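(* Let $V(\omega,\Lambda,M)$ be an irreducible admissible representation of $S_\infty\times S_\infty$ over $\mathbb{C}$, with $\omega=(\alpha,\beta)\in\Omega$. If either $\gamma(\alpha,\beta)<1$, or $\alpha_i>0$ for all $i$, or $\beta_i>0$ for all $i$, then $$\mathrm{lAnn}_{\mathbb{C}S_\infty}V(\omega,\Lambda,M)=0=\mathrm{rAnn}_{\mathbb{C}S_\infty}V(\omega,\Lambda,M).$$ In the remaining cases, set $m:=\max\{i\mid\alpha_i\ne0\}$, $n:=\max\{i\mid\beta_i\neq0\}$ (with $\max\emptyset=0$), $\lambda=\Lambda(0)$ and $\mu=M(0)$. Assume the Vershik--Nessonov quasi-equivalence claim stated in the context. Then $$\mathrm{lAnn}_{\mathbb{C}S_\infty}V(\omega,\Lambda,M)=I_{(\infty^m,n+\lambda_1,n+\lambda_2,\ldots)}\quad\text{and}\quad \mathrm{rAnn}_{\mathbb{C}S_\infty}V(\omega,\Lambda,M)=I_{(\infty^m,n+\mu_1,n+\mu_2,\ldots)}.$$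
   Context: $S_n$ is the symmetric group on $\{1,\dots,n\}$, $S_\infty=\bigcup_nS_n$, $\mathbb{C}S_\infty=\bigcup_n\mathbb{C}S_n$. $S_\infty[d]<S_\infty$ is the subgroup fixing $1,\dots,d$ pointwise (canonically isomorphic to $S_\infty$). $\mathrm{lAnn}\,V$ (resp. $\mathrm{rAnn}\,V$) is the annihilator ideal in $\mathbb{C}S_\infty$ of the restriction of $V$ to the left (resp. right) factor of $S_\infty\times S_\infty$. $D^\nu$ is the simple $\mathbb{C}S_n$-module (Specht module) of a partition $\nu\vdash n$; $\ell(\nu)$ is the number of non-zero parts and $\nu^t$ the transpose. Thoma simplex: $\Omega$ is the set of pairs $\omega=(\alpha,\beta)$ of sequences in $[0,1]$ with $\alpha_1\ge\alpha_2\ge\cdots$, $\beta_1\ge\beta_2\ge\cdots$, $\gamma(\alpha,\beta):=\sum_i(\alpha_i+\beta_i)\le1$. The extreme character $\chi^\omega$ of $S_\infty$ is $\chi^\omega(\sigma)=\prod_c\left(\sum_i\alpha_i^{|c|}+(-1)^{|c|-1}\sum_i\beta_i^{|c|}\right)$, product over cycles $c$ of $\sigma$ of length $|c|\ge2$. $T^\omega$ is the irreducible unitary representation of $S_\infty\times S_\infty$ having a unit vector $v$ fixed by the diagonal subgroup with $((g,e)v,v)=\chi^\omega(g)$ for all $g\in S_\infty$. Admissible representations (Olshanski, Okounkov): Let $K_d=\{(g,g)\mid g\in S_\infty[d]\}$. A unitary representation $V$ of $S_\infty\times S_\infty$ is admissible if $\bigcup_dV^{K_d}$ is dense in $V$.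 A Young distribution of size $d$ is a function from $[-1,1]$ to the set of finite partitions such that the sum of the sizes of all its values is $d$ (so all but finitely many values are $\varnothing$). By Okounkov's classification, the irreducible admissible representations are, up to isomorphism, the $V(\omega,\Lambda,M)$, where $\omega\in\Omega$ and $\Lambda,M$ are Young distributions of the same size $d$ (the depth) such that $\ell(\Lambda(x))+\ell(M(x))\le\#\{i\mid\alpha_i=x\}$ for $x>0$ and $\ell(\Lambda(x)^t)+\ell(M(x)^t)\le\#\{j\mid\beta_j=-x\}$ for $x<0$. Here $V=V(\omega,\Lambda,M)$ is characterised as follows: $d$ is the minimal integer with $V^{K_d}\ne0$. Let $P_d$ be the orthogonal projection onto $V^{K_d}$ and, for $1\le i\le d$ and any $N>d$, let $A_i$ (resp. $B_i$) be the operator on $V^{K_d}$ given by $P_d$ composed with the action of the transposition $(i\,N)$ of the left (resp. right) factor (this is independent of $N$). Then $V^{K_d}\cong U_\Lambda\boxtimes U_M$, where the left $S_d$ and the $A_i$ act on $U_\Lambda$, the right $S_d$ and the $B_i$ act on $U_M$, and $U_\Lambda$ is the module induced to $S_d$ from the Young subgroup $\prod_xS_{|\Lambda(x)|}$ of $\boxtimes_xD^{\Lambda(x)}$ on which $A_i$ acts by the scalar $x$ whenever $i$ belongs to the block of $x$ (with $\sigma A_i\sigma^{-1}=A_{\sigma(i)}$ for $\sigma\in S_d$); similarly for $U_M$ with $M$ and $B_i$. Moreover $((g,e)v,v)=\chi^\omega(g)(v,v)$ for $v\in V^{K_d}$, $g\in S_\infty[d]$, where $\chi^\omega$ is evaluated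 via $S_\infty[d]\simeq S_\infty$. In particular the restriction of $V$ to $S_\infty[d]\times S_\infty[d]$ has a direct summand isomorphic to $T^\omega$. Vershik--Nessonov quasi-equivalence claim: for every irreducible admissible representation $V(\omega,\Lambda,M)$, with $\lambda=\Lambda(0)$ and $r=|\lambda|$, the restriction of $V(\omega,\Lambda,M)$ to the left copy of $S_\infty$ is quasi-equivalent, as a unitary representation of $S_\infty$, to $\mathrm{Ind}^{S_\infty}_{S_r\times S_\infty[r]}(D^\lambda\boxtimes T^\omega)$, where $T^\omega$ is regarded as a representation of $S_\infty[r]\simeq S_\infty$ by restriction to the left factor. An $\infty$-partition is a non-increasing function $\nu:\mathbb{Z}_{>0}\to\mathbb{N}\cup\{\infty\}$ with $\sum_i\nu_i=\infty$. For such $\nu$, $I_\nu$ is the (prime) ideal of $\mathbb{C}S_\infty$ with $I_\nu\cap\mathbb{C}S_n=\bigcap_{\kappa\vdash n,\,\kappa\subset\nu}\mathrm{Ann}(D^\kappa)$ for all $n\geq 1$, where $\kappa\subset\nu$ means $\kappa_i\le\nu_i$ for all $i$. The notation $(\infty^m,n+\lambda_1,n+\lambda_2,\ldots)$ means $m$ entries $\infty$ followed by $n+\lambda_1,n+\lambda_2,\dots$ (with $\lambda_i=0$ for $i>\ell(\lambda)$). *)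

(* Defs.v *)
From HB Require Import structures.
From mathcomp Require Import all_boot all_order all_algebra all_fingroup.
From mathcomp Require Import sesquilinear complex finmap.
From mathcomp Require Import all_classical all_reals all_analysis.

Set Implicit Arguments.
Unset Strict Implicit.
Unset Printing Implicit Defensive.
Import Order.TTheory GRing.Theory Num.Theory numFieldNormedType.Exports.
Local Open Scope classical_set_scope.
Local Open Scope card_scope.
Local Open Scope ring_scope.

(* Conventions.  The complex numbers are R[i] for an arbitrary R : realType.
   All indices start at 0: S_oo permutes {0, 1, 2, ...}, S_n permutes 'I_n,
   and alpha i stands for the (i+1)-st Thoma parameter.
   Permutations multiply as in MathComp, (g * h) i = h (g i), so that
   'S_n -> S_oo is a group morphism.  Passing from the right-to-left product
   to this one through g |-> g^-1 fixes transpositions, cycle types and all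
   the subgroups involved; the only visible effect is that conjugation reads
   sigma A_i sigma^-1 = A_(sigma^-1 i). *)

#[local] Obligation Tactic := idtac.

(** * The infinite symmetric group *)

Record Sinf := FinPerm {
  sfun :> nat -> nat;
  sinv : nat -> nat;
  sfunK : cancel sfun sinv;
  sinvK : cancel sinv sfun;
  sfin : exists n, forall i, (n <= i)%N -> sfun i = i }.

HB.instance Definition _ := gen_eqMixin Sinf.
HB.instance Definition _ := gen_choiceMixin Sinf.

Lemma Sinf_eq (g h : Sinf) : sfun g =1 sfun h -> g = h.
Proof.
case: g h => [f f' fK f'K ff] [k k' kK k'K kf] /= fk'.
have fk : f = k by exact: funext.
move: kK k'K kf; rewrite -{}fk => kK k'K kf.
have f'k' : f' = k' by apply: funext => i; rewrite -{1}(k'K i) fK.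
by move: kK k'K kf; rewrite -{}f'k' => *; congr FinPerm; exact: Prop_irrelevance.
Qed.

Program Definition Sinf_one : Sinf := @FinPerm id id _ _ _.
Next Obligation. by []. Qed.
Next Obligation. by []. Qed.
Next Obligation. by exists 0%N. Qed.

Program Definition Sinf_inv (g : Sinf) : Sinf := @FinPerm (sinv g) g _ _ _.
Next Obligation. move=> g; exact: sinvK. Qed.
Next Obligation. move=> g; exact: sfunK. Qed.
Next Obligation.
move=> g; have [n gn] := sfin g; exists n => i ni; rewrite -[X in sinv g X](gn i ni) sfunK //.
Qed.

Program Definition Sinf_mul (g h : Sinf) : Sinf :=
  @FinPerm (h \o g) (sinv g \o sinv h) _ _ _.
Next Obligation. by move=> g h i /=; rewrite !sfunK. Qed.
Next Obligation. by move=> g h i /=; rewrite !sinvK. Qed.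
Next Obligation.
move=> g h; have [n gn] := sfin g; have [m hm] := sfin h; exists (maxn n m) => i.
by rewrite geq_max => /andP[ni mi] /=; rewrite gn ?hm.
Qed.

Fact Sinf_mulA : associative Sinf_mul.
Proof. by move=> *; apply: Sinf_eq. Qed.
Fact Sinf_mul1 : left_id Sinf_one Sinf_mul.
Proof. by move=> *; apply: Sinf_eq. Qed.
Fact Sinf_1mul : right_id Sinf_one Sinf_mul.
Proof. by move=> *; apply: Sinf_eq. Qed.
Fact Sinf_mulV : left_inverse Sinf_one Sinf_inv Sinf_mul.
Proof. by move=> g; apply: Sinf_eq => i /=; rewrite sinvK. Qed.
Fact Sinf_Vmul : right_inverse Sinf_one Sinf_inv Sinf_mul.
Proof. by move=> g; apply: Sinf_eq => i /=; rewrite sfunK. Qed.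

HB.instance Definition _ := isGroup.Build Sinf
  Sinf_mulA Sinf_mul1 Sinf_1mul Sinf_mulV Sinf_Vmul.

Definition perm_nat n (s : 'S_n) (i : nat) : nat :=
  if insub i is Some j then val (s j) else i.

Lemma perm_natK n (s t : 'S_n) : cancel s t -> cancel (perm_nat s) (perm_nat t).
Proof.
move=> st i; rewrite {2}/perm_nat; case: insubP => [j _ <-|ni].
  by rewrite /perm_nat valK st.
by rewrite /perm_nat insubN.
Qed.

(* The inclusion of S_n in S_oo. *)
Program Definition embS n (s : 'S_n) : Sinf :=
  @FinPerm (perm_nat s) (perm_nat s^-1%g) _ _ _.
Next Obligation. by move=> n s; apply: perm_natK; exact: permK. Qed.
Next Obligation. by move=> n s; apply: perm_natK; exact: permKV. Qed.
Next Obligation.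
by move=> n s; exists n => i ni; rewrite /perm_nat insubN // -leqNgt.
Qed.

(* S_oo[d]. *)
Definition Sfix (d : nat) : set Sinf :=
  [set g | forall i, (i < d)%N -> g i = i].

Definition shift_nat (d : nat) (f : nat -> nat) (i : nat) : nat :=
  if (i < d)%N then i else (d + f (i - d))%N.

Lemma shift_natK d f g : cancel f g -> cancel (shift_nat d f) (shift_nat d g).
Proof.
move=> fK i; rewrite {2}/shift_nat; case: ltnP => id; rewrite /shift_nat.
  by rewrite id.
by rewrite ltnNge leq_addr /= addKn fK subnKC.
Qed.

(* The canonical isomorphism of S_oo onto S_oo[d]. *)
Program Definition shiftS (d : nat) (g : Sinf) : Sinf :=
  @FinPerm (shift_nat d g) (shift_nat d (sinv g)) _ _ _.
Next Obligation. by move=> d g; apply: shift_natK; exact: sfunK. Qed.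
Next Obligation. by move=> d g; apply: shift_natK; exact: sinvK. Qed.
Next Obligation.
move=> d g; have [n gn] := sfin g; exists (d + n)%N => i dni.
have di : (d <= i)%N := leq_trans (leq_addr n d) dni.
by rewrite /shift_nat ltnNge di /= gn ?subnKC // leq_subRL.
Qed.

Definition swap_nat (i j k : nat) : nat :=
  if k == i then j else if k == j then i else k.

Lemma swap_natK i j : involutive (swap_nat i j).
Proof.
move=> k; rewrite {2}/swap_nat; case: eqVneq => [->|ki].
  by rewrite /swap_nat eqxx; case: eqVneq.
by case: eqVneq => [->|kj]; rewrite /swap_nat ?eqxx // (negPf ki) (negPf kj).
Qed.

Program Definition transS (i j : nat) : Sinf :=
  @FinPerm (swap_nat i j) (swap_nat i j) (swap_natK i j) (swap_natK i j) _.
Next Obligation.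
move=> i j; exists (maxn i j).+1 => k; rewrite gtn_max => /andP[ik jk].
by rewrite /swap_nat !gtn_eqF.
Qed.

(** * Hilbert spaces and unitary representations *)

Record hilbert (R : realType) := Hilbert {
  hspace :> completeNormedModType R[i];
  hdot : {dot hspace for (Num.conj : R[i] -> R[i])};
  hdotE : forall u, hdot u u = `|u| ^+ 2 }.

Notation "''[' u , v ]" := (hdot _ u v) : ring_scope.

Record unitary_rep (R : realType) (G : groupType) (H : hilbert R) :=
  UnitaryRep {
    rep_op :> G -> {linear H -> H};
    rep1 : forall u, rep_op 1%g u = u;
    repM : forall g h u, rep_op (g * h)%g u = rep_op g (rep_op h u);
    rep_dot : forall g u v, '[rep_op g u, rep_op g v] = '[u, v] }.

Program Definition lres (R : realType) (G : groupType) (H : hilbert R)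
    (pi : unitary_rep (G * G)%type H) : unitary_rep G H :=
  @UnitaryRep R G H (fun g => pi (g, 1%g)) _ _ _.
Next Obligation. by move=> *; exact: rep1. Qed.
Next Obligation.
by move=> R G H pi g h u; rewrite -repM; congr (pi (_, _) u); rewrite mulg1.
Qed.
Next Obligation. by move=> *; exact: rep_dot. Qed.

Program Definition rres (R : realType) (G : groupType) (H : hilbert R)
    (pi : unitary_rep (G * G)%type H) : unitary_rep G H :=
  @UnitaryRep R G H (fun g => pi (1%g, g)) _ _ _.
Next Obligation. by move=> *; exact: rep1. Qed.
Next Obligation.
by move=> R G H pi g h u; rewrite -repM; congr (pi (_, _) u); rewrite mulg1.
Qed.
Next Obligation. by move=> *; exact: rep_dot. Qed.

Section Representations.
Variables (R : realType) (G : groupType).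
Implicit Type H : hilbert R.

Definition closed_subspace H (A : set H) : Prop :=
  [/\ closed A, A 0 & forall (c : R[i]) u v, A u -> A v -> A (c *: u + v)].

Definition subrep H (rho : unitary_rep G H) (A : set H) : Prop :=
  closed_subspace A /\ forall g u, A u -> A (rho g u).

Definition irreducible_rep H (rho : unitary_rep G H) : Prop :=
  (exists u : H, u != 0) /\
  forall A, subrep rho A -> A = [set 0] \/ A = setT.

(* The subrepresentations A of rho and A' of rho' are unitarily equivalent. *)
Definition subrep_equiv H (rho : unitary_rep G H) (A : set H)
    H' (rho' : unitary_rep G H') (A' : set H') : Prop :=
  exists U : {linear H -> H'},
    [/\ U @` A = A',
        forall u v, A u -> A v -> '[U u, U v] = '[u, v]
      & forall g u, A u -> U (rho g u) = rho' g (U u)].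

Definition disjoint_subrep H (rho : unitary_rep G H) (A : set H)
    H' (rho' : unitary_rep G H') : Prop :=
  forall B B', subrep rho B -> B `<=` A -> subrep rho' B' ->
    subrep_equiv rho B rho' B' -> B = [set 0].

(* Quasi-equivalence: no non-zero subrepresentation of either one is disjoint
   from the other. *)
Definition quasi_equiv H (rho : unitary_rep G H)
    H' (rho' : unitary_rep G H') : Prop :=
  (forall A, subrep rho A -> A <> [set 0] -> ~ disjoint_subrep rho A rho') /\
  (forall A, subrep rho' A -> A <> [set 0] -> ~ disjoint_subrep rho' A rho).

(* rho is unitarily equivalent to the representation of G induced from the
   representation tau of K, where iota embeds K in G: the space of rho is the
   Hilbert sum, over the cosets g (iota K), of the translates by g of a copy
   of tau. *)
Definition is_induced (K : groupType) (iota : K -> G)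
    W (tau : unitary_rep K W) H (rho : unitary_rep G H) : Prop :=
  exists j : {linear W -> H},
    [/\ forall u v, '[j u, j v] = '[u, v],
        forall k u, rho (iota k) (j u) = j (tau k u),
        forall g u v, ~ range iota g -> '[rho g (j u), j v] = 0
      & forall A : set H, closed_subspace A ->
          (forall g u, A (rho g (j u))) -> A = setT].

(* The relation w = P_A u, for P_A the orthogonal projection on A. *)
Definition is_proj H (A : set H) (u w : H) : Prop :=
  A w /\ forall z, A z -> '[u - w, z] = 0.

(* Elements of the group algebra of G are finitely supported functions. *)
Definition group_algebra := {fsfun G -> R[i] with 0}.

Definition Ann H (rho : unitary_rep G H) : set group_algebra :=
  [set a | forall u, \sum_(g <- finsupp a) a g *: rho g u = 0].

End Representations.

Definition lAnn (R : realType) (G : groupType) (H : hilbert R)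
    (pi : unitary_rep (G * G)%type H) : set (group_algebra R G) :=
  Ann (lres pi).
Definition rAnn (R : realType) (G : groupType) (H : hilbert R)
    (pi : unitary_rep (G * G)%type H) : set (group_algebra R G) :=
  Ann (rres pi).

(** * Modules over the finite symmetric groups *)

Section FiniteGroupAlgebra.
Variables (R : realType) (gT : finGroupType).

Definition fin_group_algebra := {ffun gT -> R[i]^o}.
Implicit Types u w : fin_group_algebra.

Definition conv u w : fin_group_algebra :=
  [ffun g => \sum_h (u h * w (h^-1 * g)%g)].

Definition ltrans (s : gT) u : fin_group_algebra :=
  [ffun g => u (s^-1 * g)%g].

Definition left_ideal w : set fin_group_algebra :=
  [set conv u w | u in setT].

Definition dotf u w : R[i] := \sum_g u g * (w g)^*.

End FiniteGroupAlgebra.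

Definition is_partition (nu : seq nat) : bool :=
  sorted geq nu && all (leq 1) nu.

Definition transpose_part (nu : seq nat) : seq nat :=
  [seq count (leq j.+1) nu | j <- iota 0 (head 0%N nu)].

Section Young.
Variable R : realType.

Definition young_symmetrizer n (T1 T2 : eqType) (row : 'I_n -> T1)
    (col : 'I_n -> T2) : fin_group_algebra R 'S_n :=
  [ffun s => \sum_(p : 'S_n | [forall i, row (p i) == row i])
             \sum_(q : 'S_n | [forall i, col (q i) == col i] && (p * q == s)%g)
               (-1) ^+ (q : bool)].

(* D^nu, for nu a partition of n: the left ideal generated by the Young
   symmetrizer of the tableau filled row after row, in which i sits in row
   reshape_index nu i and in column reshape_offset nu i. *)
Definition specht n (nu : seq nat) : set (fin_group_algebra R 'S_n) :=
  left_ideal (young_symmetrizer (fun i : 'I_n => reshape_index nu i)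
                                (fun i : 'I_n => reshape_offset nu i)).

Record young_dist := YoungDist {
  yd :> {fsfun R -> seq nat with [::]};
  yd_partition : forall x, is_partition (yd x);
  yd_supp : forall x, yd x != [::] -> -1 <= x <= 1 }.

Implicit Types L M : young_dist.

Definition yd_shape L : seq nat := [seq sumn (L x) | x <- finsupp L].
Definition yd_size L : nat := sumn (yd_shape L).

(* {0, ..., yd_size L - 1} is cut into consecutive blocks of sizes |L x|, for
   x in the support of L; yd_val L i is the x of the block of i, and
   yd_row L i, yd_col L i are the row and column of i in the tableau of shape
   L x filling this block. *)
Definition yd_val L (i : nat) : R :=
  nth 0 (finsupp L) (reshape_index (yd_shape L) i).
Definition yd_row L (i : nat) : nat :=
  reshape_index (L (yd_val L i)) (reshape_offset (yd_shape L) i).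
Definition yd_col L (i : nat) : nat :=
  reshape_offset (L (yd_val L i)) (reshape_offset (yd_shape L) i).

(* U_L, for d = yd_size L.  With Y the Young subgroup preserving the blocks,
   the product c in C[Y] of the Young symmetrizers of the blocks generates the
   left ideal C[Y] c, which is the outer tensor product of the D^(L x), and
   the induced module C[S_d] (x)_{C[Y]} C[Y] c is C[S_d] c. *)
Definition yd_module d L : set (fin_group_algebra R 'S_d) :=
  left_ideal (young_symmetrizer (fun i : 'I_d => (yd_val L i, yd_row L i))
                                (fun i : 'I_d => (yd_val L i, yd_col L i))).

Definition outer_tensor d (U W : set (fin_group_algebra R 'S_d)) :
    set {ffun 'S_d * 'S_d -> R[i]^o} :=
  [set f | exists k (u w : 'I_k -> fin_group_algebra R 'S_d),
     (forall l, U (u l) /\ W (w l)) /\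
     f = [ffun p => \sum_l u l p.1 * w l p.2]].

Definition act2 d (s t : 'S_d) (f : {ffun 'S_d * 'S_d -> R[i]^o}) :
    {ffun 'S_d * 'S_d -> R[i]^o} :=
  [ffun p => f ((s^-1 * p.1)%g, (t^-1 * p.2)%g)].

(* A_i and B_i on U_L (x) U_M: on the basis vector g of C[S_d], A_i is the
   scalar yd_val L (g i), since g^-1 A_i g = A_(g i). *)
Definition jmA L d (i : 'I_d) (f : {ffun 'S_d * 'S_d -> R[i]^o}) :
    {ffun 'S_d * 'S_d -> R[i]^o} :=
  [ffun p : 'S_d * 'S_d => (yd_val L (p.1 i))%:C%C * f p].
Definition jmB M d (i : 'I_d) (f : {ffun 'S_d * 'S_d -> R[i]^o}) :
    {ffun 'S_d * 'S_d -> R[i]^o} :=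
  [ffun p : 'S_d * 'S_d => (yd_val M (p.2 i))%:C%C * f p].

End Young.

(** * Thoma parameters and admissible representations *)

Section Admissible.
Variable R : realType.

(* The sum of the parameters, as an extended real so that it always exists. *)
Definition gamma (alpha beta : nat -> R) : \bar R :=
  (\sum_(i <oo) (alpha i + beta i)%:E)%E.

Record thoma := Thoma {
  alpha : nat -> R;
  beta : nat -> R;
  alpha01 : forall i, 0 <= alpha i <= 1;
  beta01 : forall i, 0 <= beta i <= 1;
  alpha_noninc : forall i j, (i <= j)%N -> alpha j <= alpha i;
  beta_noninc : forall i j, (i <= j)%N -> beta j <= beta i;
  gamma_le1 : (gamma alpha beta <= 1)%E }.

Definition chi (w : thoma) n (s : 'S_n) : R :=
  \prod_(c in porbits s | (2 <= #|c|)%N)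
    (limn (series (fun i => alpha w i ^+ #|c|)) +
     (-1) ^+ #|c|.-1 * limn (series (fun i => beta w i ^+ #|c|))).

Definition is_Tomega (w : thoma) (H : hilbert R)
    (T : unitary_rep (Sinf * Sinf)%type H) : Prop :=
  irreducible_rep T /\
  exists v : H,
    [/\ '[v, v] = 1,
        forall g : Sinf, T (g, g) v = v
      & forall n (s : 'S_n), '[T (embS s, 1%g) v, v] = (chi w s)%:C%C].

Definition Kfix (H : hilbert R) (V : unitary_rep (Sinf * Sinf)%type H)
    (d : nat) : set H :=
  [set v | forall g, Sfix d g -> V (g, g) v = v].

Definition admissible (H : hilbert R)
    (V : unitary_rep (Sinf * Sinf)%type H) : Prop :=
  dense (\bigcup_d Kfix V d).

(* V is (isomorphic to) V(w, L, M). *)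
Record is_V (H : hilbert R) (V : unitary_rep (Sinf * Sinf)%type H)
    (w : thoma) (L M : young_dist R) : Prop := IsV {
  isV_irreducible : irreducible_rep V;
  isV_admissible : admissible V;
  isV_size : yd_size M = yd_size L;
  isV_pos : forall x : R, 0 < x ->
    `I_(size (L x) + size (M x)) #<= [set i | alpha w i = x];
  isV_neg : forall x : R, x < 0 ->
    `I_(size (transpose_part (L x)) + size (transpose_part (M x)))
      #<= [set j | beta w j = - x];
  isV_depth : Kfix V (yd_size L) <> [set 0];
  isV_depth_min : forall e, (e < yd_size L)%N -> Kfix V e = [set 0];
  isV_module : let d := yd_size L in
    let U := outer_tensor (yd_module (d := d) L) (yd_module (d := d) M) in
    exists Phi : {linear {ffun 'S_d * 'S_d -> R[i]^o} -> H},
      [/\ set_bij U (Kfix V d) Phi,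
          forall s t f, U f -> V (embS s, embS t) (Phi f) = Phi (act2 s t f),
          forall (i : 'I_d) N f, (d <= N)%N -> U f ->
            is_proj (Kfix V d) (V (transS i N, 1%g) (Phi f)) (Phi (jmA L i f))
        & forall (i : 'I_d) N f, (d <= N)%N -> U f ->
            is_proj (Kfix V d) (V (1%g, transS i N) (Phi f)) (Phi (jmB M i f))];
  isV_char : let d := yd_size L in
    forall v, Kfix V d v -> forall n (s : 'S_n),
      '[V (shiftS d (embS s), 1%g) v, v] = (chi w s)%:C%C * '[v, v] }.

(* tau is D^nu (x) T, as a representation of S_r x S_oo, for nu a partition of
   r.  The inner product on D^nu is the restriction of the standard one of
   C[S_r]; invariant inner products on D^nu are proportional. *)
Definition is_specht_tensor r (nu : seq nat)
    (H : hilbert R) (T : unitary_rep Sinf H)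
    (W : hilbert R) (tau : unitary_rep ('S_r * Sinf)%type W) : Prop :=
  exists b : {bilinear fin_group_algebra R 'S_r -> H -> W},
    let D := @specht R r nu in
    [/\ forall u u' t t', D u -> D u' ->
          '[b u t, b u' t'] = dotf u u' * '[t, t'],
        forall s h u t, D u -> tau (s, h) (b u t) = b (ltrans s u) (T h t)
      & forall A : set W, closed_subspace A ->
          (forall u t, D u -> A (b u t)) -> A = setT].

(* The inclusion S_r x S_oo = S_r x S_oo[r] -> S_oo. *)
Definition young_emb r (k : 'S_r * Sinf) : Sinf :=
  (embS k.1 * shiftS r k.2)%g.

(* The restriction of V(w, L, M) to the left factor is quasi-equivalent to
   Ind (D^(L 0) (x) T^w); both T^w and Ind are determined up to unitary
   equivalence. *)
Definition VershikNessonov : Prop :=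
  forall (H : hilbert R) (V : unitary_rep (Sinf * Sinf)%type H)
         (w : thoma) (L M : young_dist R),
  is_V V w L M ->
  let r := sumn (L 0) in
  exists (HT : hilbert R) (T : unitary_rep (Sinf * Sinf)%type HT)
         (W : hilbert R) (tau : unitary_rep ('S_r * Sinf)%type W)
         (HI : hilbert R) (I : unitary_rep Sinf HI),
    [/\ is_Tomega w T,
        is_specht_tensor (L 0) (lres T) tau,
        is_induced (young_emb (r := r)) tau I
      & quasi_equiv (lres V) I].

End Admissible.

(** * The ideals I_nu *)

(* Entries of an oo-partition, None standing for oo. *)
Definition le_inf (a b : option nat) : bool :=
  match a, b with
  | _, None => true
  | None, Some _ => false
  | Some k, Some l => (k <= l)%N
  end.

Definition is_inf_partition (nu : nat -> option nat) : Prop :=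
  (forall i j, (i <= j)%N -> le_inf (nu j) (nu i)) /\
  ((exists i, nu i = None) \/
   forall B, exists k, (B <= \sum_(i < k) odflt 0 (nu i))%N).

Definition sub_inf (kappa : seq nat) (nu : nat -> option nat) : Prop :=
  forall i, le_inf (Some (nth 0%N kappa i)) (nu i).

(* (oo^m, n + lambda_1, n + lambda_2, ...). *)
Definition inf_part (m n : nat) (lambda : seq nat) (i : nat) : option nat :=
  if (i < m)%N then None else Some (n + nth 0 lambda (i - m))%N.

Section Ideals.
Variable R : realType.

Definition CS (n : nat) : set (group_algebra R Sinf) :=
  [set a | forall g, g \in finsupp a -> range (@embS n) g].

Definition restr n (a : group_algebra R Sinf) : fin_group_algebra R 'S_n :=
  [ffun s => a (embS s)].

Definition AnnD n (kappa : seq nat) : set (group_algebra R Sinf) :=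
  [set a | CS n a /\ forall u, @specht R n kappa u -> conv (restr n a) u = 0].

(* J = I_nu; as C[S_oo] is the union of the C[S_n], the intersections
   determine J. *)
Definition is_I (nu : nat -> option nat) (J : set (group_algebra R Sinf)) :
    Prop :=
  is_inf_partition nu /\
  forall n, (1 <= n)%N ->
    J `&` CS n =
    CS n `&` \bigcap_(kappa in [set k | is_partition k /\ sumn k = n /\
                                        sub_inf k nu]) AnnD n kappa.

(* m = max {i >= 1 | the i-th term of a is non-zero}, with max of the empty
   set equal to 0; the i-th term is a (i - 1). *)
Definition is_max_index (a : nat -> R) (m : nat) : Prop :=
  (forall i, a i != 0 -> (i < m)%N) /\ (m = 0%N \/ a m.-1 != 0).

End Ideals.

(* Main.v *)
(* Restricted to one factor, V contains a vector whose state on S_oo[d] is the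
   Thoma character.  For finitely many parameters, and no defect, the character
   is a positive combination chi(s) = sum_x wt(x) e_x(s) over the words x in m
   even and n odd letters, where e_x is the sign character of the odd letters
   on the stabilizer of x; in general it is approximated by such sums, with an
   additional letter of weight 1 - gamma fixed by the stabilizers.  In the zero
   case there are, on any finite set, words with trivial stabilizer whose weight
   stays away from 0, so the state is faithful on C[S_k].

   In the other case quasi-equivalence reduces Ann V to Ann Ind.  The induced
   representation has a cyclic vector xi such that y xi = 0 if and only if
   y (c_lambda (x) e_x) = 0 for all words x, where c_lambda is the Young
   symmetrizer.  By Garnir relations, symmetrizing over a block of points lets
   rectangles killed by e grow by one row, and antisymmetrizing by one column;
   hence c_nu kills these elements as soon as nu is not contained in
   (oo^m, n + lambda).  If nu is contained in it, filling its first m rows with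
   even letters and its first n columns with odd ones gives a non-zero
   trace. *)

From HB Require Import structures.
Require Import Defs.
From mathcomp Require Import all_boot all_order all_algebra all_fingroup.
From mathcomp Require Import sesquilinear complex finmap ring.
From mathcomp Require Import all_classical all_reals all_analysis.
Set Implicit Arguments.
Unset Strict Implicit.
Unset Printing Implicit Defensive.
Import Order.TTheory GRing.Theory Num.Theory numFieldNormedType.Exports.
Local Open Scope ring_scope.

(** * Group algebras of finite groups *)

(** The argument stays inside group algebras of finite groups; positivity of [tr (star a * a)] takes
    the place of semisimplicity, branching rules and dimension formulas. The elements of C[S_N]
    killing the induced representation form a two-sided ideal, which is compared with one Young
    symmetrizer c_nu at a time: it contains c_nu or it kills the left ideal of c_nu ([young_ann]).
    One inclusion thus needs a vector not killed by c_nu; the other needs that c_nu acts by zero,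
    together with the fact that the c_nu generate the unit ideal. Words are what makes T^w
    computable: no model of its space is at hand, but a positive combination of the e_x turns the
    norm of y xi into traces in a finite group algebra. Symmetrizers are left unnormalised, hence
    idempotent only up to a non-zero scalar, which explains the many cancellations of orders of
    stabilizers. The quasi-equivalence claim speaks of the left factor; the right annihilator is
    reached by exchanging the factors, which turns V(w, L, M) into V(w, M, L). *)

Section Galg.
Variables (C : numClosedFieldType) (gT : finGroupType).

Definition galg := {ffun gT -> C^o}.
Implicit Types (a b c : galg) (g h : gT).

HB.instance Definition _ := GRing.Lmodule.on galg.

Definition gmul a b : galg := [ffun g => \sum_h (a h * b (h^-1 * g)%g)].
Definition gel g : galg := [ffun h => (h == g)%:R].

Lemma gmulA : associative gmul.
Proof.
move=> a b c; apply/ffunP => g; rewrite !ffunE.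
under eq_bigr => h _ do rewrite ffunE mulr_sumr.
under [RHS]eq_bigr => h _ do rewrite ffunE mulr_suml.
rewrite [RHS]exchange_big /=; apply: eq_bigr => h _.
rewrite (reindex_inj (mulgI h^-1%g)) /=; apply: eq_bigr => k _.
by rewrite mulrA invMg invgK -mulgA mulKVg.
Qed.

Lemma gmul1 : left_id (gel 1%g) gmul.
Proof.
move=> a; apply/ffunP => g; rewrite ffunE (bigD1 1%g) //= big1 ?addr0.
  by rewrite ffunE eqxx mul1r invg1 mul1g.
by move=> h /negPf h1; rewrite ffunE h1 mul0r.
Qed.

Lemma gmulr1 : right_id (gel 1%g) gmul.
Proof.
move=> a; apply/ffunP => g; rewrite ffunE (bigD1 g) //= big1 ?addr0.
  by rewrite ffunE mulVg eqxx mulr1.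
by move=> h hg; rewrite ffunE -eq_mulVg1 (negPf hg) mulr0.
Qed.

Lemma gmulDl : left_distributive gmul +%R.
Proof.
move=> a b c; apply/ffunP => g; rewrite !ffunE -big_split /=.
by apply: eq_bigr => h _; rewrite !ffunE mulrDl.
Qed.

Lemma gmulDr : right_distributive gmul +%R.
Proof.
move=> a b c; apply/ffunP => g; rewrite !ffunE -big_split /=.
by apply: eq_bigr => h _; rewrite !ffunE mulrDr.
Qed.

Lemma gel1_neq0 : gel 1%g != 0.
Proof. by apply/eqP => /ffunP/(_ 1%g); rewrite !ffunE eqxx => /eqP; rewrite oner_eq0. Qed.

HB.instance Definition _ := GRing.Zmodule_isNzRing.Build galg
  gmulA gmul1 gmulr1 gmulDl gmulDr gel1_neq0.

Lemma gmul_scalel (k : C) a b : k *: (a * b) = (k *: a) * b.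
Proof.
apply/ffunP => g; rewrite !ffunE /GRing.scale /= mulr_sumr.
by apply: eq_bigr => h _; rewrite ffunE mulrA.
Qed.
HB.instance Definition _ := GRing.Lmodule_isLalgebra.Build C galg gmul_scalel.

Lemma gmul_scaler (k : C) a b : k *: (a * b) = a * (k *: b).
Proof.
apply/ffunP => g; rewrite !ffunE /GRing.scale /= mulr_sumr.
by apply: eq_bigr => h _; rewrite ffunE mulrCA.
Qed.
HB.instance Definition _ := GRing.Lalgebra_isAlgebra.Build C galg gmul_scaler.

Lemma gmulE a b g : (a * b) g = \sum_h (a h * b (h^-1 * g)%g).
Proof. by rewrite ffunE. Qed.

Lemma galg_addE a b g : (a + b) g = a g + b g. Proof. by rewrite ffunE. Qed.
Lemma galg_oppE a g : (- a) g = - a g. Proof. by rewrite ffunE. Qed.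
Lemma galg_scaleE (k : C) a g : (k *: a) g = k * a g. Proof. by rewrite ffunE. Qed.
Lemma galg_sumE I (r : seq I) (P : pred I) (F : I -> galg) g :
  (\sum_(i <- r | P i) F i) g = \sum_(i <- r | P i) F i g.
Proof. by rewrite sum_ffunE. Qed.
Lemma galg0E g : (0 : galg) g = 0. Proof. by rewrite ffunE. Qed.

Lemma gelE g h : gel g h = (h == g)%:R. Proof. by rewrite ffunE. Qed.

Lemma mul_gell g a h : (gel g * a) h = a (g^-1 * h)%g.
Proof.
rewrite gmulE (bigD1 g) //= big1 ?addr0 ?gelE ?eqxx ?mul1r // => k /negPf kg.
by rewrite gelE kg mul0r.
Qed.

Lemma mul_gelr g a h : (a * gel g) h = a (h * g^-1)%g.
Proof.
rewrite gmulE (bigD1 (h * g^-1)%g) //= big1 ?addr0.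
  by rewrite gelE invMg invgK -mulgA mulVg mulg1 eqxx mulr1.
move=> k /negPf kg; rewrite gelE -(can_eq (mulKg k)) mulKVg.
by rewrite -(can_eq (mulgK g^-1)%g) mulgK eq_sym kg mulr0.
Qed.

Lemma gelM g h : gel (g * h) = gel g * gel h.
Proof.
apply/ffunP => k; rewrite mul_gell !gelE; congr (nat_of_bool _)%:R.
by apply/eqP/eqP => [->|<-]; rewrite ?mulKg ?mulKVg.
Qed.

Lemma gel1 : gel 1 = 1. Proof. by []. Qed.

Lemma gelVK g : gel g^-1 * gel g = 1. Proof. by rewrite -gelM mulVg. Qed.

Lemma galgE a : a = \sum_g a g *: gel g.
Proof.
apply/ffunP => h; rewrite galg_sumE (bigD1 h) //= big1 ?addr0.
  by rewrite galg_scaleE gelE eqxx mulr1.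
by move=> g /negPf gh; rewrite galg_scaleE gelE eq_sym gh mulr0.
Qed.

(** The regular character divided by the order of the group; [tr (star a * a)] is the sum of the
    squared moduli of the coefficients of a. *)
Definition tr a : C := a 1%g.

Lemma tr0 : tr 0 = 0. Proof. exact: galg0E. Qed.

Lemma trC a b : tr (a * b) = tr (b * a).
Proof.
rewrite /tr !gmulE (reindex_inj invg_inj) /=; apply: eq_bigr => h _.
by rewrite invgK !mulg1 mulrC.
Qed.

Definition star a : galg := [ffun g => (a g^-1%g)^*].

Lemma starE a g : star a g = (a g^-1%g)^*. Proof. by rewrite ffunE. Qed.

Lemma starK : involutive star.
Proof. by move=> a; apply/ffunP => g; rewrite !starE invgK conjCK. Qed.

Lemma starM a b : star (a * b) = star b * star a.
Proof.
apply/ffunP => g; rewrite starE !gmulE rmorph_sum /=.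
rewrite (reindex_inj (mulgI g^-1%g)) /=.
apply: eq_bigr => h _; rewrite !starE rmorphM mulrC.
by congr (_ * _); congr (Num.conj (_ _)); rewrite invMg ?invgK // -mulgA mulgV mulg1.
Qed.

Lemma starD a b : star (a + b) = star a + star b.
Proof. by apply/ffunP => g; rewrite !(starE, galg_addE) rmorphD. Qed.

Lemma starZ (k : C) a : star (k *: a) = k^* *: star a.
Proof. by apply/ffunP => g; rewrite !(starE, galg_scaleE) rmorphM. Qed.

Lemma star0 : star 0 = 0.
Proof. by apply/ffunP => g; rewrite !(starE, galg0E) rmorph0. Qed.

Lemma star_gel g : star (gel g) = gel g^-1.
Proof. by apply/ffunP => h; rewrite starE !gelE conjC_nat eq_invg_sym eq_sym. Qed.

Lemma tr_star_mul a b : tr (star a * b) = \sum_g (a g)^* * b g.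
Proof.
rewrite /tr gmulE (reindex_inj invg_inj) /=; apply: eq_bigr => g _.
by rewrite starE !invgK mulg1.
Qed.

Lemma tr_star_ge0 a : 0 <= tr (star a * a).
Proof. by rewrite tr_star_mul sumr_ge0 // => g _; rewrite mulrC mul_conjC_ge0. Qed.

Lemma tr_star_eq0 a : tr (star a * a) = 0 -> a = 0.
Proof.
rewrite tr_star_mul => /eqP; rewrite psumr_eq0 => [/allP a0|g _]; last first.
  by rewrite mulrC mul_conjC_ge0.
apply/ffunP => g; rewrite galg0E; apply/eqP.
by rewrite -mul_conjC_eq0 mulrC; apply: a0; rewrite mem_index_enum.
Qed.

Lemma star_mul_eq0 a : star a * a = 0 -> a = 0.
Proof. by move=> a0; apply: tr_star_eq0; rewrite a0 /tr galg0E. Qed.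

Lemma selfadj_sqr0 a : star a = a -> a * a = 0 -> a = 0.
Proof. by move=> sa aa; apply: star_mul_eq0; rewrite sa. Qed.

Section Csym.
Variables (G : {group gT}) (e : gT -> bool).
Hypothesis eM : {in G &, forall g h, e (g * h)%g = e g (+) e h}.

(** Up to the factor #|G|, the projection on the character (-1)^e of G. The sign e is only asked to
    be multiplicative on G: for words it is defined through [restr_perm], a morphism only on
    permutations preserving a set. *)
Definition csym : galg := [ffun g => (g \in G)%:R * (-1) ^+ e g].

Lemma csymE g : csym g = (g \in G)%:R * (-1) ^+ e g. Proof. by rewrite ffunE. Qed.

Lemma csym_sum : csym = \sum_(g in G) (-1) ^+ e g *: gel g.
Proof.
apply/ffunP => h; rewrite galg_sumE csymE; case: (boolP (h \in G)) => hG.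
  rewrite (bigD1 h) //= big1 ?addr0 => [|g /andP[_ /negPf gh]].
    by rewrite galg_scaleE gelE eqxx mulr1 mul1r.
  by rewrite galg_scaleE gelE eq_sym gh mulr0.
rewrite mul0r big1 // => g gG; rewrite galg_scaleE gelE.
by case: eqP => [gh|_]; [rewrite gh gG in hG|rewrite mulr0].
Qed.

Lemma sgn_char1 : e 1%g = false.
Proof. by have := eM (group1 G) (group1 G); rewrite mulg1; case: (e _). Qed.

Lemma sgn_charV g : g \in G -> e g^-1%g = e g.
Proof.
by move=> gG; have := eM (groupVr gG) gG; rewrite mulVg sgn_char1; case: (e g); case: (e _).
Qed.

Lemma csym_mull g : g \in G -> gel g * csym = (-1) ^+ e g *: csym.
Proof.
move=> gG; apply/ffunP => h; rewrite mul_gell galg_scaleE !csymE.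
rewrite groupMl ?groupV //; case: (boolP (h \in G)) => hG; last by rewrite !mul0r mulr0.
by rewrite !mul1r eM ?groupV // sgn_charV // signr_addb.
Qed.

Lemma csym_mulr g : g \in G -> csym * gel g = (-1) ^+ e g *: csym.
Proof.
move=> gG; apply/ffunP => h; rewrite mul_gelr galg_scaleE !csymE.
rewrite groupMr ?groupV //; case: (boolP (h \in G)) => hG; last by rewrite !mul0r mulr0.
by rewrite !mul1r eM ?groupV // sgn_charV // signr_addb mulrC.
Qed.

Lemma star_csym : star csym = csym.
Proof.
apply/ffunP => g; rewrite starE !csymE groupV rmorphM /= rmorph_nat rmorph_sign.
by case: (boolP (g \in G)) => gG; rewrite ?mul0r // sgn_charV.
Qed.

Lemma csym_sqr : csym * csym = #|G|%:R *: csym.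
Proof.
rewrite {1}csym_sum mulr_suml scaler_nat -sumr_const; apply: eq_bigr => g gG.
by rewrite -scalerAl csym_mull // scalerA -signr_addb addbb expr0 scale1r.
Qed.

End Csym.

Lemma csym_absorbl (H G : {group gT}) (e : gT -> bool) :
  {in G &, forall g h, e (g * h)%g = e g (+) e h} -> H \subset G ->
  csym H e * csym G e = #|H|%:R *: csym G e.
Proof.
move=> eM HG; rewrite (csym_sum H) mulr_suml scaler_nat -sumr_const.
apply: eq_bigr => g gH; rewrite -scalerAl csym_mull //; last exact: (fintype.subsetP HG).
by rewrite scalerA -signr_addb addbb expr0 scale1r.
Qed.

Lemma csym_absorbr (H G : {group gT}) (e : gT -> bool) :
  {in G &, forall g h, e (g * h)%g = e g (+) e h} -> H \subset G ->
  csym G e * csym H e = #|H|%:R *: csym G e.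
Proof.
move=> eM HG; rewrite (csym_sum H) mulr_sumr scaler_nat -sumr_const.
apply: eq_bigr => g gH; rewrite -scalerAr csym_mulr //; last exact: (fintype.subsetP HG).
by rewrite scalerA -signr_addb addbb expr0 scale1r.
Qed.

Lemma csym_dprod (H K G : {group gT}) (e : gT -> bool) :
  {in G &, forall g h, e (g * h)%g = e g (+) e h} ->
  (H * K)%g = G -> (H :&: K)%g = 1%g ->
  csym H e * csym K e = csym G e.
Proof.
move=> eM HKG HK1.
have HG : H \subset G by rewrite -HKG mulG_subl.
have KG : K \subset G by rewrite -HKG mulG_subr.
apply/ffunP => g; rewrite gmulE [RHS]csymE.
case: (boolP (g \in G)) => gG; last first.
  rewrite mul0r big1 // => h _; rewrite !csymE.
  case: (boolP (h \in H)) => hH; last by rewrite !mul0r.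
  case: (boolP (_ \in K)) => hK; last by rewrite mul0r mulr0.
  by rewrite -HKG -(mulKVg h g) mem_mulg in gG.
have /mulsgP[h k hH kK ghk] : g \in (H * K)%g by rewrite HKG.
rewrite (bigD1 h) //= big1 ?addr0.
  rewrite !csymE ghk mulKg hH kK !mul1r eM ?signr_addb //.
    exact: (fintype.subsetP HG).
  exact: (fintype.subsetP KG).
move=> h' h'h; rewrite !csymE.
case: (boolP (h' \in H)) => hH'; last by rewrite !mul0r.
case: (boolP (_ \in K)) => hK'; last by rewrite mul0r mulr0.
have : (h'^-1 * h)%g \in (H :&: K)%g.
  rewrite inE groupM ?groupV //=.
  by rewrite -(mulgK k h) -ghk mulgA groupM ?groupV.
by rewrite HK1 inE -eq_mulVg1 (negPf h'h).
Qed.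

End Galg.

Global Opaque gel gmul star csym.

(** * Functoriality of group algebras *)

Section Push.
Variables (C : numClosedFieldType) (gT hT : finGroupType) (phi : gT -> hT).
Hypothesis phiM : {morph phi : x y / (x * y)%g}.
Implicit Types a b : galg C gT.

Definition push a : galg C hT := \sum_g a g *: gel C (phi g).

Lemma push_gel g : push (gel C g) = gel C (phi g).
Proof.
rewrite /push (bigD1 g) //= big1 ?addr0 ?gelE ?eqxx ?scale1r // => h /negPf hg.
by rewrite gelE hg scale0r.
Qed.

Lemma pushD a b : push (a + b) = push a + push b.
Proof. by rewrite -big_split; apply: eq_bigr => g _; rewrite galg_addE scalerDl. Qed.

Lemma pushZ (k : C) a : push (k *: a) = k *: push a.
Proof. by rewrite scaler_sumr; apply: eq_bigr => g _; rewrite galg_scaleE scalerA. Qed.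

Lemma push0 : push 0 = 0.
Proof. by rewrite /push big1 // => g _; rewrite galg0E scale0r. Qed.

Lemma push_sum I (r : seq I) (P : pred I) (F : I -> galg C gT) :
  push (\sum_(i <- r | P i) F i) = \sum_(i <- r | P i) push (F i).
Proof. by apply: (big_morph _ pushD push0). Qed.

Lemma pushM a b : push (a * b) = push a * push b.
Proof.
rewrite {1}(galgE a) mulr_suml push_sum {2}/push mulr_suml; apply: eq_bigr => g _.
rewrite -scalerAl pushZ -scalerAl; congr (_ *: _).
rewrite {1}(galgE b) mulr_sumr push_sum [in RHS]/push mulr_sumr; apply: eq_bigr => h _.
by rewrite -!scalerAr pushZ -gelM push_gel phiM gelM.
Qed.

Lemma morphg1 : phi 1%g = 1%g.
Proof. by apply: (mulgI (phi 1%g)); rewrite -phiM !mulg1. Qed.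

Lemma morphgV g : phi g^-1%g = (phi g)^-1%g.
Proof. by apply: (mulgI (phi g)); rewrite -phiM !mulgV morphg1. Qed.

Lemma push_star a : push (star a) = star (push a).
Proof.
rewrite /push (big_morph _ (@starD C hT) (@star0 C hT)).
rewrite (reindex_inj invg_inj) /=; apply: eq_bigr => g _.
by rewrite starE invgK starZ star_gel morphgV.
Qed.

Hypothesis phi_inj : injective phi.

Lemma push_csym (G : {group gT}) (H : {group hT}) e e' :
  phi @: G = H -> (forall g, e' (phi g) = e g) -> push (csym C G e) = csym C H e'.
Proof.
move=> GH ee; rewrite !csym_sum push_sum -GH big_imset /=; last by move=> ? ? _ _; exact: phi_inj.
by apply: eq_bigr => g _; rewrite pushZ push_gel ee.
Qed.

End Push.

(** * Symmetrizers *)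

Section Pext.
Variables (X Y : finType) (f : X -> Y).

Definition pext_fun (s : {perm X}) (y : Y) : Y :=
  if [pick x | f x == y] is Some x then f (s x) else y.

Hypothesis fI : injective f.

Lemma pick_inj x : [pick x' | f x' == f x] = Some x.
Proof. by case: pickP => [x' /eqP/fI ->//|/(_ x)]; rewrite eqxx. Qed.

Lemma pick_out y : (forall x, f x != y) -> [pick x' | f x' == y] = None.
Proof. by move=> fy; case: pickP => // x; rewrite (negPf (fy x)). Qed.

Lemma in_or_out y : {x | y = f x} + (forall x, f x != y).
Proof.
case: (pickP (fun x => f x == y)) => [x /eqP <-|fy]; first by left; exists x.
by right=> x; rewrite fy.
Qed.

Lemma pext_funE s x : pext_fun s (f x) = f (s x).
Proof. by rewrite /pext_fun pick_inj. Qed.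

Lemma pext_fun_out s y : (forall x, f x != y) -> pext_fun s y = y.
Proof. by move=> fy; rewrite /pext_fun pick_out. Qed.

Lemma pext_fun_inj s : injective (pext_fun s).
Proof.
move=> y z; case: (in_or_out y) => [[x ->]|yo]; case: (in_or_out z) => [[x' ->]|zo].
- by rewrite !pext_funE => /fI/perm_inj ->.
- by rewrite pext_funE pext_fun_out // => /eqP; rewrite (negPf (zo _)).
- by rewrite pext_funE pext_fun_out // => /eqP; rewrite eq_sym (negPf (yo _)).
- by rewrite !pext_fun_out.
Qed.

Definition pext (s : {perm X}) : {perm Y} := perm (@pext_fun_inj s).

Lemma pextE s x : pext s (f x) = f (s x).
Proof. by rewrite permE pext_funE. Qed.

Lemma pext_out s y : (forall x, f x != y) -> pext s y = y.
Proof. by move=> fy; rewrite permE pext_fun_out. Qed.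

Lemma pextM : {morph pext : s t / (s * t)%g}.
Proof.
move=> s t; apply/permP => y; rewrite permM.
by case: (in_or_out y) => [[x ->]|yo]; rewrite ?pextE ?permM // !pext_out.
Qed.

Lemma pext_inj : injective pext.
Proof.
move=> s t st; apply/permP => x; apply: fI.
by rewrite -!pextE st.
Qed.

Lemma pext_tperm x x' : pext (tperm x x') = tperm (f x) (f x').
Proof.
apply/permP => y; case: (in_or_out y) => [[z ->]|yo].
  rewrite pextE; case: tpermP => [->|->|/eqP zx /eqP zx'].
  - by rewrite tpermL.
  - by rewrite tpermR.
  - by rewrite tpermD // (inj_eq fI) eq_sym.
by rewrite pext_out // tpermD.
Qed.

Lemma odd_pext s : odd_perm (pext s) = odd_perm s.
Proof.
have [ts -> _] := prod_tpermP s.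
have p1 : pext 1%g = 1%g := morphg1 pextM.
rewrite (big_morph _ pextM p1).
elim: ts => [|t ts IH]; first by rewrite !big_nil !odd_perm1.
rewrite !big_cons !odd_permM pext_tperm !odd_tperm (inj_eq fI).
by congr (_ (+) _).
Qed.

End Pext.

(** Conjugation by g carries the extension along f to the extension along g \o f; this is how two
    placements of the same points are compared. *)
Lemma pext_conj (X Y : finType) (f : X -> Y) (g : {perm Y}) (fI : injective f)
  (gfI : injective (g \o f)) s : (pext fI s * g = g * pext gfI s)%g.
Proof.
apply/permP => y; rewrite !permM; case: (in_or_out f y) => [[x ->]|yo].
  by rewrite pextE -[g (f x)]/((g \o f) x) pextE.
rewrite !pext_out // => x /=; apply: contra (yo x) => /eqP/perm_inj ->; exact: eqxx.
Qed.

Section Stab.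
Variables (X : finType).

(** Row groups, column groups and stabilizers of words are all stabilizers of a labelling, with
    labels in any type; only the partition into fibres matters. *)
Definition stabf (T : eqType) (f : X -> T) : {set {perm X}} :=
  [set p : {perm X} | [forall i, f (p i) == f i]].

Lemma stabfP (T : eqType) (f : X -> T) (p : {perm X}) :
  reflect (forall i, f (p i) = f i) (p \in stabf f).
Proof. by rewrite inE; apply: (iffP forallP) => fp i; apply/eqP. Qed.

Lemma stabf_group_set (T : eqType) (f : X -> T) : group_set (stabf f).
Proof.
apply/group_setP; split=> [|p q /stabfP fp /stabfP fq]; apply/stabfP => i.
  by rewrite perm1.
by rewrite permM fq fp.
Qed.
Canonical stabf_group (T : eqType) (f : X -> T) := Group (stabf_group_set f).

Lemma stabf_sub (T T' : eqType) (f : X -> T) (f' : X -> T') :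
  (forall x y, f x = f y -> f' x = f' y) -> stabf f \subset stabf f'.
Proof. by move=> ff; apply/fintype.subsetP => p /stabfP fp; apply/stabfP => i; apply: ff. Qed.

Variable C : numClosedFieldType.

Definition psym (T : eqType) (f : X -> T) : galg C {perm X} := csym C (stabf_group f) xpred0.
Definition asym (T : eqType) (f : X -> T) : galg C {perm X} := csym C (stabf_group f) (@odd_perm X).

Lemma odd_permMg (G : {set {perm X}}) :
  {in G &, forall g h, odd_perm (g * h)%g = odd_perm g (+) odd_perm h}.
Proof. by move=> g h _ _; exact: odd_permM. Qed.

Section StabSym.
Variables (T : eqType) (f : X -> T).

Lemma psym_csym : psym f = csym C (stabf_group f) xpred0. Proof. by []. Qed.
Lemma asym_csym : asym f = csym C (stabf_group f) (@odd_perm X). Proof. by []. Qed.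
Lemma psym_mull p : p \in stabf f -> gel C p * psym f = psym f.
Proof. by move=> fp; rewrite csym_mull // expr0 scale1r. Qed.
Lemma psym_mulr p : p \in stabf f -> psym f * gel C p = psym f.
Proof. by move=> fp; rewrite csym_mulr // expr0 scale1r. Qed.
Lemma asym_mull p : p \in stabf f -> gel C p * asym f = (-1) ^+ odd_perm p *: asym f.
Proof. by move=> fp; rewrite csym_mull //; exact: odd_permMg. Qed.
Lemma asym_mulr p : p \in stabf f -> asym f * gel C p = (-1) ^+ odd_perm p *: asym f.
Proof. by move=> fp; rewrite csym_mulr //; exact: odd_permMg. Qed.
Lemma star_psym : star (psym f) = psym f.
Proof. exact: star_csym. Qed.
Lemma star_asym : star (asym f) = asym f.
Proof. apply: star_csym; exact: odd_permMg. Qed.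
Lemma psym_sqr : psym f * psym f = #|stabf f|%:R *: psym f.
Proof. exact: csym_sqr. Qed.
Lemma asym_sqr : asym f * asym f = #|stabf f|%:R *: asym f.
Proof. apply: csym_sqr; exact: odd_permMg. Qed.
Lemma psym_sum : psym f = \sum_(p in stabf f) gel C p.
Proof. by rewrite /psym csym_sum; apply: eq_bigr => p _; rewrite expr0 scale1r. Qed.
Lemma asym_sum : asym f = \sum_(p in stabf f) (-1) ^+ odd_perm p *: gel C p.
Proof. exact: csym_sum. Qed.
Lemma psymE p : psym f p = (p \in stabf f)%:R.
Proof. by rewrite csymE expr0 mulr1. Qed.
Lemma asymE p : asym f p = (p \in stabf f)%:R * (-1) ^+ odd_perm p.
Proof. by rewrite csymE. Qed.
Lemma card_stabf_neq0 : #|stabf f|%:R != 0 :> C.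
Proof. by rewrite pnatr_eq0 -lt0n cardG_gt0. Qed.

End StabSym.

Lemma gel_psym (T : eqType) (f : X -> T) (g : {perm X}) :
  gel C g * psym f = psym (f \o g) * gel C g.
Proof.
apply/ffunP => p; rewrite mul_gell mul_gelr !psymE; congr (nat_of_bool _)%:R.
apply/stabfP/stabfP => H i /=.
  by have := H (g i); rewrite !permM permK permKV.
by have := H (g^-1%g i); rewrite /= !permM !permKV.
Qed.

Lemma gel_asym (T : eqType) (f : X -> T) (g : {perm X}) :
  gel C g * asym f = asym (f \o g) * gel C g.
Proof.
apply/ffunP => p; rewrite mul_gell mul_gelr !asymE; congr ((nat_of_bool _)%:R * _).
  apply/stabfP/stabfP => H i /=.
    by have := H (g i); rewrite !permM permK permKV.
  by have := H (g^-1%g i); rewrite /= !permM !permKV.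
by rewrite !odd_permM odd_permV addbC.
Qed.

Lemma eq_stabf (T T' : eqType) (f : X -> T) (f' : X -> T') :
  (forall x y, (f x == f y) = (f' x == f' y)) -> stabf f = stabf f'.
Proof.
by move=> ff; apply/setP => p; rewrite !inE; apply: eq_forallb => i; rewrite ff.
Qed.

Lemma eq_psym (T T' : eqType) (f : X -> T) (f' : X -> T') :
  (forall x y, (f x == f y) = (f' x == f' y)) -> psym f = psym f'.
Proof. by move=> ff; apply/ffunP => p; rewrite !psymE (eq_stabf ff). Qed.

Lemma eq_asym (T T' : eqType) (f : X -> T) (f' : X -> T') :
  (forall x y, (f x == f y) = (f' x == f' y)) -> asym f = asym f'.
Proof. by move=> ff; apply/ffunP => p; rewrite !asymE (eq_stabf ff). Qed.

(** The transposition (x y) lies in both stabilizers: [psym] absorbs it with sign 1 and [asym] with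
    sign -1. *)
Lemma asym_psym0 (T T' : eqType) (f : X -> T) (f' : X -> T') x y :
  x != y -> f x = f y -> f' x = f' y -> asym f * psym f' = 0.
Proof.
move=> xy fxy fxy'.
have st (S : eqType) (h : X -> S) : h x = h y -> tperm x y \in stabf h.
  by move=> hxy; apply/stabfP => i; case: tpermP => [->|->|].
have E : asym f * psym f' = - (asym f * psym f').
  rewrite -{1}(psym_mull (st _ _ fxy')) mulrA (asym_mulr (st _ _ fxy)).
  by rewrite odd_tperm xy expr1 scaleN1r mulNr.
apply/ffunP => g; rewrite galg0E; have /ffunP/(_ g) := E.
rewrite galg_oppE => /eqP; rewrite -addr_eq0 -mulr2n mulrn_eq0 /= => /eqP //.
Qed.

Lemma psym_asym0 (T T' : eqType) (f : X -> T) (f' : X -> T') x y :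
  x != y -> f x = f y -> f' x = f' y -> psym f' * asym f = 0.
Proof.
move=> xy fxy fxy'; apply: (can_inj (@starK _ _)).
by rewrite starM star_psym star_asym star0 (asym_psym0 xy).
Qed.

Lemma psym_absorbr (T T' : eqType) (f : X -> T) (f' : X -> T') :
  (forall x y, f x = f y -> f' x = f' y) ->
  psym f' * psym f = #|stabf f|%:R *: psym f'.
Proof. by move=> ff; apply: csym_absorbr => //; exact: stabf_sub. Qed.

Lemma asym_absorbl (T T' : eqType) (f : X -> T) (f' : X -> T') :
  (forall x y, f x = f y -> f' x = f' y) ->
  asym f * asym f' = #|stabf f|%:R *: asym f'.
Proof. by move=> ff; apply: csym_absorbl; [exact: odd_permMg|exact: stabf_sub]. Qed.

Lemma asym_absorbr (T T' : eqType) (f : X -> T) (f' : X -> T') :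
  (forall x y, f x = f y -> f' x = f' y) ->
  asym f' * asym f = #|stabf f|%:R *: asym f'.
Proof. by move=> ff; apply: csym_absorbr; [exact: odd_permMg|exact: stabf_sub]. Qed.

End Stab.

Section Extf.
Variables (X Y : finType) (T : eqType) (f : X -> Y).

(* The labelling g of X, transported to f(X), all other points of Y being
   given labels of their own. *)
Definition extf (g : X -> T) (y : Y) : T + Y :=
  if [pick x | f x == y] is Some x then inl (g x) else inr y.

Variable g : X -> T.
Hypothesis fI : injective f.

Lemma extfE x : extf g (f x) = inl (g x).
Proof. by rewrite /extf pick_inj. Qed.

Lemma extf_out y : (forall x, f x != y) -> extf g y = inr y.
Proof. by move=> yo; rewrite /extf pick_out. Qed.

Lemma stabf_extf : pext fI @: stabf g = stabf (extf g).
Proof.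
apply/setP => p; apply/imsetP/stabfP => [[s /stabfP gs -> y]|Hp].
  case: (in_or_out f y) => [[x ->]|yo]; last by rewrite pext_out.
  by rewrite pextE !extfE gs.
have out y : (forall x, f x != y) -> p y = y.
  move=> yo; have := Hp y; rewrite (extf_out yo).
  case: (in_or_out f (p y)) => [[x ->]|yo']; first by rewrite extfE.
  by rewrite extf_out // => -[].
pose h x := if [pick x' | f x' == p (f x)] is Some x' then x' else x.
have fh x : f (h x) = p (f x).
  rewrite /h; case: pickP => [x' /eqP//|no]; exfalso.
  have o : forall x', f x' != p (f x) by move=> x'; rewrite no.
  have := out _ o => /perm_inj E; have := o x; by rewrite E eqxx.
have hI : injective h.
  by move=> x y hxy; apply: fI; apply: (@perm_inj _ p); rewrite -!fh hxy.
exists (perm hI); first apply/stabfP => x.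
  by rewrite permE; have := Hp (f x); rewrite -fh !extfE => -[].
apply/permP => y; case: (in_or_out f y) => [[x ->]|yo].
  by rewrite pextE permE fh.
by rewrite pext_out // out.
Qed.

Variable C : numClosedFieldType.

Lemma push_psym : push (pext fI) (psym C g) = psym C (extf g).
Proof. by apply: push_csym => //; [exact: pext_inj|exact: stabf_extf]. Qed.

Lemma push_asym : push (pext fI) (asym C g) = asym C (extf g).
Proof.
by apply: push_csym => //; [exact: pext_inj|exact: stabf_extf|exact: odd_pext].
Qed.

End Extf.

Lemma extf_comp (X Y : finType) (T : eqType) (f : X -> Y) (g : X -> T)
    (s : {perm Y}) x y : injective f ->
  (extf (s \o f) g (s x) == extf (s \o f) g (s y)) = (extf f g x == extf f g y).
Proof.
move=> fI; have sfI : injective (s \o f) by apply: inj_comp => //; exact: perm_inj.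
have E z : extf (s \o f) g (s z) =
    match extf f g z with inl t => inl t | inr z' => inr (s z') end.
  case: (in_or_out f z) => [[x' ->]|zo]; first by rewrite -[s _]/((s \o f) x') !extfE.
  rewrite !extf_out // => x' /=; apply: contra (zo x') => /eqP/perm_inj ->; exact: eqxx.
rewrite !E; case: (extf f g x) => [t|z]; case: (extf f g y) => [t'|z'] //.
by rewrite -[LHS]/(s z == s z') (inj_eq perm_inj).
Qed.

Global Opaque push psym asym pext.

(** * Young symmetrizers *)

Section Tableau.
Variables (X : finType) (row : X -> nat).

(* (row, col) identifies X with the cells of a diagram with left-justified rows. *)
Definition diagram (col : X -> nat) : Prop :=
  (forall x y, row x = row y -> col x = col y -> x = y) /\
  (forall x k, (k < col x)%N -> exists2 y, row y = row x & col y = k).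

(** For the columns of a diagram these are the partial sums of the conjugate partition, so comparing
    them for all k is the dominance order. *)
Definition ncols (col : X -> nat) (k : nat) : nat := #|[set x | (col x < k)%N]|.

Let below (col : X -> nat) (i k : nat) := #|[set x | (row x == i) && (col x < k)%N]|.

Lemma ncols_below col k :
  ncols col k = \sum_(i < (\max_x row x).+1) below col i k.
Proof.
rewrite /ncols -sum1_card (partition_big (fun x => inord (row x) : 'I_(\max_x row x).+1) xpredT) //=.
apply: eq_bigr => i _; rewrite /below -sum1_card; apply: eq_bigl => x; rewrite !inE andbC.
congr andb; apply/eqP/eqP => [<-|rx]; last by apply: val_inj; rewrite /= inordK // rx.
by rewrite inordK // ltnS; exact: leq_bigmax.
Qed.

(** If row i reaches column k, left justification fills all k places before it, the most that an
    injective labelling can use; otherwise the whole row already lies below k. *)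
Lemma below_le col col' i k : diagram col ->
  (forall x y, row x = row y -> col' x = col' y -> x = y) ->
  (below col' i k <= below col i k)%N.
Proof.
move=> [_ lj] inj'.
case: (pickP (fun x => (row x == i) && (k <= col x)%N)) => [x /andP[/eqP rx kx]|no].
  apply: (@leq_trans k).
    case: (k) => [|k'].
      by rewrite /below leqn0 cards_eq0; apply/eqP/setP => y; rewrite !inE andbF.
    rewrite /below -[X in (_ <= X)%N]card_ord.
    rewrite -(@card_in_imset _ _ (fun y => inord (col' y) : 'I_k'.+1)).
      exact: max_card.
    move=> y z; rewrite !inE => /andP[/eqP ry cy] /andP[/eqP rz cz] /(congr1 val) /=.
    by rewrite !inordK //; apply: inj'; rewrite ry.
  have ex (j : 'I_k) : exists y, (row y == i) && (col y == j).
    have [|y ry cy] := lj x j; first exact: leq_trans (ltn_ord j) kx.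
    by exists y; rewrite ry rx cy !eqxx.
  pose f j := xchoose (ex j).
  have fP j : row (f j) = i /\ col (f j) = j.
    by have /andP[/eqP ? /eqP ?] := xchooseP (ex j).
  have fI : injective f.
    by move=> j j' ff; apply: val_inj; rewrite /= -(fP j).2 -(fP j').2 ff.
  rewrite -[X in (X <= _)%N]card_ord -(card_imset _ fI) /below subset_leq_card //.
  apply/fintype.subsetP => y /imsetP[j _ ->]; rewrite !inE (fP j).1 eqxx /= (fP j).2.
  exact: ltn_ord.
rewrite /below subset_leq_card //; apply/fintype.subsetP => y; rewrite !inE => /andP[ry _].
by have := no y; rewrite ry /= leqNgt => /negbT; rewrite negbK.
Qed.

Lemma ncols_le col col' k : diagram col ->
  (forall x y, row x = row y -> col' x = col' y -> x = y) ->
  (ncols col' k <= ncols col k)%N.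
Proof. by move=> dc inj'; rewrite !ncols_below; apply: leq_sum => i _; exact: below_le. Qed.

(** Equality of the totals forces equality in [below_le] row by row. A value of col' missing from
    the row of x would make the count jump for col' and not for col. *)
Lemma ncols_cell col col' : diagram col ->
  (forall x y, row x = row y -> col' x = col' y -> x = y) ->
  (forall k, ncols col' k = ncols col k) ->
  forall x, exists2 y, row y = row x & col y = col' x.
Proof.
move=> dc inj' ncE x.
have bE k : below col' (row x) k = below col (row x) k.
  have := @leqif_sum _ (xpredT : pred 'I_(\max_x row x).+1) _ _ _
    (fun i _ => leqif_eq (@below_le col col' i k dc inj')).
  case=> _; rewrite -!ncols_below ncE eqxx => /esym/forallP H.
  have rx : (row x < (\max_x row x).+1)%N by rewrite ltnS; exact: leq_bigmax.
  by have := H (Ordinal rx) => /eqP.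
case: (pickP (fun y => (row y == row x) && (col y == col' x))) => [y /andP[/eqP ? /eqP ?]|no].
  by exists y.
exfalso; have : (below col (row x) (col' x) < below col (row x) (col' x).+1)%N.
  rewrite -!bE /below proper_card //; apply/properP; split.
    by apply/fintype.subsetP => y; rewrite !inE => /andP[-> /ltnW].
  by exists x; rewrite !inE eqxx /= ?ltnn // ltnSn.
rewrite ltnNge => /negP; apply; rewrite /below subset_leq_card //.
apply/fintype.subsetP => y; rewrite !inE => /andP[ry]; rewrite ry ltnS leq_eqVlt => /orP[cy|//].
by have := no y; rewrite ry cy.
Qed.

Variables (C : numClosedFieldType).

Lemma young_col_noninj (col' : X -> nat) (g : {perm X}) x y : x != y -> row x = row y ->
  col' (g x) = col' (g y) -> psym C row * gel C g * asym C col' = 0.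
Proof.
move=> xy rxy cxy; rewrite -mulrA gel_asym mulrA.
by rewrite (psym_asym0 C xy (f := col' \o g)) ?mul0r.
Qed.

Lemma young_neq0 col col' g : diagram col ->
  psym C row * gel C g * asym C col' != 0 -> forall k, (ncols col' k <= ncols col k)%N.
Proof.
move=> dc nz k.
have -> : ncols col' k = ncols (col' \o g) k.
  rewrite /ncols -[RHS](card_imset _ (@perm_inj _ g)); apply: eq_card => x; rewrite !inE.
  apply/idP/imsetP => [cx|[y]]; last by rewrite inE => cy ->.
  by exists (g^-1%g x); rewrite ?inE /= permKV.
apply: ncols_le => // x y rxy cxy; apply/eqP/negPn/negP => xy.
by rewrite (young_col_noninj xy rxy cxy) eqxx in nz.
Qed.

Variable col : X -> nat.
Hypothesis dc : diagram col.

Local Notation P := (psym C row).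
Local Notation Q := (asym C col).

(** Von Neumann's lemma. Either g sends two points of a row to one column and the product vanishes,
    or the column counts let each row be sorted: p moves x within its row to the cell in the column
    of g x, and g = p (p^-1 g), where the second factor preserves columns. *)
Lemma young_gel g : exists l : C, P * gel C g * Q = l *: (P * Q).
Proof.
have [inj|] := pselect (forall x y, row x = row y -> col (g x) = col (g y) -> x = y); last first.
  move=> /existsNP[x /existsNP[y /not_implyP[rxy /not_implyP[cxy /eqP xy]]]].
  by exists 0; rewrite scale0r (young_col_noninj xy rxy cxy).
have nc k : ncols (col \o g) k = ncols col k.
  rewrite /ncols -(card_imset _ (@perm_inj _ g)); apply: eq_card => x; rewrite !inE.
  apply/imsetP/idP => [[y]|cx]; first by rewrite inE /= => cy ->.
  by exists (g^-1%g x); rewrite ?inE /= permKV.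
have cell := @ncols_cell col (col \o g) dc inj nc.
have ex x : exists y, (row y == row x) && (col y == col (g x)).
  by have [y ry cy] := cell x; exists y; rewrite ry cy !eqxx.
pose f x := xchoose (ex x).
have fP x : row (f x) = row x /\ col (f x) = col (g x).
  by have /andP[/eqP ? /eqP ?] := xchooseP (ex x).
have fI : injective f.
  move=> x y fxy; apply: inj; first by rewrite -(fP x).1 -(fP y).1 fxy.
  by rewrite -(fP x).2 -(fP y).2 fxy.
pose p := perm fI.
have pr : p \in stabf row by apply/stabfP => x; rewrite permE (fP x).1.
have qc : (p^-1 * g)%g \in stabf col.
  by apply/stabfP => x; rewrite permM -(fP _).2 -[f _](permE fI) permKV.
exists ((-1) ^+ odd_perm (p^-1 * g)%g).
rewrite -(mulKVg p g) gelM mulrA psym_mulr // -mulrA asym_mull //.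
by rewrite -scalerAr mulKg.
Qed.

Lemma young_scalar x : exists l : C, P * x * Q = l *: (P * Q).
Proof.
rewrite [x]galgE mulr_sumr mulr_suml.
pose Pr (y : galg C {perm X}) := exists l : C, y = l *: (P * Q).
apply: (big_ind Pr) => [|y z [l ->] [m ->]|g _]; first by exists 0; rewrite scale0r.
  by exists (l + m); rewrite scalerDl.
have [l E] := young_gel g.
by exists (x g * l); rewrite -scalerAr -scalerAl E scalerA.
Qed.

Lemma young_at1 : (P * Q) 1%g = 1.
Proof.
rewrite gmulE (bigD1 1%g) //= big1 ?addr0.
  by rewrite psymE asymE invg1 mulg1 !group1 odd_perm1 !mul1r.
move=> g g1; rewrite psymE asymE mulg1.
case: (boolP (g \in stabf row)) => gr; last by rewrite mul0r.
case: (boolP (_ \in stabf col)) => gc; last by rewrite mul0r mulr0.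
rewrite groupV in gc; case/eqP: g1; apply/permP => x; rewrite perm1.
by apply: dc.1; [exact: (stabfP _ _ gr)|exact: (stabfP _ _ gc)].
Qed.

(** With h = 0 the self-adjoint element Q P Q would have square 0, hence vanish, and then so would P
    Q, against its coefficient 1 at the identity. *)
Lemma young_sqr : exists2 h : C, h != 0 & (P * Q) * (P * Q) = h *: (P * Q).
Proof.
have [h E] := young_scalar (Q * P).
exists h; last by rewrite -E !mulrA.
apply/eqP => h0; rewrite h0 scale0r in E.
have sQPQ : star (Q * P * Q) = Q * P * Q by rewrite !starM star_asym star_psym mulrA.
have QPQ : Q * P * Q = 0.
  apply: selfadj_sqr0 => //.
  have -> : Q * P * Q * (Q * P * Q) = Q * P * (Q * Q) * P * Q by rewrite !mulrA.
  rewrite asym_sqr -!(scalerAl, scalerAr).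
  have -> : Q * P * Q * P * Q = Q * (P * (Q * P) * Q) by rewrite !mulrA.
  by rewrite E mulr0 scaler0.
have PQ0 : P * Q = 0.
  apply: star_mul_eq0; rewrite starM star_asym star_psym.
  have -> : Q * P * (P * Q) = Q * (P * P) * Q by rewrite !mulrA.
  by rewrite psym_sqr -scalerAr -scalerAl QPQ scaler0.
by have := young_at1; rewrite PQ0 galg0E => /eqP; rewrite eq_sym oner_eq0.
Qed.

Lemma young_sqr' : exists2 h : C, h != 0 & (Q * P) * (Q * P) = h *: (Q * P).
Proof.
have [h h0 E] := young_sqr; exists h^*; first by rewrite conjC_eq0.
by have := congr1 (@star _ _) E; rewrite starZ !starM star_asym star_psym.
Qed.

(** By [young_scalar], star (z P Q) times z P Q is a multiple l of Q P Q, with l non-zero by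
    positivity. Multiplying by P on the left gives P Q P Q, a non-zero multiple of P Q. *)
Lemma young_in_ideal (J : galg C {perm X} -> Prop) z :
  (forall a y b, J y -> J (a * y * b)) -> J (z * (P * Q)) -> z * (P * Q) != 0 -> J (P * Q).
Proof.
move=> JM Jy y0.
have JZ (k : C) y : J y -> J (k *: y).
  by move=> /(JM k%:A _ 1); rewrite mulr1 -scalerAl mul1r.
have [l E] := young_scalar (star z * z * P).
have PP : P * (star z * z * P) * Q = P * star z * z * P * Q by rewrite !mulrA.
have nz : star (z * (P * Q)) * (z * (P * Q)) = l *: (Q * P * Q).
  rewrite !starM star_asym star_psym.
  by rewrite -[Q * P * Q]mulrA scalerAr -E !mulrA.
have JQPQ : J (l *: (Q * P * Q)) by rewrite -nz -[_ * _]mulr1; exact: JM.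
have l0 : l != 0.
  apply: contra_neq y0 => l0; apply: star_mul_eq0; by rewrite nz l0 scale0r.
have [h h0 cc] := young_sqr.
have -> : P * Q = h^-1 *: (P * (l^-1 *: (l *: (Q * P * Q))) * 1).
  rewrite scalerA mulVf // scale1r mulr1.
  have -> : P * (Q * P * Q) = P * Q * (P * Q) by rewrite !mulrA.
  by rewrite cc scalerA mulVf // scale1r.
by apply/(JZ)/JM/JZ.
Qed.

(** What is used of the simplicity of Specht modules: an element y of J with y x P Q non-zero would
    bring P Q into J by [young_in_ideal]. *)
Lemma young_ann (J : galg C {perm X} -> Prop) :
  (forall a y b, J y -> J (a * y * b)) -> ~ J (P * Q) ->
  forall y x, J y -> y * (x * (P * Q)) = 0.
Proof.
move=> JM nJ y x Jy; apply/eqP/negPn/negP => nz; apply: nJ.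
apply: (@young_in_ideal J (y * x)) => //; last by rewrite -mulrA.
by rewrite -[y * x * _]mul1r !mulrA -[1 * y * x * P * Q]mulrA -[1 * y * x * _]mulrA; apply: JM.
Qed.

End Tableau.

Section Ortho.
Variables (C : numClosedFieldType) (X : finType) (row col row' col' : X -> nat).
Hypotheses (dc : diagram row col) (dc' : diagram row' col').

Lemma young_ortho k : ncols col k <> ncols col' k -> forall x,
  psym C row * asym C col * x * (psym C row' * asym C col') = 0.
Proof.
have aux (r c c' : X -> nat) : diagram r c -> (ncols c k < ncols c' k)%N ->
    forall x, psym C r * x * asym C c' = 0.
  move=> d lt x; rewrite [x]galgE mulr_sumr mulr_suml big1 // => g _.
  rewrite -scalerAr -scalerAl; apply/eqP; rewrite scaler_eq0; apply/orP; right.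
  apply/negPn/negP => /(young_neq0 d)/(_ k); by rewrite leqNgt lt.
move=> /eqP; rewrite neq_ltn => /orP[] lt x.
  rewrite -!mulrA; have := @aux row col col' dc lt (asym C col * x * psym C row').
  by rewrite !mulrA.
(* In the other case dominance gives P' star x Q = 0, whose adjoint is Q x P' = 0. *)
have E := @aux row' col' col dc' lt (star x).
have {}E : asym C col * x * psym C row' = 0.
  apply: (can_inj (@starK _ _)); rewrite !starM star_psym star_asym star0.
  by rewrite mulrA.
have -> : psym C row * asym C col * x * (psym C row' * asym C col') =
  psym C row * (asym C col * x * psym C row') * asym C col' by rewrite !mulrA.
by rewrite E mulr0 mul0r.
Qed.

End Ortho.

(** * Central elements from Young symmetrizers *)

Section ClassSum.
Variables (C : numClosedFieldType) (gT : finGroupType).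
Implicit Types a b : galg C gT.

Definition class_sum a : galg C gT := \sum_g gel C g * a * gel C g^-1.

Lemma class_sum_comm a b : class_sum a * b = b * class_sum a.
Proof.
rewrite [b]galgE mulr_sumr mulr_suml; apply: eq_bigr => h _.
rewrite -scalerAr -scalerAl; congr (_ *: _).
rewrite mulr_suml mulr_sumr (reindex_inj (mulgI h)) /=; apply: eq_bigr => g _.
by rewrite invMg !gelM !mulrA -[_ * gel C h^-1 * _]mulrA gelVK mulr1.
Qed.

Lemma class_sumJ a g h : class_sum a (g^-1 * h * g)%g = class_sum a h.
Proof.
have := congr1 (fun f : galg C gT => f (h * g)%g) (class_sum_comm a (gel C g)).
by rewrite mul_gelr mul_gell mulgK mulgA.
Qed.

Lemma class_sumZ (k : C) a : class_sum (k *: a) = k *: class_sum a.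
Proof.
by rewrite /class_sum scaler_sumr; apply: eq_bigr => g _; rewrite -scalerAr -scalerAl.
Qed.

Lemma class_sum_sum I (r : seq I) (Pr : pred I) (F : I -> galg C gT) :
  class_sum (\sum_(i <- r | Pr i) F i) = \sum_(i <- r | Pr i) class_sum (F i).
Proof.
rewrite /class_sum exchange_big /=; apply: eq_bigr => g _.
by rewrite mulr_sumr mulr_suml.
Qed.

(** Conjugation by h carries a factor h from the left to the right. For P Q this makes the class sum
    self-adjoint, since star (P Q) = Q P. *)
Lemma class_sum_mulC a b : class_sum (a * b) = class_sum (b * a).
Proof.
rewrite [a]galgE mulr_sumr mulr_suml !class_sum_sum; apply: eq_bigr => h _.
rewrite -scalerAr -scalerAl !class_sumZ; congr (_ *: _).
rewrite /class_sum (reindex_inj (mulIg h^-1%g)) /=; apply: eq_bigr => g _.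
by rewrite invMg invgK !gelM !mulrA -[_ * gel C h^-1 * _]mulrA gelVK mulr1.
Qed.

Lemma star_class_sum a : star (class_sum a) = class_sum (star a).
Proof.
rewrite /class_sum (big_morph _ (@starD C gT) (@star0 C gT)); apply: eq_bigr => g _.
by rewrite !starM !star_gel invgK mulrA.
Qed.

Lemma class_sum1 a : class_sum a 1%g = #|gT|%:R * a 1%g.
Proof.
rewrite galg_sumE -sum1_card natr_sum mulr_suml; apply: eq_bigr => g _.
by rewrite mul_gelr mul_gell invgK mul1g mulVg mul1r.
Qed.

Lemma class_sum_ortho a b : (forall x, a * x * b = 0) -> class_sum a * class_sum b = 0.
Proof.
move=> ab; rewrite mulr_suml big1 // => g _; rewrite mulr_sumr big1 // => h _.
have -> : gel C g * a * gel C g^-1 * (gel C h * b * gel C h^-1) =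
  gel C g * (a * (gel C g^-1 * gel C h) * b) * gel C h^-1 by rewrite !mulrA.
by rewrite ab mulr0 mul0r.
Qed.

End ClassSum.

Section Complete.
Variables (C : numClosedFieldType) (X K : finType) (row col : K -> X -> nat).
Hypothesis dc : forall k, diagram (row k) (col k).
Hypothesis sep : forall k k', k != k' -> exists n, ncols (col k) n <> ncols (col k') n.
Variable ty : {perm X} -> K.
Hypothesis tyP : forall s t, ty s = ty t -> exists g, t = (g^-1 * s * g)%g.

Local Notation c k := (psym C (row k) * asym C (col k)).

Let z k := class_sum (c k).

Lemma young_class_sum_sqr k : z k * z k != 0.
Proof.
apply/eqP => zz; have sz : star (z k) = z k.
  by rewrite /z star_class_sum starM star_psym star_asym class_sum_mulC.
have := selfadj_sqr0 sz zz => /ffunP/(_ 1%g).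
rewrite class_sum1 young_at1 // mulr1 galg0E => /eqP.
by rewrite pnatr_eq0 -leqn0 leqNgt; case/negP; apply/card_gt0P; exists 1%g.
Qed.

(* The class sums of the Young symmetrizers are linearly independent, and
   there are at least as many of them as there are conjugacy classes. *)
Lemma young_complete (J : galg C {perm X} -> Prop) :
  (forall y y', J y -> J y' -> J (y + y')) ->
  (forall a y b, J y -> J (a * y * b)) ->
  (forall k, J (c k)) -> J 1.
Proof.
move=> JD JM Jc.
(* A representative of the class of type k; the identity is a dummy when no permutation has type
   k. *)
pose s k := if [pick s | ty s == k] is Some s then s else 1%g.
have vanish (f : galg C {perm X}) : (forall g h, f (g^-1 * h * g)%g = f h) ->
    (forall k, f (s k) = 0) -> f = 0.
  move=> fJ fs; apply/ffunP => h; rewrite galg0E.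
  have := fs (ty h); rewrite /s; case: pickP => [t /eqP|/(_ h)]; last by rewrite eqxx.
  by move=> /tyP[g ->] ft; rewrite fJ.
(* A square matrix, because the same K indexes Young symmetrizers and classes. *)
pose M : 'M[C]_#|K| := \matrix_(i, j) z (enum_val i) (s (enum_val j)).
pose F (v : 'rV[C]_#|K|) := \sum_i v 0 i *: z (enum_val i).
have FJ v g h : F v (g^-1 * h * g)%g = F v h.
  by rewrite !galg_sumE; apply: eq_bigr => i _; rewrite !galg_scaleE class_sumJ.
have Fs v j : F v (s (enum_val j)) = (v *m M) 0 j.
  by rewrite galg_sumE mxE; apply: eq_bigr => i _; rewrite galg_scaleE mxE.
have Mfree : row_free M.
  apply: inj_row_free => v vM; apply/rowP => i; rewrite mxE.
  have F0 : F v = 0.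
    apply: vanish => [g h|k]; first exact: FJ.
    by rewrite -[k]enum_rankK Fs vM mxE.
  (* Multiplying the relation by one class sum kills the other terms by orthogonality and leaves a
     square, which is non-zero. *)
  have := congr1 (fun y => y * z (enum_val i)) F0; rewrite mul0r mulr_suml.
  rewrite (bigD1 i) //= big1 ?addr0 => [/eqP|j ji].
    by rewrite -scalerAl scaler_eq0 (negPf (young_class_sum_sqr _)) orbF => /eqP.
  rewrite -scalerAl class_sum_ortho ?scaler0 // => x.
  have [m] : exists m, ncols (col (enum_val j)) m <> ncols (col (enum_val i)) m.
    by apply: sep; rewrite (inj_eq enum_val_inj).
  by move=> ne; exact: (young_ortho (dc _) (dc _) ne).
(* The coordinates of the class function 1 in the basis of class sums. *)
pose w : 'rV[C]_#|K| := (\row_j (1 : galg C {perm X}) (s (enum_val j))) *m invmx M.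
have -> : 1 = F w.
  apply/esym/eqP; rewrite -subr_eq0; apply/eqP; apply: vanish => [g h|k].
    rewrite !galg_addE FJ !galg_oppE; congr (_ - _).
    rewrite -gel1 !gelE; congr (nat_of_bool _)%:R.
    by rewrite -mulgA -conjgE conjg_eq1.
  rewrite galg_addE galg_oppE -[k]enum_rankK Fs mulmxKV ?mxE ?subrr //.
  by rewrite -row_free_unit.
have J0 (k : K) : J 0 by have := JM 0 _ 0 (Jc k); rewrite mul0r mulr0.
apply: (big_ind J) => [|//|i _].
  exact: (J0 (ty 1%g)).
have -> : w 0 i *: z (enum_val i) = (w 0 i *: 1) * z (enum_val i) * 1.
  by rewrite mulr1 -scalerAl mul1r.
apply: (JM); apply: (big_ind J) => [|//|g _]; first exact: (J0 (ty 1%g)).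
exact: JM.
Qed.

End Complete.

Lemma stabf_extf_im (X Y : finType) (T : eqType) (f : X -> Y) (g : X -> T) p x :
  injective f -> p \in stabf (extf f g) -> exists x', p (f x) = f x'.
Proof.
move=> fI /stabfP/(_ (f x)); rewrite extfE //.
case: (in_or_out f (p (f x))) => [[x' ->]|yo]; first by exists x'.
by rewrite extf_out.
Qed.

(** * Twisting by the sign character *)

Section Sgt.
Variables (C : numClosedFieldType) (X : finType).
Implicit Types a b : galg C {perm X}.

Definition sgt a : galg C {perm X} := [ffun s => (-1) ^+ odd_perm s * a s].

Lemma sgtE a s : sgt a s = (-1) ^+ odd_perm s * a s. Proof. by rewrite ffunE. Qed.

Lemma sgtM a b : sgt (a * b) = sgt a * sgt b.
Proof.
apply/ffunP => s; rewrite sgtE !gmulE mulr_sumr; apply: eq_bigr => h _.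
rewrite !sgtE odd_permM odd_permV signr_addb mulrACA [(-1) ^+ h * (_ * _)]mulrA.
by rewrite -(signr_addb _ (odd_perm h) (odd_perm h)) addbb mul1r.
Qed.

Lemma sgtK : involutive sgt.
Proof. by move=> a; apply/ffunP => s; rewrite !sgtE mulrA -signr_addb addbb mul1r. Qed.

Lemma sgt0 : sgt 0 = 0.
Proof. by apply/ffunP => s; rewrite sgtE galg0E mulr0. Qed.

Lemma sgtN a : sgt (- a) = - sgt a.
Proof. by apply/ffunP => s; rewrite !(sgtE, galg_oppE) mulrN. Qed.

Lemma sgt_gel s : sgt (gel C s) = (-1) ^+ odd_perm s *: gel C s.
Proof.
apply/ffunP => t; rewrite sgtE galg_scaleE gelE.
by case: eqP => [->//|_]; rewrite !mulr0.
Qed.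

Lemma sgt_psym (T : eqType) (f : X -> T) : sgt (psym C f) = asym C f.
Proof. by apply/ffunP => s; rewrite sgtE psymE asymE mulrC. Qed.

Lemma sgt_asym (T : eqType) (f : X -> T) : sgt (asym C f) = psym C f.
Proof. by rewrite -sgt_psym sgtK. Qed.

End Sgt.

(** * Rectangles and Garnir relations *)

Section PsymSplit.
Variables (C : numClosedFieldType) (X : finType).

(** Cosets of the stabilizer of z: an element sending z to y is one that fixes z, followed by the
    transposition (z y). The label None isolates z. *)
Lemma psym_coset (T : eqType) (f : X -> T) z :
  psym C f = psym C (fun y => if y == z then None else Some (f y)) *
             \sum_(y | f y == f z) gel C (tperm z y).
Proof.
rewrite [LHS]psym_sum (partition_big (fun s : {perm X} => s z) (fun y => f y == f z)) /=; last first.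
  by move=> s /stabfP ->.
rewrite mulr_sumr; apply: eq_bigr => y /eqP fy.
rewrite psym_sum mulr_suml (reindex_inj (mulIg (tperm z y))) /=.
have ft x : f (tperm z y x) = f x by case: tpermP => [->|->|].
apply: eq_big => [h|h _]; last by rewrite gelM.
apply/andP/idP => [[/stabfP fh]|/stabfP fh].
  rewrite permM => /eqP hz.
  have {}hz : h z = z by apply: (@perm_inj _ (tperm z y)); rewrite hz tpermL.
  apply/stabfP => x; case: (eqVneq x z) => [->|xz]; first by rewrite hz eqxx.
  have -> : (h x == z) = false by apply/negbTE; rewrite -[X in _ == X]hz (inj_eq perm_inj).
  by rewrite -(fh x) permM ft.
have hz : h z = z by have := fh z; rewrite eqxx; case: eqP.
split; last by rewrite permM hz tpermL.
apply/stabfP => x; rewrite permM ft; case: (eqVneq x z) => [->|xz]; first by rewrite hz.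
have := fh x; rewrite (negPf xz).
have -> : (h x == z) = false by apply/negbTE; rewrite -[X in _ == X]hz (inj_eq perm_inj).
by case.
Qed.

(** No fibre of f meets both D and its complement, so the stabilizer is the direct product of its
    parts supported inside and outside D. *)
Lemma psym_split (T : eqType) (f : X -> T) (D : {set X}) :
  (forall x y, f x = f y -> (x \in D) = (y \in D)) ->
  psym C f = psym C (fun x => if x \in D then inl (f x) else inr x) *
             psym C (fun x => if x \in D then inr x else inl (f x)).
Proof.
move=> fD; apply/esym/csym_dprod => //=; last first.
  apply/trivgP/fintype.subsetP => p.
  rewrite inE => /andP[/stabfP p1 /stabfP p2]; rewrite inE; apply/eqP/permP => x.
  rewrite perm1; have := p1 x; have := p2 x.
  by case: (x \in D); case: (p x \in D) => // E1 E2; [case: E1|case: E2].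
apply/setP/subset_eqP/andP; split.
  by rewrite mul_subG //; apply: stabf_sub => x y; case: ifP => _; case: ifP => _ // [->].
apply/fintype.subsetP => p /stabfP fp.
have pD : p \in 'N(D | 'P)%g.
  by apply/astabsP => x; rewrite /= apermE (fD _ _ (fp x)).
have hD x : x \in D -> restr_perm D p x = p x by exact: restr_permE.
have hN x : x \notin D -> restr_perm D p x = x by exact: (out_perm (restr_perm_on D p)).
have hDD x : (restr_perm D p x \in D) = (x \in D).
  case: (boolP (x \in D)) => xD; last by rewrite hN // (negPf xD).
  by rewrite hD // (fD _ _ (fp x)).
rewrite -(mulKVg (restr_perm D p) p) mem_mulg //; apply/stabfP => x.
  by rewrite hDD; case: (boolP (x \in D)) => xD; [rewrite hD // fp|rewrite hN].
rewrite permM; set y := ((restr_perm D p)^-1)%g x.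
have xy : x = restr_perm D p y by rewrite permKV.
rewrite (fD _ _ (fp y)) xy hDD; case: (boolP (y \in D)) => yD; first by rewrite hD.
by rewrite hN // fp.
Qed.

Lemma csym_comm (G H : {group {perm X}}) e e' :
  (forall p q, p \in G -> q \in H -> (p * q = q * p)%g) ->
  csym C G e * csym C H e' = csym C H e' * csym C G e.
Proof.
move=> pq; rewrite !csym_sum mulr_suml mulr_sumr; apply: eq_bigr => p pG.
rewrite mulr_suml mulr_sumr; apply: eq_bigr => q qH.
by rewrite -!scalerAl -!scalerAr -!gelM pq // !scalerA mulrC.
Qed.

Lemma disjoint_perm_comm (D : {set X}) (p q : {perm X}) :
  (forall x, x \notin D -> p x = x) -> (forall x, x \in D -> q x = x) -> (p * q = q * p)%g.
Proof.
move=> pD qD; apply/permP => x; rewrite !permM.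
case: (boolP (x \in D)) => xD.
  rewrite (qD _ xD) qD //; apply/negPn/negP => pxD.
  by have := pD _ pxD => /perm_inj E; rewrite E xD in pxD.
rewrite (pD _ xD); case: (boolP (q x \in D)) => qxD; last by rewrite pD.
by have := qD _ qxD => /perm_inj E; rewrite E (negPf xD) in qxD.
Qed.

End PsymSplit.

Section Rect.
Variables (C : numClosedFieldType) (X : finType).

Definition rowR a b (R : 'I_a * 'I_b -> X) : X -> 'I_a + X := extf R fst.
Definition colR a b (R : 'I_a * 'I_b -> X) : X -> 'I_b + X := extf R snd.
Local Notation P R := (psym C (rowR R)).
Local Notation Q R := (asym C (colR R)).

Implicit Types (Y B : {set X}) (e : galg C {perm X}).

(** Vanishing is required for all placements of the grid in Y, so that permutations preserving Y can
    be moved past the symmetrizers. The order Q P is the one that Garnir relations extend by a row;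
    the order P Q is the one that the sign twist turns back into Q P. *)
Definition killQP a b Y e := forall R : 'I_a * 'I_b -> X,
  injective R -> (forall c, R c \in Y) -> Q R * P R * e = 0.
Definition killPQ a b Y e := forall R : 'I_a * 'I_b -> X,
  injective R -> (forall c, R c \in Y) -> P R * Q R * e = 0.

Lemma rect_diagram a b :
  @diagram ('I_a * 'I_b)%type (fun c => c.1) (fun c => c.2).
Proof.
split=> [[i j] [i' j'] /= /val_inj -> /val_inj -> //|[i j] k kj].
by exists (i, Ordinal (ltn_trans kj (ltn_ord j))).
Qed.

Lemma rect_sqr a b (R : 'I_a * 'I_b -> X) : injective R ->
  exists2 h : C, h != 0 & (P R * Q R) * (P R * Q R) = h *: (P R * Q R).
Proof.
move=> RI; have [h h0 E] := young_sqr C (@rect_diagram a b).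
exists h => //; have := congr1 (push (pext RI)) E.
rewrite pushZ !(pushM (pextM RI)) push_psym push_asym.
have -> : psym C (extf R (fun c => nat_of_ord c.1)) = P R.
  apply: eq_psym => x y; rewrite /rowR /extf.
  by case: pickP => [c _|_]; case: pickP => [c' _|_].
have -> // : asym C (extf R (fun c => nat_of_ord c.2)) = Q R.
apply: eq_asym => x y; rewrite /colR /extf.
by case: pickP => [c _|_]; case: pickP => [c' _|_].
Qed.

Lemma rowR_gel a b (R : 'I_a * 'I_b -> X) (g : {perm X}) : injective R ->
  P R * gel C g = gel C g * P (g \o R).
Proof.
move=> RI; rewrite gel_psym; congr (_ * _); apply: eq_psym => x y.
by rewrite /= /rowR extf_comp.
Qed.

Lemma colR_gel a b (R : 'I_a * 'I_b -> X) (g : {perm X}) : injective R ->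
  Q R * gel C g = gel C g * Q (g \o R).
Proof.
move=> RI; rewrite gel_asym; congr (_ * _); apply: eq_asym => x y.
by rewrite /= /colR extf_comp.
Qed.

Lemma QP_gel a b (R : 'I_a * 'I_b -> X) (g : {perm X}) : injective R ->
  Q R * P R * gel C g = gel C g * (Q (g \o R) * P (g \o R)).
Proof. by move=> RI; rewrite -mulrA rowR_gel // mulrA colR_gel // -mulrA. Qed.

Lemma PQ_gel a b (R : 'I_a * 'I_b -> X) (g : {perm X}) : injective R ->
  P R * Q R * gel C g = gel C g * (P (g \o R) * Q (g \o R)).
Proof. by move=> RI; rewrite -mulrA colR_gel // mulrA rowR_gel // -mulrA. Qed.

Lemma rowRE a b (R : 'I_a * 'I_b -> X) c : injective R -> rowR R (R c) = inl c.1.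
Proof. by move=> RI; exact: extfE. Qed.
Lemma rowR_out a b (R : 'I_a * 'I_b -> X) x : (forall c, R c != x) -> rowR R x = inr x.
Proof. exact: extf_out. Qed.
Lemma colRE a b (R : 'I_a * 'I_b -> X) c : injective R -> colR R (R c) = inl c.2.
Proof. by move=> RI; exact: extfE. Qed.
Lemma colR_out a b (R : 'I_a * 'I_b -> X) x : (forall c, R c != x) -> colR R x = inr x.
Proof. exact: extf_out. Qed.

Lemma comp_perm_inj (T : Type) (R : T -> X) (g : {perm X}) :
  injective R -> injective (g \o R).
Proof. by move=> RI; apply: inj_comp => //; exact: perm_inj. Qed.

(** Up to a non-zero scalar P Q is P (Q P) Q, and the last Q is a combination of column
    permutations, which only move R to another placement in Y. *)
Lemma killQP_PQ a b Y e : killQP a b Y e -> killPQ a b Y e.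
Proof.
move=> k R RI RY; have [h h0 E] := rect_sqr RI.
apply: (scalerI h0); rewrite scaler0 scalerAl -E.
have -> : P R * Q R * (P R * Q R) * e = P R * (Q R * P R * (Q R * e)) by rewrite !mulrA.
have -> : Q R * P R * (Q R * e) = 0; last by rewrite mulr0.
rewrite [X in _ * (X * e)]asym_sum mulr_suml mulr_sumr big1 // => q qc.
rewrite -scalerAl -scalerAr mulrA QP_gel // -mulrA k ?mulr0 ?scaler0 //; first exact: comp_perm_inj.
by move=> c /=; have [c' ->] := stabf_extf_im c RI qc.
Qed.

Lemma rowR_inl a b (R : 'I_a * 'I_b -> X) y i : injective R ->
  rowR R y = inl i -> exists c, y = R (i, c).
Proof.
move=> RI; case: (in_or_out R y) => [[[i' c] ->]|yo].
  by rewrite rowRE // => -[/= ->]; exists c.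
by rewrite rowR_out.
Qed.

(* Symmetrizing row j together with the cell z of row i puts two points of a
   same column in the symmetrized set. *)
Lemma garnir a b (R : 'I_a * 'I_b -> X) i j c : injective R -> i != j ->
  Q R * P R * (\sum_(y | (y == R (i, c)) || (rowR R y == inl j)) gel C (tperm (R (i, c)) y)) = 0.
Proof.
move=> RI ij; set z := R (i, c).
pose f2 y := if y == z then inl j else rowR R y.
have zi : rowR R z = inl i by rewrite /rowR extfE.
have -> : \sum_(y | (y == z) || (rowR R y == inl j)) gel C (tperm z y) =
          \sum_(y | f2 y == f2 z) gel C (tperm z y).
  apply: eq_bigl => y; rewrite /f2 eqxx; case: (eqVneq y z) => //=.
  by rewrite eqxx.
pose f3 y := if y == z then None else Some (f2 y).
have h0 := card_stabf_neq0 C f3.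
(* Scaling by #|stabf f3| inserts [psym f3] after P R, which completes the coset sum to the
   symmetrizer of f2. *)
apply: (scalerI h0); rewrite scaler0 scalerAl scalerAr.
rewrite -(psym_absorbr C (f := f3)); last first.
  move=> x y; rewrite /f3 /f2; case: (eqVneq x z) => [->|xz]; case: (eqVneq y z) => [->|yz] //.
  by case.
rewrite -2!mulrA [X in _ * (_ * X)](_ : _ = psym C f2); last by rewrite -psym_coset.
rewrite [P R]psym_sum mulr_suml mulr_sumr big1 // => p pr.
rewrite gel_psym mulrA.
(* p sends the cell (i, c1) to z and the cell (j, c1) into row j: one column of R, one block of
   f2. *)
have [c1 x1] : exists c1, (p^-1%g z) = R (i, c1).
  by apply: rowR_inl => //; have /stabfP -> := groupVr pr.
rewrite (asym_psym0 C (x := R (i, c1)) (y := R (j, c1))) ?mul0r //.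
- by rewrite (inj_eq RI) xpair_eqE (negPf ij).
- by rewrite !colRE.
- rewrite /= -x1 permKV /f2 eqxx; have /stabfP pr' := pr.
  have E : rowR R (p (R (j, c1))) = inl j by rewrite pr' /rowR extfE.
  by case: eqP => // E'; rewrite E.
Qed.

(* Induction on the number of cells of the first a rows of R which lie outside
   Y: the Garnir relation exchanges such a cell with cells of the last row. *)
Lemma killQP_row a b Y B e :
  (forall x y, x \in B -> y \in B -> gel C (tperm x y) * e = e) ->
  killQP a b Y e -> killQP a.+1 b (Y :|: B) e.
Proof.
move=> tB kY R; move: {2}#|_| (leqnn #|[set c | (c.1 != ord_max) && (R c \notin Y)]|) => n.
elim: n R => [|n IH] R le_n RI RY.
  (* No upper cell is left outside Y. With R' the first a rows of R, P R splits off the last row, Q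
     R absorbs Q R', which commutes with the symmetrizer of that row, and Q R' * P R' kills e. *)
  have RY' i c : i != ord_max -> R (i, c) \in Y.
    move=> im; apply/negPn/negP => RcY.
    have : (i, c) \in [set c | (c.1 != ord_max) && (R c \notin Y)] by rewrite inE /= im.
    by move: le_n; rewrite leqn0 cards_eq0 => /eqP ->; rewrite inE.
  pose R' (c : 'I_a * 'I_b) := R (widen_ord (leqnSn a) c.1, c.2).
  have wm (i : 'I_a) : widen_ord (leqnSn a) i != ord_max.
    by rewrite -val_eqE /= neq_ltn ltn_ord.
  have R'I : injective R' by move=> [i c] [i' c'] /RI [/val_inj -> ->].
  pose D := [set x | rowR R x == inl ord_max].
  have rD x y : rowR R x = rowR R y -> (x \in D) = (y \in D) by rewrite !inE => ->.
  have wid (i : 'I_a.+1) : i != ord_max -> exists i' : 'I_a, i = widen_ord (leqnSn a) i'.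
    move=> im; have ia : (i < a)%N by rewrite ltn_neqAle -ltnS ltn_ord andbT -val_eqE in im *.
    by exists (Ordinal ia); exact: val_inj.
  have outR' x : (forall c, R c != x) -> (forall c, R' c != x) by move=> xo c; exact: xo.
  have outR'm c : forall c', R' c' != R (ord_max, c).
    by move=> c'; rewrite (inj_eq RI) xpair_eqE (negPf (wm _)).
  have cRR x y : colR R' x = colR R' y -> colR R x = colR R y.
    case: (in_or_out R' x) => [[c ->]|xo]; case: (in_or_out R' y) => [[c' ->]|yo].
    - by rewrite !(colRE _ R'I) => -[/= E]; rewrite /R' !(colRE _ RI) /= E.
    - by rewrite (colRE _ R'I) (colR_out yo).
    - by rewrite (colRE _ R'I) (colR_out xo).
    - by rewrite (colR_out xo) (colR_out yo) => -[->].
  apply: (scalerI (card_stabf_neq0 C (colR R'))); rewrite scaler0 !scalerAl.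
  rewrite -(asym_absorbr C cRR) (psym_split C rD).
  set P1 := psym C _; set P2 := psym C _.
  have -> : P2 = P R'.
    apply: eq_psym => x y; rewrite /D !inE.
    have E1 c : (if rowR R (R' c) == inl ord_max then inr (R' c) else inl (rowR R (R' c))) =
        inl (inl (widen_ord (leqnSn a) c.1)) :> (('I_a.+1 + X) + X)%type.
      rewrite /R' rowRE //=; case: eqP => // -[E].
      by have := wm c.1; rewrite -val_eqE /= E eqxx.
    have E2 u : (forall c, R' c != u) ->
        (if rowR R u == inl ord_max then inr u else inl (rowR R u)) =
        (if rowR R u == inl ord_max then inr u else inl (inr u)) :> (('I_a.+1 + X) + X)%type.
      move=> uo; case: ifP => // um; congr inl.
      case: (in_or_out R u) => [[[i c1] uR]|uo']; last by rewrite rowR_out.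
      have [|i' ii'] := wid i; first by apply: contraFneq um => im; rewrite uR rowRE // -im.
      by have := uo (i', c1); rewrite /R' /= -ii' -uR eqxx.
    case: (in_or_out R' x) => [[c ->]|xo]; case: (in_or_out R' y) => [[c' ->]|yo].
    - by rewrite !E1 !(rowRE _ R'I); apply/eqP/eqP => [[/val_inj ->]|[->]].
    - by rewrite E1 (E2 _ yo) (rowRE _ R'I) (rowR_out yo); case: ifP.
    - by rewrite E1 (E2 _ xo) (rowRE _ R'I) (rowR_out xo); case: ifP.
    - rewrite (E2 _ xo) (E2 _ yo) (rowR_out xo) (rowR_out yo).
      case: ifP => xm; case: ifP => ym //; apply/esym/eqP => -[E];
        by rewrite E ym in xm.
  have cm : Q R' * P1 = P1 * Q R'.
    apply: csym_comm => q p /= qc pr; apply/esym/(disjoint_perm_comm (D := D)) => x xD.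
      have /stabfP/(_ x) := pr; rewrite (negPf xD).
      by case: ifP => // _ [].
    have xo : forall c, R' c != x.
      move: xD; rewrite inE => /eqP/(rowR_inl RI)[c ->]; exact: outR'm.
    have /stabfP/(_ x) := qc; rewrite (colR_out xo).
    case: (in_or_out R' (q x)) => [[c ->]|qo]; first by rewrite colRE.
    by rewrite colR_out // => -[].
  have -> : Q R * Q R' * (P1 * P R') * e = Q R * (Q R' * P1) * P R' * e by rewrite !mulrA.
  rewrite cm; have -> : Q R * (P1 * Q R') * P R' * e = Q R * P1 * (Q R' * P R' * e) by rewrite !mulrA.
  rewrite kY ?mulr0 // => c; exact: RY'.
case: (pickP (mem [set c | (c.1 != ord_max) && (R c \notin Y)])) => [[i c]|no]; last first.
  apply: IH => //; rewrite (_ : [set _ | _] = finset.set0) ?cards0 //.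
  by apply/setP => x; have := no x; rewrite /= !inE.
rewrite /= inE /= => /andP[im zY]; set z := R (i, c).
have zB : z \in B by have := RY (i, c); rewrite inE (negPf zY).
(* The Garnir relation is applied to e. For y in B the transposition fixes e, so these terms are
   copies of Q R * P R * e, at least one because of y = z. The other y lie in the last row and in Y;
   exchanging them with z leaves one bad cell fewer. *)
have := congr1 (fun u => u * e) (garnir c RI im).
rewrite mul0r -mulrA mulr_suml mulr_sumr (bigID (mem B)) /= [X in _ + X]big1 ?addr0.
  rewrite (eq_bigr (fun _ => Q R * P R * e)); last first.
    by move=> y /andP[_ yB]; rewrite tB.
  rewrite sumr_const -scaler_nat => /eqP; rewrite scaler_eq0 => /orP[|/eqP //].
  rewrite pnatr_eq0 -leqn0 leqNgt => /negP[]; apply/card_gt0P; exists z.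
  by rewrite unfold_in /= eqxx zB.
move=> y /andP[/orP[/eqP ->|/eqP/(rowR_inl RI)[c' yR]] yB]; first by rewrite zB in yB.
have yY : y \in Y by have := RY (ord_max, c'); rewrite inE -yR (negPf yB) orbF.
rewrite mulrA QP_gel // -mulrA IH ?mulr0 //; last 2 first.
- exact: comp_perm_inj.
- by move=> c2 /=; case: tpermP => [_|_|_ _]; rewrite ?inE ?yY ?zB ?orbT // -finset.in_setU.
rewrite -ltnS; apply: leq_trans le_n; apply: proper_card; apply/properP; split.
  apply/fintype.subsetP => -[i2 c2]; rewrite !inE /= => /andP[i2m]; rewrite i2m /=.
  case: tpermP => [_|E|_ _ //]; first by rewrite yY.
  by move: i2m; rewrite yR in E; have [-> _] := RI _ _ E; rewrite eqxx.
exists (i, c); first by rewrite inE /= im.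
by rewrite inE /= tpermL yY andbF.
Qed.

End Rect.

Section RectSgt.
Variables (C : numClosedFieldType) (X : finType).
Implicit Types (Y B : {set X}) (e : galg C {perm X}).

(* Twisting by the sign exchanges rows and columns. *)
Lemma killQP_sgt a b Y e : killPQ a b Y e -> killQP b a Y (sgt e).
Proof.
move=> k R RI RY.
pose R' (c : 'I_a * 'I_b) := R (c.2, c.1).
have R'I : injective R' by move=> [i j] [i' j'] /RI [-> ->].
have := k R' R'I (fun c => RY _) => /(congr1 (@sgt _ _)).
rewrite !sgtM sgt_psym sgt_asym sgt0.
have E1 : asym C (rowR R') = asym C (colR R).
  apply: eq_asym => x y.
  have E u : rowR R' u = colR R u.
    case: (in_or_out R u) => [[[i j] ->]|uo].
      by rewrite colRE // -[R _]/(R' (j, i)) rowRE.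
    by rewrite colR_out // rowR_out // => c; exact: uo.
  by rewrite !E.
have E2 : psym C (colR R') = psym C (rowR R).
  apply: eq_psym => x y.
  have E u : colR R' u = rowR R u.
    case: (in_or_out R u) => [[[i j] ->]|uo].
      by rewrite rowRE // -[R _]/(R' (j, i)) colRE.
    by rewrite rowR_out // colR_out // => c; exact: uo.
  by rewrite !E.
by rewrite E1 E2.
Qed.

(** The row version for [sgt e]. Each twist transposes the grid and reverses the order of P and Q,
    so each is preceded by [killQP_PQ]. *)
Lemma killQP_col a b Y B e :
  (forall x y, x \in B -> y \in B -> x != y -> gel C (tperm x y) * e = - e) ->
  killQP a b Y e -> killQP a b.+1 (Y :|: B) e.
Proof.
move=> tB /killQP_PQ/killQP_sgt k.
have {}k : killQP b.+1 a (Y :|: B) (sgt e).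
  apply: killQP_row => // x y xB yB.
  case: (eqVneq x y) => [->|xy]; first by rewrite tperm1 gel1 mul1r.
  have E : sgt (gel C (tperm x y)) = - gel C (tperm x y).
    by rewrite sgt_gel odd_tperm xy expr1 scaleN1r.
  by rewrite -[gel C _]opprK -E mulNr -sgtM tB // sgtN opprK.
by rewrite -[e]sgtK; apply: killQP_sgt; apply: killQP_PQ.
Qed.

Lemma killQP_sub a b Y Y' e : Y' \subset Y -> killQP a b Y e -> killQP a b Y' e.
Proof. by move=> YY k R RI RY; apply: k => // c; apply: (fintype.subsetP YY). Qed.

Lemma killQP_rows m a b Y (B : nat -> {set X}) e :
  (forall l x y, (l < m)%N -> x \in B l -> y \in B l -> gel C (tperm x y) * e = e) ->
  killQP a b Y e -> killQP (m + a) b (Y :|: \bigcup_(l < m) B l) e.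
Proof.
elim: m => [|m IH] tB k; first by rewrite big_ord0 finset.setU0.
rewrite big_ord_recr finset.setUA addSn; apply: killQP_row; first by move=> x y; apply: tB.
by apply: IH => // l x y lm; apply: tB; exact: ltnW.
Qed.

Lemma killQP_cols n a b Y (B : nat -> {set X}) e :
  (forall l x y, (l < n)%N -> x \in B l -> y \in B l -> x != y ->
     gel C (tperm x y) * e = - e) ->
  killQP a b Y e -> killQP a (n + b) (Y :|: \bigcup_(l < n) B l) e.
Proof.
elim: n => [|n IH] tB k; first by rewrite big_ord0 finset.setU0.
rewrite big_ord_recr finset.setUA addSn; apply: killQP_col; first by move=> x y; apply: tB.
by apply: IH => // l x y ln; apply: tB; exact: ltnW.
Qed.

End RectSgt.

(** * Words in even and odd letters *)

Section Words.
Variables (X : finType) (m n : nat).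

(* Letters are m even ones, n odd ones, and None; the points labelled None
   have to be fixed by the stabilizer of the word. *)
Definition letter := option ('I_m + 'I_n).
Implicit Type x : X -> letter.

Definition wlab x (i : X) : ('I_m + 'I_n) + X := if x i is Some l then inl l else inr i.

Definition wodd x : {set X} := [set i | if x i is Some (inr _) then true else false].

Definition wsgn x (s : {perm X}) : bool := odd_perm (restr_perm (wodd x) s).

Lemma wlabP x i j : wlab x i = wlab x j -> x i = x j.
Proof. by rewrite /wlab; case: (x i) => [l|]; case: (x j) => [l'|] // [->]. Qed.

Lemma wodd_norm x s : s \in stabf (wlab x) -> s \in 'N(wodd x | 'P)%g.
Proof.
by move=> /stabfP xs; apply/astabsP => i; rewrite /= apermE !inE (wlabP (xs i)).
Qed.

Lemma wsgnM x : {in stabf_group (wlab x) &, forall g h, wsgn x (g * h)%g = wsgn x g (+) wsgn x h}.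
Proof.
move=> g h gx hx; rewrite /wsgn.
by rewrite [restr_perm _ _](morphM (restr_perm_morphism (wodd x))) ?wodd_norm // odd_permM.
Qed.

Lemma restr_perm_id (D : {set X}) p :
  p \in 'N(D | 'P)%g -> (forall i, i \notin D -> p i = i) -> restr_perm D p = p.
Proof.
move=> pD pi; apply/permP => i; case: (boolP (i \in D)) => iD; first by rewrite restr_permE.
by rewrite (out_perm (restr_perm_on D p)) // pi.
Qed.

Variable C : numClosedFieldType.

Definition wproj x : galg C {perm X} := csym C (stabf_group (wlab x)) (wsgn x).

Lemma tperm_wstab x i j l : x i = Some l -> x j = Some l -> tperm i j \in stabf (wlab x).
Proof.
by move=> xi xj; apply/stabfP => k; rewrite /wlab; case: tpermP => [->|->|//]; rewrite xi xj.
Qed.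

Lemma wproj_even x i j l : x i = Some (inl l) -> x j = Some (inl l) ->
  gel C (tperm i j) * wproj x = wproj x.
Proof.
move=> xi xj; rewrite /wproj csym_mull ?(tperm_wstab xi xj) //; last exact: wsgnM.
suff -> : wsgn x (tperm i j) = false by rewrite expr0 scale1r.
rewrite /wsgn [restr_perm _ _](_ : _ = 1%g) ?odd_perm1 //; apply/permP => k; rewrite perm1.
case: (boolP (k \in wodd x)) => kD; last by rewrite (out_perm (restr_perm_on _ _)).
rewrite restr_permE ?wodd_norm ?(tperm_wstab xi xj) //.
by case: tpermP kD => [->|->|//]; rewrite inE ?xi ?xj.
Qed.

Lemma wproj_odd x i j l : x i = Some (inr l) -> x j = Some (inr l) -> i != j ->
  gel C (tperm i j) * wproj x = - wproj x.
Proof.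
move=> xi xj ij; rewrite /wproj csym_mull ?(tperm_wstab xi xj) //; last exact: wsgnM.
suff -> : wsgn x (tperm i j) = true by rewrite expr1 scaleN1r.
rewrite /wsgn restr_perm_id ?odd_tperm ?ij ?wodd_norm ?(tperm_wstab xi xj) // => k kD.
by rewrite tpermD //; apply: contraNneq kD => <-; rewrite inE ?xi ?xj.
Qed.

(** An even letter is a block on which e is symmetric and adds a row to the rectangle; an odd letter
    is one on which e is antisymmetric and adds a column. Together with Y the blocks cover X. *)
Lemma kill_letters a b (Y : {set X}) (x : X -> letter) (e : galg C {perm X}) :
  (forall i j l, x i = Some (inl l) -> x j = Some (inl l) -> gel C (tperm i j) * e = e) ->
  (forall i j l, x i = Some (inr l) -> x j = Some (inr l) -> i != j ->
     gel C (tperm i j) * e = - e) ->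
  (forall i, i \in Y \/ x i <> None) ->
  killQP a b Y e -> killQP (m + a) (n + b) finset.setT e.
Proof.
move=> xe xo xY k.
pose Be l := [set i | if x i is Some (inl l') then nat_of_ord l' == l else false].
pose Bo l := [set i | if x i is Some (inr l') then nat_of_ord l' == l else false].
have BeP l i : i \in Be l -> exists2 l' : 'I_m, x i = Some (inl l') & nat_of_ord l' = l.
  by rewrite inE; case: (x i) => [[l'|l']|] // /eqP; exists l'.
have BoP l i : i \in Bo l -> exists2 l' : 'I_n, x i = Some (inr l') & nat_of_ord l' = l.
  by rewrite inE; case: (x i) => [[l'|l']|] // /eqP; exists l'.
have {}k := @killQP_rows C X m a b Y Be e _ k.
have {}k : killQP (m + a) b (Y :|: \bigcup_(l < m) Be l) e.
  apply: k => l i j _ /BeP[l1 xi <-] /BeP[l2 xj] /val_inj E.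
  by apply: (xe _ _ _ xi); rewrite xj E.
have {}k := @killQP_cols C X n _ b _ Bo e _ k.
apply: (killQP_sub _ (k _)) => [|l i j _ /BoP[l1 xi <-] /BoP[l2 xj] /val_inj E ij]; last first.
  by apply: (xo _ _ _ xi) => //; rewrite xj E.
apply/fintype.subsetP => i _; rewrite !inE; case: (xY i) => [->//|].
case xi: (x i) => [[l|l]|] // _.
  apply/orP; left; apply/orP; right; apply/finset.bigcupP; exists l => //.
  by rewrite inE xi.
by apply/orP; right; apply/finset.bigcupP; exists l => //; rewrite inE xi.
Qed.

End Words.

Lemma extf_extf (X1 X Y : finType) (T : eqType) (R : X1 -> X) (f : X -> Y) (g : X1 -> T) x y :
  injective R -> injective f ->
  (extf f (extf R g) x == extf f (extf R g) y) = (extf (f \o R) g x == extf (f \o R) g y).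
Proof.
move=> RI fI; have fRI : injective (f \o R) by exact: inj_comp.
have E z : extf f (extf R g) z =
   match extf (f \o R) g z with inl t => inl (inl t)
   | inr v => if [pick u | f u == z] is Some u then inl (inr u) else inr v end.
  case: (in_or_out f z) => [[u ->]|zo]; last first.
    rewrite extf_out // extf_out => [|c]; last exact: zo.
    by rewrite pick_out.
  rewrite extfE //; case: (in_or_out R u) => [[c ->]|uo].
    by rewrite extfE // -[f (R c)]/((f \o R) c) extfE.
  rewrite extf_out // [extf (f \o R) _ _]extf_out ?pick_inj // => c /=.
  by rewrite (inj_eq fI).
rewrite !E; case: (in_or_out (f \o R) x) => [[c ->]|xo];
  case: (in_or_out (f \o R) y) => [[c' ->]|yo].
- by rewrite !extfE.
- by rewrite extfE // extf_out //; case: pickP.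
- by rewrite extfE // extf_out //; case: pickP.
- rewrite !extf_out //; case: (in_or_out f x) => [[u xu]|xo']; case: (in_or_out f y) => [[v yv]|yo'].
  + by rewrite xu yv !pick_inj //; rewrite -[LHS]/(u == v) -[RHS]/(f u == f v) (inj_eq fI).
  + rewrite xu pick_inj // pick_out // -[RHS]/(f u == y); apply/esym/negbTE; exact: yo'.
  + rewrite yv pick_inj // (pick_out xo') -[RHS]/(x == f v) [RHS]eq_sym.
    apply/esym/negbTE; exact: xo'.
  + by rewrite !pick_out.
Qed.

(** * Gluing two blocks of points *)

Section Glue.
Variables (C : numClosedFieldType) (X1 X2 X : finType) (f1 : X1 -> X) (f2 : X2 -> X).
Hypotheses (f1I : injective f1) (f2I : injective f2).
Hypothesis f12 : forall a b, f1 a <> f2 b.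
Hypothesis fcover : forall y, (exists a, y = f1 a) \/ (exists b, y = f2 b).

Local Notation iota1 := (push (C := C) (pext f1I)).
Local Notation iota2 := (push (C := C) (pext f2I)).

Lemma pext_disj s t : (pext f1I s * pext f2I t = pext f2I t * pext f1I s)%g.
Proof.
apply/permP => y; rewrite !permM; case: (fcover y) => [[a ->]|[b ->]].
  rewrite pextE; rewrite ![pext f2I t _]pext_out ?pextE // => b; apply/eqP => E.
    exact: (f12 (esym E)).
  exact: (f12 (esym E)).
rewrite pextE; rewrite ![pext f1I s _]pext_out ?pextE // => b'; apply/eqP; exact: f12.
Qed.

Lemma push_disj a b : iota1 a * iota2 b = iota2 b * iota1 a.
Proof.
have -> : iota1 a = \sum_s a s *: gel C (pext f1I s) by [].
have -> : iota2 b = \sum_t b t *: gel C (pext f2I t) by [].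
rewrite mulr_suml mulr_sumr; apply: eq_bigr => s _.
rewrite mulr_suml mulr_sumr; apply: eq_bigr => t _.
rewrite -!scalerAl -!scalerAr !scalerA mulrC; congr (_ *: _).
by rewrite -!gelM pext_disj.
Qed.

(** The two factors commute, so transpositions of points of f2 reach [wproj] and act by its signs,
    while rectangles inside the image of f1 are killed by c alone. *)
Lemma kill_glue m n a b (x : X2 -> letter m n) (c : galg C {perm X1}) :
  (forall i, x i <> None) -> killQP a b finset.setT c ->
  killQP (m + a) (n + b) finset.setT (iota1 c * iota2 (wproj C x)).
Proof.
move=> xN k; pose x' y : letter m n := if [pick b | f2 b == y] is Some b then x b else None.
have x'2 i : x' (f2 i) = x i by rewrite /x' pick_inj.
have x'P i l : x' i = Some l -> exists2 b, i = f2 b & x b = Some l.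
  by rewrite /x'; case: pickP => // b' /eqP <- E; exists b'.
have tp i j : gel C (tperm (f2 i) (f2 j)) = iota2 (gel C (tperm i j)).
  by rewrite push_gel pext_tperm.
have M2 := pushM (pextM f2I).
apply: (@kill_letters X m n C a b [set f1 a | a in finset.setT] x').
- move=> i j l /x'P[i' -> xi] /x'P[j' -> xj].
  by rewrite tp mulrA -push_disj -mulrA -M2 (wproj_even C xi xj).
- move=> i j l /x'P[i' -> xi] /x'P[j' -> xj] ij.
  rewrite tp mulrA -push_disj -mulrA -M2 (wproj_odd C xi xj) //; last first.
    by apply: contraNneq ij => ->.
  by rewrite -scaleN1r pushZ scaleN1r mulrN.
- move=> y; case: (fcover y) => [[a' ->]|[b' ->]]; first by left; apply: imset_f.
  by right; rewrite x'2.
move=> R RI RY.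
have ex c' : exists a', f1 a' == R c'.
  by have /imsetP[a' _ ->] := RY c'; exists a'.
pose R0 c' := xchoose (ex c').
have R0E c' : f1 (R0 c') = R c' by apply/eqP/(xchooseP (ex c')).
have R0I : injective R0 by move=> c1 c2 E; apply: RI; rewrite -!R0E E.
have RE : R = f1 \o R0 by apply/funext => c' /=; rewrite R0E.
have -> : asym C (colR R) = iota1 (asym C (colR R0)).
  by rewrite push_asym; apply: eq_asym => u v; rewrite /colR extf_extf // -RE.
have -> : psym C (rowR R) = iota1 (psym C (rowR R0)).
  by rewrite push_psym; apply: eq_psym => u v; rewrite /rowR extf_extf // -RE.
rewrite -(pushM (pextM f1I)) mulrA -(pushM (pextM f1I)) k // ?push0 ?mul0r //.
Qed.

End Glue.

Section Gsum.
Variables (C : numClosedFieldType) (gT : finGroupType).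

(** Signed families rather than signed subsets of the group: a product of symmetrizers is again such
    a family, over pairs, and its trace is a signed count of the factorizations of 1. *)
Definition gsum (I : finType) (A : pred I) (w : I -> bool) (g : I -> gT) : galg C gT :=
  \sum_(i | A i) (-1) ^+ w i *: gel C (g i).

Lemma gsumM (I J : finType) (A : pred I) (B : pred J) w v g h :
  gsum A w g * gsum B v h =
  gsum (fun p : I * J => A p.1 && B p.2) (fun p => w p.1 (+) v p.2) (fun p => (g p.1 * h p.2)%g).
Proof.
rewrite /gsum big_distrlr /= pair_big /=; apply: eq_bigr => p _.
by rewrite -scalerAl -scalerAr scalerA -gelM signr_addb.
Qed.

Lemma tr_gsum_neq0 (I : finType) (A : pred I) w g i0 :
  (forall i, A i -> g i = 1%g -> w i = false) -> A i0 -> g i0 = 1%g -> tr (gsum A w g) != 0.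
Proof.
move=> Aw A0 g0.
have -> : tr (gsum A w g) = (\sum_(i | A i) (g i == 1%g))%:R.
  rewrite natr_sum /tr galg_sumE; apply: eq_bigr => i Ai.
  rewrite galg_scaleE gelE eq_sym; case: eqP => [gi|_]; last by rewrite mulr0.
  by rewrite Aw // mul1r.
by rewrite pnatr_eq0 (bigD1 i0) //= g0 eqxx.
Qed.

Lemma csym_gsum (G : {group gT}) e : csym C G e = gsum (mem G) e id.
Proof. by rewrite csym_sum. Qed.

End Gsum.

Lemma push_gsum (C : numClosedFieldType) (gT hT : finGroupType) (phi : gT -> hT)
  (I : finType) (A : pred I) (w : I -> bool) (g : I -> gT) :
  push phi (gsum C A w g) = gsum C A w (phi \o g).
Proof.
by rewrite /gsum push_sum; apply: eq_bigr => i _; rewrite pushZ push_gel.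
Qed.

(** * Non-vanishing of a trace *)

Section Trace.
Variables (C : numClosedFieldType) (Z X1 X2 X : finType).
Variables (f : Z -> X) (f1 : X1 -> X) (f2 : X2 -> X).
Hypotheses (fI : injective f) (f1I : injective f1) (f2I : injective f2).
Hypothesis f12 : forall a b, f1 a <> f2 b.
Hypothesis fcover : forall y, (exists a, y = f1 a) \/ (exists b, y = f2 b).
Variables (row col : Z -> nat) (row1 col1 : X1 -> nat) (m n : nat) (x : X2 -> letter m n).
Hypothesis rcI : forall z z', row z = row z' -> col z = col z' -> z = z'.
Hypothesis rc1I : forall a b, row1 a = row1 b -> col1 a = col1 b -> a = b.
Hypothesis cellE : forall z, (row z < m)%N -> exists2 b, f z = f2 b &
  exists2 l, x b = Some (inl l) & nat_of_ord l = row z.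
Hypothesis cellO : forall z, (m <= row z)%N -> (col z < n)%N -> exists2 b, f z = f2 b &
  exists2 l, x b = Some (inr l) & nat_of_ord l = col z.
Hypothesis cell1 : forall z, (m <= row z)%N -> (n <= col z)%N -> exists2 a, f z = f1 a &
  row z = (m + row1 a)%N /\ col z = (n + col1 a)%N.
Hypothesis f2_f : forall b, exists z, f2 b = f z.

(* If p q k q' p' = 1 then q fixes the cells of the even rows, agrees with the
   inverse of k on the odd columns and with that of q' on the remaining
   diagram, so all terms contributing to the trace have sign 1. *)
Section Elt.
Variables (p q : {perm X}) (k : {perm X2}) (q' p' : {perm X1}).
Hypotheses (pP : p \in stabf (extf f row)) (qP : q \in stabf (extf f col)).
Hypotheses (kP : k \in stabf (wlab x)) (q'P : q' \in stabf col1) (p'P : p' \in stabf row1).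
Hypothesis prod1 : (p * q * pext f2I k * pext f1I q' * pext f1I p' = 1)%g.

(** Since the product is 1, the last four factors compose to p^-1, so F preserves rows; its
    definition controls columns and letters at the same time. *)
Let F y := pext f1I p' (pext f1I q' (pext f2I k (q y))).

Let FE y : F y = (p^-1)%g y.
Proof.
have /permP/(_ (p^-1 y)%g) := prod1; rewrite !permM perm1 permKV.
by rewrite /F => <-.
Qed.

Let Frow y : extf f row (F y) = extf f row y.
Proof. by rewrite FE; have /stabfP -> := groupVr pP. Qed.

Let Ff z : exists2 z', F (f z) = f z' & row z' = row z.
Proof.
have := Frow (f z); rewrite extfE //; case: (in_or_out f (F (f z))) => [[z' ->]|yo].
  by rewrite extfE // => -[rz]; exists z'.
by rewrite extf_out.
Qed.

Let qf z : exists2 z', q (f z) = f z' & col z' = col z.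
Proof.
have /stabfP/(_ (f z)) := qP; rewrite extfE //; case: (in_or_out f (q (f z))) => [[z' ->]|yo].
  by rewrite extfE // => -[cz]; exists z'.
by rewrite extf_out.
Qed.

Let p1f2 s b : pext f1I s (f2 b) = f2 b.
Proof. by rewrite pext_out // => a; apply/eqP. Qed.

Let p2f1 s a : pext f2I s (f1 a) = f1 a.
Proof. by rewrite pext_out // => b; apply/eqP => E; exact: (f12 (esym E)). Qed.

Let F2 y b : q y = f2 b -> F y = f2 (k b).
Proof. by move=> qy; rewrite /F qy pextE !p1f2. Qed.

Let F1 y a : q y = f1 a -> F y = f1 (p' (q' a)).
Proof. by move=> qy; rewrite /F qy p2f1 !pextE. Qed.

Let kx b : x (k b) = x b.
Proof. by apply: wlabP; have /stabfP := kP. Qed.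

(** F keeps z in its row, so its value carries the even letter of that row. As k preserves letters,
    q already sends z to a point with this letter, hence to a cell of the same row; q preserves
    columns, so this cell is z. *)
Lemma trace_even z : (row z < m)%N -> q (f z) = f z.
Proof.
move=> rz; have [z' Fz rz'] := Ff z; have [z'' qz cz''] := qf z.
have [b' fz' [l' xb' lb']] : exists2 b, f z' = f2 b & exists2 l, x b = Some (inl l) & nat_of_ord l = row z'.
  by apply: cellE; rewrite rz'.
have [[a qa]|[b qb]] := fcover (q (f z)).
  by exfalso; apply: (f12 (a := p' (q' a)) (b := b')); rewrite -(F1 qa) -fz'.
have kb : k b = b' by apply: f2I; rewrite -(F2 qb) Fz.
have xb : x b = Some (inl l') by rewrite -kx kb.
suff E : z'' = z by rewrite qz E.
apply: rcI => //; rewrite -rz' -lb'.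
case: (ltnP (row z'') m) => [/cellE[b2 fb2 [l2 xb2 <-]]|r2].
  have E : b2 = b by apply: f2I; rewrite -fb2 -qb qz.
  by move: xb2; rewrite E xb => -[->].
case: (ltnP (col z'') n) => c2.
  have [b2 fb2 [l2 xb2 _]] := cellO r2 c2.
  have E : b2 = b by apply: f2I; rewrite -fb2 -qb qz.
  by move: xb2; rewrite E xb.
have [a fa _] := cell1 r2 c2.
by exfalso; apply: (f12 (a := a) (b := b)); rewrite -fa -qz.
Qed.

Lemma trace_low z z' : (m <= row z)%N -> q (f z) = f z' -> (m <= row z')%N.
Proof.
move=> rz qz; rewrite leqNgt; apply/negP => rz'.
have := trace_even rz'; rewrite -qz => /perm_inj; rewrite qz => /fI E.
by move: rz'; rewrite E ltnNge rz.
Qed.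

(** Here q keeps the column, which is the odd letter, k keeps the letter, and F keeps the row: the
    cell reached is z again, so k undoes q. *)
Lemma trace_odd z : (m <= row z)%N -> (col z < n)%N ->
  exists2 b, q (f z) = f2 b & f2 (k b) = f z /\ b \in wodd x.
Proof.
move=> rz cz; have [z' Fz rz'] := Ff z; have [z'' qz cz''] := qf z.
have rz'' := trace_low rz qz.
have [b fb [l xb lb]] := cellO rz'' (eq_ind_r (fun c => (c < n)%N) cz cz'').
exists b; first by rewrite qz.
split; last by rewrite inE xb.
have qb : q (f z) = f2 b by rewrite qz.
rewrite -(F2 qb) Fz; congr f; apply: rcI => //.
have fkb : f z' = f2 (k b) by rewrite -Fz (F2 qb).
have xkb : x (k b) = Some (inr l) by rewrite kx.
have r' : (m <= row z')%N by rewrite rz'.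
case: (ltnP (col z') n) => c'; last first.
  have [a fa _] := cell1 r' c'.
  by exfalso; apply: (f12 (a := a) (b := k b)); rewrite -fa.
have [b2 fb2 [l2 xb2 <-]] := cellO r' c'.
have E : b2 = k b by apply: f2I; rewrite -fb2.
by move: xb2; rewrite E xkb -cz'' -lb => -[->].
Qed.

Lemma trace_one a : exists2 b, q (f1 a) = f1 b & q' b = a.
Proof.
case: (in_or_out f (f1 a)) => [[z fz]|ao]; last first.
  (* A point outside the diagram is fixed by q and by F. Then p' undoes q' at a, and q' a shares
     both row and column with a. *)
  have qa : q (f1 a) = f1 a.
    have /stabfP/(_ (f1 a)) := qP; rewrite [RHS]extf_out //.
    case: (in_or_out f (q (f1 a))) => [[z ->]|yo]; first by rewrite extfE.
    by rewrite extf_out // => -[].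
  exists a => //; have Fa : F (f1 a) = f1 a.
    have := Frow (f1 a); rewrite [RHS]extf_out //.
    case: (in_or_out f (F (f1 a))) => [[z ->]|yo]; first by rewrite extfE.
    by rewrite extf_out // => -[].
  have E : p' (q' a) = a by apply: f1I; rewrite -(F1 qa).
  apply: rc1I; last by have /stabfP -> := q'P.
  by rewrite -{2}E; have /stabfP -> := p'P.
have rz : (m <= row z)%N.
  by rewrite leqNgt; apply/negP => /cellE[b E]; case: (f12 (a := a) (b := b)); rewrite fz.
have cz : (n <= col z)%N.
  by rewrite leqNgt; apply/negP => /(cellO rz)[b E]; case: (f12 (a := a) (b := b)); rewrite fz.
have [z' Fz rz'] := Ff z; have [z'' qz cz''] := qf z.
have rz'' := trace_low rz qz.
have [b fb [rb cb]] := cell1 rz'' (eq_ind_r (fun c => (n <= c)%N) cz cz'').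
exists b; first by rewrite fz qz.
have qb : q (f z) = f1 b by rewrite qz.
have [a0 fa0 [ra ca]] := cell1 rz cz.
have {fa0} E : a0 = a by apply: f1I; rewrite -fa0.
rewrite {a0}E in ra ca.
have fz' : f z' = f1 (p' (q' b)) by rewrite -Fz (F1 qb).
have r' : (m <= row z')%N by rewrite rz'.
have c' : (n <= col z')%N.
  rewrite leqNgt; apply/negP => /(cellO r')[b2 E].
  by case: (f12 (a := p' (q' b)) (b := b2)); rewrite -fz'.
have [a' fa' [ra' _]] := cell1 r' c'.
have E : a' = p' (q' b) by apply: f1I; rewrite -fa'.
apply: rc1I.
  have /stabfP/(_ (q' b)) := p'P; rewrite -E => <-.
  by apply: (@addnI m); rewrite -ra' rz' ra.
have /stabfP -> := q'P; apply: (@addnI n); by rewrite -cb cz'' ca.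
Qed.

Lemma trace_sign : odd_perm q (+) wsgn x k (+) odd_perm q' = false.
Proof.
suff : (q * pext f2I (restr_perm (wodd x) k) * pext f1I q' = 1)%g.
  by move=> /(congr1 (@odd_perm _)); rewrite !odd_permM odd_perm1 !odd_pext.
apply/permP => y; rewrite !permM perm1.
have [[a ->]|[b ->]] := fcover y.
  by have [b -> qb] := trace_one a; rewrite p2f1 pextE qb.
have [z ->] := f2_f b.
case: (ltnP (row z) m) => rz.
  rewrite trace_even //; have [b' -> [l xb _]] := cellE rz.
  by rewrite pextE (out_perm (restr_perm_on _ _)) ?p1f2 // inE xb.
case: (ltnP (col z) n) => cz; last first.
  have [a -> _] := cell1 rz cz.
  by have [b' -> qb] := trace_one a; rewrite p2f1 pextE qb.
have [b' -> [kb bo]] := trace_odd rz cz.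
by rewrite pextE restr_permE ?wodd_norm // kb -kb p1f2.
Qed.

End Elt.

Lemma trace_neq0 :
  psym C (extf f row) * asym C (extf f col) * push (pext f2I) (wproj C x) *
  push (pext f1I) (asym C col1) * push (pext f1I) (psym C row1) != 0.
Proof.
suff : tr (psym C (extf f row) * asym C (extf f col) * push (pext f2I) (wproj C x) *
  push (pext f1I) (asym C col1) * push (pext f1I) (psym C row1)) != 0.
  by apply: contra_neq => ->; exact: tr0.
rewrite /wproj !psym_csym !asym_csym !csym_gsum !push_gsum !gsumM.
apply: (tr_gsum_neq0 _ (i0 := (((1, 1), 1), 1, 1)%g)) => [[[[[p q] k] q'] p']|/=|/=] /=.
- rewrite addbF => /andP[/andP[/andP[/andP[pP qP] kP] q'P] p'P] E.
  exact: (trace_sign pP qP kP q'P p'P E).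
- by rewrite !group1.
- by rewrite !(morphg1 (pextM _)) !mulg1.
Qed.

End Trace.

(** * Completeness of the Young symmetrizers *)

Section CycleType.
Variable X : finType.
Implicit Types (s t : {perm X}) (c : {set X}).

Lemma sum_card_porbits s : (\sum_(c in porbits s) #|c| = #|X|)%N.
Proof.
rewrite -cardsT -sum1_card /porbits.
rewrite [RHS](partition_big_imset (porbit s)) /=; apply: eq_big => [c|c].
  by apply/imsetP/imsetP => -[x _ ->]; exists x.
move=> /imsetP[x _ ->]; rewrite -sum1_card; apply: eq_bigl => y.
by rewrite !inE eq_porbit_mem.
Qed.

Definition cycles s : seq {set X} :=
  sort (relpre (fun c => #|c|) geq) (enum (porbits s)).

Definition cycle_type s : seq nat := [seq #|c| | c <- cycles s].

Lemma mem_cycles s c : (c \in cycles s) = (c \in porbits s).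
Proof. by rewrite mem_sort mem_enum. Qed.

Lemma cycle_type_partition s : is_partition (cycle_type s).
Proof.
apply/andP; split.
  rewrite /cycle_type -sort_map; apply: sort_sorted => a b; exact: leq_total.
apply/allP => k /mapP[c]; rewrite mem_cycles => /imsetP[x _ ->] ->.
by apply/card_gt0P; exists x; exact: porbit_id.
Qed.

Lemma sumn_cycle_type s : sumn (cycle_type s) = #|X|.
Proof.
rewrite /cycle_type /cycles -sort_map (perm_sumn (permEl (perm_sort _ _))).
by rewrite sumnE big_map big_enum /= sum_card_porbits.
Qed.

Lemma iter_modn_porbit s x k : iter k s x = iter (k %% #|porbit s x|) s x.
Proof.
rewrite {1}(divn_eq k #|porbit s x|) addnC iterD; congr iter.
by elim: (_ %/ _)%N => //= q IH; rewrite mulSn iterD IH iter_porbit.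
Qed.

Lemma iter_porbit_inj s x i j : iter i s x = iter j s x ->
  i = j %[mod #|porbit s x|].
Proof.
have d0 : (0 < #|porbit s x|)%N by rewrite lt0n card_porbit_neq0.
rewrite iter_modn_porbit [RHS]iter_modn_porbit => E.
have nthE k : (k < #|porbit s x|)%N -> nth x (traject s x #|porbit s x|) k = iter k s x.
  by move=> kd; rewrite nth_traject.
have := uniq_traject_porbit s x => /(nth_uniq x) U.
have := U (i %% #|porbit s x|)%N (j %% #|porbit s x|)%N.
by rewrite !size_traject !ltn_mod d0 !nthE ?ltn_mod // E eqxx => /(_ isT isT)/esym/eqP.
Qed.

Lemma cycle_type_conj s t : cycle_type s = cycle_type t ->
  exists g, t = (g^-1 * s * g)%g.
Proof.
move=> st; have sz : size (cycles s) = size (cycles t).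
  by have := congr1 size st; rewrite !size_map.
pose r c : option X := [pick x in c].
have rep u c : c \in cycles u -> exists2 x, r c = Some x & c = porbit u x.
  rewrite mem_cycles => /imsetP[x _ cx]; rewrite /r; case: pickP => [y yc|/(_ x)]; last first.
    by rewrite cx porbit_id.
  by exists y => //; rewrite cx; apply/esym/eqP; rewrite eq_porbit_mem -cx.
pose mt c := nth finset.set0 (cycles t) (index c (cycles s)).
have mtP c : c \in cycles s -> mt c \in cycles t /\ #|mt c| = #|c|.
  move=> cs; have ic : (index c (cycles s) < size (cycles t))%N by rewrite -sz index_mem.
  split; first exact: mem_nth.
  have := congr1 (fun l => nth 0%N l (index c (cycles s))) st.
  by rewrite !(nth_map finset.set0) ?sz // nth_index.
have mts c : c \in cycles t -> exists2 c', c' \in cycles s & mt c' = c.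
  move=> ct; have ic : (index c (cycles t) < size (cycles s))%N by rewrite sz index_mem.
  exists (nth finset.set0 (cycles s) (index c (cycles t))); first exact: mem_nth.
  by rewrite /mt index_uniq ?sort_uniq ?enum_uniq // nth_index.
have inc u x : porbit u x \in cycles u by rewrite mem_cycles; apply: imset_f.
(* x = s^k (rep of its cycle) is sent to t^k (rep of the matched cycle). *)
have ex x : exists y, exists k, exists a b,
    [/\ r (porbit s x) = Some a, r (mt (porbit s x)) = Some b, x = iter k s a & y = iter k t b].
  have [a ra pa] := rep _ _ (inc s x).
  have [mc _] := mtP _ (inc s x); have [b rb _] := rep _ _ mc.
  have : x \in porbit s a by rewrite -pa porbit_id.
  move=> /porbitP[k xk]; exists (iter k t b), k, a, b; split=> //.
  by rewrite xk permX.
have [h hP] := choice ex.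
(* The exponent is determined only modulo the length of the cycle, which is also the length of the
   matched cycle; so h does not depend on the choice. *)
have step x k a b : r (porbit s x) = Some a -> r (mt (porbit s x)) = Some b ->
    x = iter k s a -> h x = iter k t b.
  move=> ra rb xk; have [k' [a' [b' []]]] := hP x.
  rewrite ra rb => -[<-] [<-] xk' ->.
  have [a0] := rep _ _ (inc s x); rewrite ra => -[<-] pa.
  have [mc cardm] := mtP _ (inc s x).
  have [b0] := rep _ _ mc; rewrite rb => -[<-] pb.
  have := @iter_porbit_inj s a k' k; rewrite -xk -xk' => /(_ erefl).
  rewrite -pa -cardm pb => E.
  by rewrite iter_modn_porbit E -iter_modn_porbit.
have hs x : h (s x) = t (h x).
  have [k [a [b [ra rb xk ->]]]] := hP x.
  have psx : porbit s (s x) = porbit s x by have := porbit_perm s 1 x; rewrite expg1.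
  by rewrite -iterS; apply: (step _ _ a); rewrite ?psx //= -xk.
have hsurj y : exists x, h x = y.
  have [c cs mc] := mts _ (inc t y).
  have [a ra pa] := rep _ _ cs.
  have [mct _] := mtP _ cs; have [b rb pb] := rep _ _ mct.
  have : y \in porbit t b by rewrite -pb mc porbit_id.
  move=> /porbitP[k yk]; exists (iter k s a); rewrite yk permX.
  have pc : porbit s (iter k s a) = c by rewrite -permX porbit_perm -pa.
  by apply: (step _ _ a); rewrite ?pc.
have hI : injective h.
  have [g hg] := choice hsurj.
  have [g' gK Kg] := injF_bij (can_inj hg).
  have E x : h x = g' x by rewrite -{1}(Kg x) hg.
  by move=> x y; rewrite !E => /(can_inj Kg).
exists (perm hI).
have E : (s * perm hI = perm hI * t)%g by apply/permP => x; rewrite !permM !permE hs.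
by rewrite -mulgA E mulKg.
Qed.

End CycleType.

Section Std.
Variable C : numClosedFieldType.

Definition srow (nu : seq nat) N (i : 'I_N) := reshape_index nu i.
Definition scol (nu : seq nat) N (i : 'I_N) := reshape_offset nu i.
Definition young nu N : galg C 'S_N := psym C (@srow nu N) * asym C (@scol nu N).

Lemma scellP nu N (i : 'I_N) : sumn nu = N -> (scol nu i < nth 0 nu (srow nu i))%N.
Proof. by move=> nuN; apply: reshape_offsetP; rewrite nuN. Qed.

Lemma scell nu N r c : sumn nu = N -> (c < nth 0 nu r)%N ->
  exists2 i : 'I_N, srow nu i = r & scol nu i = c.
Proof.
move=> nuN cr; have lt : (flatten_index nu r c < N)%N by rewrite -nuN flatten_indexP.
exists (Ordinal lt); first exact: flatten_indexKl.
exact: flatten_indexKr.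
Qed.

Lemma scell_inj nu N (i j : 'I_N) : srow nu i = srow nu j -> scol nu i = scol nu j -> i = j.
Proof.
move=> rij cij; apply: val_inj => /=.
by rewrite -(reshape_indexK nu i) -(reshape_indexK nu j) -/(srow nu i) -/(scol nu i) rij cij.
Qed.

Lemma std_diagram nu N : sumn nu = N -> diagram (@srow nu N) (@scol nu N).
Proof.
move=> nuN; split=> [x y|x k kx]; first exact: scell_inj.
by apply: scell => //; apply: ltn_trans kx _; exact: scellP.
Qed.

Lemma partition_nth nu i j : is_partition nu -> (i <= j)%N -> (nth 0 nu j <= nth 0 nu i)%N.
Proof.
move=> /andP[srt _] ij; case: (ltnP j (size nu)) => jn; last by rewrite nth_default.
have gtr : transitive geq by move=> a b c ba cb; apply: leq_trans ba.
have := sorted_leq_nth gtr leqnn 0%N srt i j; apply => //.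
by rewrite inE; apply: leq_ltn_trans jn.
Qed.

Lemma partition_eq nu nu' : is_partition nu -> is_partition nu' ->
  (forall i, nth 0%N nu i = nth 0%N nu' i) -> nu = nu'.
Proof.
move=> p p' E.
have szP (u : seq nat) : is_partition u -> forall i, (i < size u)%N = (0 < nth 0 u i)%N.
  move=> /andP[_ /allP u1] i; apply/idP/idP => [iu|]; first by apply: u1; exact: mem_nth.
  by apply: contraTT; rewrite -leqNgt => /(nth_default 0%N) ->.
have sz : size nu = size nu'.
  apply/eqP; rewrite eqn_leq; apply/andP; split; rewrite leqNgt; apply/negP => lt.
    by move: lt; rewrite (szP _ p) E -(szP _ p') ltnn.
  by move: lt; rewrite (szP _ p') -E -(szP _ p) ltnn.
by apply: (@eq_from_nth _ 0%N).
Qed.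

(** The cells of column c occupy the first rows, so row r reaches past c exactly when that column
    has more than r cells. Hence column counts determine a partition. *)
Lemma scell_card nu N r c : is_partition nu -> sumn nu = N ->
  (c < nth 0 nu r)%N = (r < ncols (@scol nu N) c.+1 - ncols (@scol nu N) c)%N.
Proof.
move=> nup nuN.
have -> : (ncols (@scol nu N) c.+1 - ncols (@scol nu N) c = #|[set i : 'I_N | scol nu i == c]|)%N.
  rewrite /ncols; have sub : [set x : 'I_N | (scol nu x < c)%N] \subset [set x : 'I_N | (scol nu x < c.+1)%N].
    by apply/fintype.subsetP => i; rewrite !inE => /ltnW.
  rewrite -(finset.setIidPr sub) -cardsD; apply: eq_card => i.
  by rewrite !inE ltnS -leqNgt [RHS]eqn_leq andbC.
apply/idP/idP => cr.
  have ex (j : 'I_r.+1) : exists i : 'I_N, (srow nu i == j) && (scol nu i == c).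
    have [|i <- <-] := @scell nu N j c nuN; last by exists i; rewrite !eqxx.
    by apply: (leq_trans cr); apply: partition_nth => //; rewrite -ltnS.
  have fP j := xchooseP (ex j).
  have fI : injective (fun j => xchoose (ex j)).
    move=> j j' E; apply: val_inj => /=.
    have /andP[/eqP e _] := fP j; have /andP[/eqP e' _] := fP j'.
    by rewrite -e -e' E.
  rewrite -[r.+1]card_ord -(card_imset _ fI) subset_leq_card //.
  by apply/fintype.subsetP => i /imsetP[j _ ->]; rewrite inE; have /andP[_] := fP j.
rewrite ltnNge; apply: contraL cr => cr; rewrite -leqNgt.
have lt (i : 'I_N) : scol nu i = c -> (srow nu i < r)%N.
  move=> ic; rewrite ltnNge; apply: contraL cr => ri; rewrite -ltnNge -ic.
  by apply: leq_trans (scellP i nuN) _; exact: partition_nth.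
case: r lt {cr} => [|r] lt.
  by rewrite leqn0 cards_eq0; apply/eqP/setP => i; rewrite !inE; apply/eqP => /lt.
rewrite -[X in (_ <= X)%N]card_ord -(@card_in_imset _ _ (fun i => inord (srow nu i) : 'I_r.+1)).
  exact: max_card.
move=> i j; rewrite !inE => /eqP ic /eqP jc /(congr1 val) /=.
rewrite !inordK ?lt // => rij; exact: (scell_inj rij (etrans ic (esym jc))).
Qed.

(** Indexing by the cycle types of permutations, rather than by all partitions of N, makes Young
    symmetrizers and conjugacy classes share their labels by construction. *)
Lemma young_complete_part N (J : galg C 'S_N -> Prop) :
  (forall y y', J y -> J y' -> J (y + y')) ->
  (forall a y b, J y -> J (a * y * b)) ->
  (forall nu, is_partition nu -> sumn nu = N -> J (young nu N)) -> J 1.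
Proof.
move=> JD JM Jy.
pose tys := [seq cycle_type s | s : 'S_N].
pose K := seq_sub tys.
have Kp (k : K) : is_partition (val k) /\ sumn (val k) = N.
  have /mapP[s _ ->] := valP k; split; first exact: cycle_type_partition.
  by rewrite sumn_cycle_type card_ord.
have mt (s : 'S_N) : cycle_type s \in tys by apply: map_f; rewrite mem_enum.
pose ty s : K := SeqSub (mt s).
apply: (@young_complete C 'I_N K (fun k => @srow (val k) N) (fun k => @scol (val k) N) _ _ ty).
- by move=> k; apply: std_diagram; have [] := Kp k.
- move=> k k' kk'; apply: contrapT => no; case/eqP: kk'; apply: val_inj.
  have [p s] := Kp k; have [p' s'] := Kp k'.
  have E n : ncols (@scol (val k) N) n = ncols (@scol (val k') N) n.
    by apply: contrapT => ne; apply: no; exists n.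
  have cE i c : (c < nth 0 (val k) i)%N = (c < nth 0 (val k') i)%N.
    by rewrite (scell_card i c p s) (scell_card i c p' s') !E.
  apply: partition_eq => // i; apply/eqP; rewrite eqn_leq; apply/andP; split.
    by have lt := cE i (nth 0%N (val k') i); rewrite ltnn in lt; rewrite leqNgt lt.
  by have lt := cE i (nth 0%N (val k) i); rewrite ltnn in lt; rewrite leqNgt -lt.
- by move=> s t /(congr1 val) /=; exact: cycle_type_conj.
- exact: JD.
- exact: JM.
- by move=> k; have [p s] := Kp k; exact: Jy.
Qed.

End Std.

Section InjExt.
Variables (X Y : finType) (f f' : X -> Y).
Hypotheses (fI : injective f) (f'I : injective f').

Lemma inj_extend : exists g : {perm Y}, forall x, g (f x) = f' x.
Proof.
pose s := codom f ++ [seq y <- enum Y | y \notin codom f].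
pose s' := codom f' ++ [seq y <- enum Y | y \notin codom f'].
have full (h : X -> Y) : injective h ->
    perm_eq (codom h ++ [seq y <- enum Y | y \notin codom h]) (enum Y).
  move=> hI; apply: uniq_perm; last 1 first.
  - by move=> y; rewrite mem_cat mem_filter mem_enum andbT orbN.
  - rewrite cat_uniq filter_uniq ?enum_uniq // andbT; apply/andP; split.
      by rewrite map_inj_uniq ?enum_uniq.
    by apply/hasPn => y; rewrite mem_filter => /andP[].
  - exact: enum_uniq.
have ss : perm_eq s (enum Y) by exact: full.
have ss' : perm_eq s' (enum Y) by exact: full.
have us : uniq s by rewrite (perm_uniq ss) enum_uniq.
have us' : uniq s' by rewrite (perm_uniq ss') enum_uniq.
have ms y : y \in s by rewrite (perm_mem ss) mem_enum.
have sz : size s = size s' by rewrite (perm_size ss) (perm_size ss').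
pose g y := nth y s' (index y s).
have gI : injective g.
  move=> y z E; have iy : (index y s < size s')%N by rewrite -sz index_mem.
  have iz : (index z s < size s')%N by rewrite -sz index_mem.
  move: E; rewrite /g (set_nth_default z) // => /eqP; rewrite nth_uniq // => /eqP E.
  by rewrite -(nth_index z (ms y)) E nth_index.
exists (perm gI) => x; rewrite permE /g.
have ix : index (f x) s = index x (enum X).
  rewrite /s index_cat (map_f f) ?mem_enum // index_map //.
rewrite ix /s' nth_cat size_map index_mem mem_enum (nth_map x) ?index_mem ?mem_enum //.
by rewrite nth_index ?mem_enum.
Qed.

End InjExt.

(** * The elements attached to a hook *)

Section KillMul.
Variables (C : numClosedFieldType) (X : finType).

(** On the whole set all placements are allowed, so a group element standing between the rectangle
    and e only changes the placement. *)
Lemma killQP_mul a b (e : galg C {perm X}) z (R : 'I_a * 'I_b -> X) :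
  killQP a b finset.setT e -> injective R ->
  asym C (colR R) * psym C (rowR R) * z * e = 0.
Proof.
move=> k RI; rewrite [z]galgE mulr_sumr mulr_suml big1 // => g _.
rewrite -scalerAr -scalerAl QP_gel // -mulrA k ?mulr0 ?scaler0 //.
exact: comp_perm_inj.
Qed.

Lemma killPQ_mul a b (e : galg C {perm X}) z (R : 'I_a * 'I_b -> X) :
  killQP a b finset.setT e -> injective R ->
  psym C (rowR R) * asym C (colR R) * z * e = 0.
Proof.
move=> /killQP_PQ k RI; rewrite [z]galgE mulr_sumr mulr_suml big1 // => g _.
rewrite -scalerAr -scalerAl PQ_gel // -mulrA k ?mulr0 ?scaler0 //.
exact: comp_perm_inj.
Qed.

End KillMul.

Section Hook.
Variable C : numClosedFieldType.
Local Notation young := (young C).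

(* A diagram containing an a x b rectangle has its Young symmetrizer in the
   ideal generated by that of the rectangle. *)
Lemma young_kill nu N a b (X : finType) (f : 'I_N -> X) (fI : injective f) e z :
  is_partition nu -> sumn nu = N -> (b <= nth 0 nu a.-1)%N ->
  killQP a b finset.setT e -> push (pext fI) (young nu N) * z * e = 0.
Proof.
move=> nup nuN ba k.
have ex (c : 'I_a * 'I_b) : exists i : 'I_N, (srow nu i == c.1) && (scol nu i == c.2).
  have [|i <- <-] := @scell nu N c.1 c.2 nuN; last by exists i; rewrite !eqxx.
  apply: leq_trans (ltn_ord _) _; apply: (leq_trans ba); apply: partition_nth => //.
  have lt := ltn_ord c.1; rewrite -ltnS prednK //; exact: leq_ltn_trans lt.
pose R0 c := xchoose (ex c).
have RP c : srow nu (R0 c) = c.1 /\ scol nu (R0 c) = c.2.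
  by have /andP[/eqP ? /eqP ?] := xchooseP (ex c).
have R0I : injective R0.
  move=> c c' E; have [r1 c1] := RP c; have [r2 c2] := RP c'.
  apply/eqP; rewrite -pair_eqE /=; apply/andP; split; apply/eqP/val_inj.
    by rewrite /= -r1 -r2 E.
  by rewrite /= -c1 -c2 E.
pose R := f \o R0; have RI : injective R by exact: inj_comp.
rewrite (pushM (pextM fI)) push_psym push_asym.
have rr x y : rowR R x = rowR R y -> extf f (@srow nu N) x = extf f (@srow nu N) y.
  case: (in_or_out R x) => [[c ->]|xo]; case: (in_or_out R y) => [[c' ->]|yo].
  - by rewrite !rowRE // => -[E]; rewrite /R /= !extfE // (RP c).1 (RP c').1 E.
  - by rewrite rowRE // rowR_out.
  - by rewrite [in RHS]rowRE // rowR_out.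
  - by rewrite !rowR_out // => -[->].
have cc x y : colR R x = colR R y -> extf f (@scol nu N) x = extf f (@scol nu N) y.
  case: (in_or_out R x) => [[c ->]|xo]; case: (in_or_out R y) => [[c' ->]|yo].
  - by rewrite !colRE // => -[E]; rewrite /R /= !extfE // (RP c).2 (RP c').2 E.
  - by rewrite colRE // colR_out.
  - by rewrite [in RHS]colRE // colR_out.
  - by rewrite !colR_out // => -[->].
(* The symmetrizers of the diagram absorb those of the rectangle; scaling by the orders of the two
   stabilizers makes the latter appear in the middle. *)
apply: (scalerI (card_stabf_neq0 C (rowR R))); rewrite scaler0.
apply: (scalerI (card_stabf_neq0 C (colR R))); rewrite scaler0.
have -> : #|stabf (colR R)|%:R *: (#|stabf (rowR R)|%:R *: (psym C (extf f (@srow nu N)) *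
    asym C (extf f (@scol nu N)) * z * e)) =
  psym C (extf f (@srow nu N)) * psym C (rowR R) *
    (asym C (colR R) * asym C (extf f (@scol nu N))) * z * e.
  by rewrite (psym_absorbr C rr) (asym_absorbl C cc) -!(scalerAl, scalerAr) !scalerA mulrC.
have -> : psym C (extf f (@srow nu N)) * psym C (rowR R) *
    (asym C (colR R) * asym C (extf f (@scol nu N))) * z * e =
  psym C (extf f (@srow nu N)) * (psym C (rowR R) * asym C (colR R) *
    (asym C (extf f (@scol nu N)) * z) * e) by rewrite !mulrA.
by rewrite killPQ_mul // mulr0.
Qed.

(** Start from Y empty, which holds no 1 x 1 grid; the letters then add m rows and n columns. *)
Lemma wproj_kill (X : finType) m n (x : X -> letter m n) : (forall i, x i <> None) ->
  killQP m.+1 n.+1 finset.setT (wproj C x).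
Proof.
move=> xN; rewrite -[m.+1]addn1 -[n.+1]addn1.
apply: (@kill_letters X m n C 1 1 finset.set0 x) => [i j l xi xj|i j l xi xj ij|i|R RI RY].
- exact: wproj_even xi xj.
- exact: wproj_odd xi xj ij.
- by right.
- by have := RY (ord0, ord0); rewrite inE.
Qed.

(* Let x label the cells of the first i rows by even letters, according to their
   rows, and the others by odd letters, according to their columns.  Then Q R *
   P R kills C[S_r] (wproj C x) and the Young symmetrizer of la does not, so that
   young_ann applies. *)
Lemma young_self_kill la r i : is_partition la -> sumn la = r ->
  killQP i.+1 (nth 0 la i).+1 finset.setT (young la r).
Proof.
move=> lap lar R RI _; set l := nth 0%N la i.
have ex (y : 'I_r) : exists x : letter i l,
   ((srow la y < i)%N -> exists2 k, x = Some (inl k) & nat_of_ord k = srow la y) /\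
   ((i <= srow la y)%N -> exists2 k, x = Some (inr k) & nat_of_ord k = scol la y).
  case: (ltnP (srow la y) i) => ry.
    by exists (Some (inl (Ordinal ry))); split=> // _; exists (Ordinal ry).
  have cy : (scol la y < l)%N by apply: (leq_trans (scellP y lar)); exact: partition_nth.
  by exists (Some (inr (Ordinal cy))); split=> // _; exists (Ordinal cy).
have [x xP] := choice ex.
have xN y : x y <> None.
  have [h1 h2] := xP y; case: (ltnP (srow la y) i) => [/h1|/h2] [k -> _] //.
pose J (y : galg C 'S_r) := forall z, y * z * wproj C x = 0.
have JM a y b : J y -> J (a * y * b).
  by move=> Jy z; rewrite -!mulrA [y * _]mulrA; have := Jy (b * z); rewrite !mulrA -!mulrA => ->; rewrite mulr0.
have nJ : ~ J (young la r).
  (* The trace lemma is used with an empty second diagram: every point carries a letter. *)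
  pose f2 (y : 'I_r) := y; pose f1 (y : 'I_0) : 'I_r := False_rect _ (notF (ltn_ord y)).
  have f1I : injective f1 by case.
  have f2I : injective f2 by [].
  have fc y : (exists a, y = f1 a) \/ (exists b, y = f2 b) by right; exists y.
  move=> Jy; have := @trace_neq0 C 'I_r 'I_0 'I_r 'I_r f2 f1 f2 f2I f1I f2I _ fc
    (@srow la r) (@scol la r) (fun=> 0%N) (fun=> 0%N) i l x (@scell_inj la r).
  rewrite -(push_psym _ f2I) -(push_asym _ f2I) -!(pushM (pextM f2I)).
  have := Jy 1; rewrite mulr1 => ->; rewrite push0 !mul0r eqxx => H.
  suff : false by []; apply: H => //.
  - by case.
  - by case.
  - by move=> z rz; exists z => //; have [h _] := xP z; exact: h.
  - by move=> z rz _; exists z => //; have [_ h] := xP z; exact: h.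
  - move=> z rz; rewrite leqNgt (leq_trans (scellP z lar)) //; exact: partition_nth.
  - by move=> b; exists b.
have := young_ann (std_diagram lar) JM nJ; rewrite -/(young la r).
move=> /(_ (asym C (colR R) * psym C (rowR R)) 1); rewrite mul1r; apply.
by move=> z; apply: killQP_mul => //; exact: wproj_kill.
Qed.

Section Hooks.
Variables (m n r k : nat) (la : seq nat).
Hypotheses (lap : is_partition la) (lar : sumn la = r).

Local Notation lI := (@lshift_inj r k).
Local Notation rI := (@rshift_inj r k).

Definition hook_elt (x : 'I_k -> letter m n) : galg C 'S_(r + k) :=
  push (pext lI) (young la r) * push (pext rI) (wproj C x).

Lemma lr_disj (a : 'I_r) (b : 'I_k) : lshift k a <> rshift r b.
Proof. by move=> /eqP; rewrite eq_lrshift. Qed.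

Lemma lr_cover (y : 'I_(r + k)) : (exists a, y = lshift k a) \/ (exists b, y = rshift r b).
Proof.
by case: (split_ordP y) => j ->; [left; exists j|right; exists j].
Qed.

(** Some row m + i of nu is longer than n + la_i, so nu contains a rectangle with m + i + 1 rows and
    n + la_i + 1 columns. The symmetrizer of la kills rectangles of size (i + 1) x (la_i + 1), and
    the letters add m rows and n columns. *)
Lemma hook_kill nu N (f : 'I_N -> 'I_(r + k)) (fI : injective f) (x : 'I_k -> letter m n) z :
  is_partition nu -> sumn nu = N -> ~ sub_inf nu (inf_part m n la) ->
  (forall i, x i <> None) ->
  push (pext fI) (young nu N) * z * hook_elt x = 0.
Proof.
move=> nup nuN /existsNP[i0 Hi0] xN.
have [i [E lt]] : exists i, i0 = (m + i)%N /\ (n + nth 0 la i < nth 0 nu i0)%N.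
  move: Hi0; rewrite /inf_part; case: (ltnP i0 m) => [//|mi] /negP /=.
  by rewrite -ltnNge => lt; exists (i0 - m)%N; rewrite subnKC.
apply: (@young_kill nu N (m + i.+1) (n + (nth 0%N la i).+1)) => //.
  by rewrite !addnS /= -E.
apply: kill_glue => //.
- exact: lr_disj.
- exact: lr_cover.
- exact: young_self_kill.
Qed.

End Hooks.

Lemma hook_nonzero m n r la nu N : is_partition la -> sumn la = r ->
  is_partition nu -> sumn nu = N -> sub_inf nu (inf_part m n la) ->
  exists k (x : 'I_k -> letter m n) (f : 'I_N -> 'I_(r + k)) (fI : injective f),
    (forall i, x i <> None) /\
    exists z, push (pext fI) (young nu N) * z * @hook_elt m n r k la x <> 0.
Proof.
move=> lap lar nup nuN sub.
(* The cells in the first m rows or the first n columns become the points carrying letters; the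
   others, shifted by (m, n), fit in the diagram of la. *)
pose A := [set z : 'I_N | ~~ ((m <= srow nu z)%N && (n <= scol nu z)%N)].
pose k := #|A|; exists k.
have cellL z : z \notin A -> exists y : 'I_r,
    srow nu z = (m + srow la y)%N /\ scol nu z = (n + scol la y)%N.
  rewrite inE negbK => /andP[mz nz].
  have := sub (srow nu z); rewrite /inf_part ltnNge mz /= => le.
  have lt : (scol nu z - n < nth 0 la (srow nu z - m))%N.
    by rewrite ltn_subLR //; apply: leq_trans le; exact: scellP.
  have [y ry cy] := scell lar lt; exists y.
  by rewrite ry cy !subnKC.
have ex z : exists w : 'I_(r + k),
    (z \in A -> exists2 j, w = rshift r j & enum_val j = z) /\
    (z \notin A -> exists2 y, w = lshift k y &
       srow nu z = (m + srow la y)%N /\ scol nu z = (n + scol la y)%N).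
  case: (boolP (z \in A)) => zA.
    exists (rshift r (enum_rank_in zA z)); split=> // _.
    by exists (enum_rank_in zA z); rewrite ?enum_rankK_in.
  by have [y yP] := cellL _ zA; exists (lshift k y); split=> // _; exists y.
have [f fP] := choice ex.
have exx (j : 'I_k) : exists x : letter m n,
    ((srow nu (enum_val j) < m)%N ->
       exists2 l, x = Some (inl l) & nat_of_ord l = srow nu (enum_val j)) /\
    ((m <= srow nu (enum_val j))%N ->
       exists2 l, x = Some (inr l) & nat_of_ord l = scol nu (enum_val j)).
  case: (ltnP (srow nu (enum_val j)) m) => rj.
    by exists (Some (inl (Ordinal rj))); split=> // _; exists (Ordinal rj).
  have cj : (scol nu (enum_val j) < n)%N.
    by have := enum_valP j; rewrite inE rj /= -ltnNge.
  by exists (Some (inr (Ordinal cj))); split=> // _; exists (Ordinal cj).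
have [x xP] := choice exx.
have fI : injective f.
  move=> z z' E; have [fA fL] := fP z; have [fA' fL'] := fP z'.
  case: (boolP (z \in A)) => [/fA[j fj jz]|/fL[y fy [ry cy]]];
    case: (boolP (z' \in A)) => [/fA'[j' fj' jz']|/fL'[y' fy' [ry' cy']]].
  - by rewrite -jz -jz'; congr enum_val; apply: (@rshift_inj r k); rewrite -fj -fj'.
  - by have := @lr_disj r k y' j; rewrite -fj -fy' E.
  - by have := @lr_disj r k y j'; rewrite -fj' -fy E.
  - have yy : y = y' by apply: (@lshift_inj r k); rewrite -fy -fy'.
    by apply: (@scell_inj nu N); rewrite ?ry ?ry' ?cy ?cy' yy.
exists x, f, fI; split.
  move=> j; have [h1 h2] := xP j.
  by case: (ltnP (srow nu (enum_val j)) m) => [/h1|/h2] [l -> _].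
apply: contrapT => /forallNP all0.
have {}all0 z : push (pext fI) (young nu N) * z * @hook_elt m n r k la x = 0.
  by apply: contrapT; exact: all0.
have M1 := pushM (pextM (@lshift_inj r k)).
have := @trace_neq0 C 'I_N 'I_r 'I_k 'I_(r + k) f (@lshift r k) (@rshift r k) fI
  (@lshift_inj r k) (@rshift_inj r k) (@lr_disj r k) (@lr_cover r k)
  (@srow nu N) (@scol nu N) (@srow la r) (@scol la r) m n x
  (@scell_inj nu N) (@scell_inj la r).
rewrite -(push_psym _ fI) -(push_asym _ fI) -(pushM (pextM fI)) -/(young nu N).
set w := push _ (wproj C x); set Q := asym C (@scol la r); set P := psym C (@srow la r).
(* The trace lemma ends in Q P whereas [hook_elt] contains P Q. Writing Q P as a multiple of Q P Q P
   makes P Q appear in the middle, and the first Q serves as z. *)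
have [h h0 hE] := young_sqr' C (std_diagram lar).
suff -> : push (pext fI) (young nu N) * w * push (pext (@lshift_inj r k)) Q *
    push (pext (@lshift_inj r k)) P = 0.
  rewrite eqxx => H; suff : false by []; apply: H => //.
  - move=> z rz; have [fA _] := fP z.
    have [|j fj jz] := fA _; first by rewrite inE leqNgt rz.
    by exists j => //; have [h1 _] := xP j; rewrite -jz; apply: h1; rewrite jz.
  - move=> z rz cz; have [fA _] := fP z.
    have [|j fj jz] := fA _; first by rewrite inE rz leqNgt cz.
    by exists j => //; have [_ h1] := xP j; rewrite -jz; apply: h1; rewrite jz.
  - move=> z rz cz; have [_ fL] := fP z.
    by apply: fL; rewrite inE rz cz.
  - move=> j; exists (enum_val j); have [fA _] := fP (enum_val j).
    have [j' -> /enum_val_inj -> //] := fA (enum_valP j).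
rewrite -mulrA -M1; apply: (scalerI h0); rewrite scaler0 scalerAr -pushZ -hE.
have -> : push (pext fI) (young nu N) * w * push (pext (@lshift_inj r k)) (Q * P * (Q * P)) =
   push (pext fI) (young nu N) * push (pext (@lshift_inj r k)) Q * @hook_elt m n r k la x *
   push (pext (@lshift_inj r k)) P.
  have cm a : push (pext (@lshift_inj r k)) a * w = w * push (pext (@lshift_inj r k)) a.
    by apply: push_disj; [exact: lr_disj|exact: lr_cover].
  rewrite /hook_elt -/w /young -/P -/Q !M1 -!mulrA; congr (_ * _).
  by rewrite !mulrA -cm -[_ * w * _]mulrA -cm mulrA -[_ * w * _]mulrA -cm mulrA
     -[_ * w * _]mulrA -cm !mulrA.
by rewrite all0 mul0r.
Qed.

End Hook.

(** * The Thoma characters as sums over words *)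

Section Sign.
Variable (X : finType) (F : comNzRingType).
Implicit Types (s : {perm X}) (D : {set X}).

Lemma sign_porbits s :
  (-1) ^+ odd_perm s = \prod_(c in porbits s) (-1) ^+ #|c|.-1 :> F.
Proof.
have E : (#|X| = \sum_(c in porbits s) #|c|.-1 + #|porbits s|)%N.
  rewrite -(sum_card_porbits s) -sum1_card -big_split /=; apply: eq_bigr => c.
  by move=> /imsetP[x _ ->]; rewrite addn1 prednK // lt0n card_porbit_neq0.
rewrite /odd_perm E oddD -addbA addbb addbF signr_odd.
by apply: (big_morph (fun k : nat => (-1 : F) ^+ k) (exprD (-1)) (expr0 (-1))).
Qed.

(** Cycles of length 1 contribute 1 on both sides; the longer cycles of the restriction are those of
    s contained in D. *)
Lemma sign_restr_perm D s : s \in 'N(D | 'P)%g ->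
  (-1) ^+ odd_perm (restr_perm D s) =
  \prod_(c in porbits s | c \subset D) (-1) ^+ #|c|.-1 :> F.
Proof.
move=> sD; set p := restr_perm D s.
have pin i : i \in D -> porbit p i = porbit s i.
  move=> iD.
  have E k : iter k p i = iter k s i /\ iter k s i \in D.
    elim: k => [|k [IH1 IH2]] //=; rewrite IH1 /p restr_permE //.
    by split=> //; have /astabsP/(_ (iter k s i)) := sD; rewrite /= apermE => ->.
  apply/setP => j; apply/porbitP/porbitP => -[k ->]; exists k; rewrite !permX.
    by rewrite (E k).1.
  by rewrite (E k).1.
have pout i : i \notin D -> p i = i by exact: (out_perm (restr_perm_on D s)).
have pout' i : i \notin D -> porbit p i = [set i].
  move=> iD; apply/setP => j; rewrite inE; apply/porbitP/eqP => [[k ->]|->]; last by exists 0%N; rewrite permX.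
  by rewrite permX; elim: k => //= k ->; exact: pout.
have sin i : i \in D -> porbit s i \subset D.
  move=> iD; apply/fintype.subsetP => j /porbitP[k ->]; rewrite permX.
  elim: k => //= k IH; have /astabsP/(_ (iter k s i)) := sD; by rewrite /= apermE => ->.
rewrite sign_porbits (bigID (fun c : {set X} => (1 < #|c|)%N)) /= [X in _ * X]big1 ?mulr1; last first.
  move=> c /andP[/imsetP[i _ ->]]; rewrite -leqNgt => c1.
  by have -> : #|porbit p i|.-1 = 0%N by case: #|_| c1 => [|[]].
rewrite [RHS](bigID (fun c : {set X} => (1 < #|c|)%N)) /= [X in _ = _ * X]big1 ?mulr1; last first.
  move=> c /andP[/andP[/imsetP[i _ ->]] _]; rewrite -leqNgt => c1.
  by have -> : #|porbit s i|.-1 = 0%N by case: #|_| c1 => [|[]].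
apply: eq_bigl => c; apply/andP/andP => [[/imsetP[i _ ->] c1]|[/andP[/imsetP[i _ ->] cD] c1]].
  case: (boolP (i \in D)) => iD; last by rewrite pout' // cards1 in c1.
  by rewrite pin // in c1 *; split=> //; rewrite sin // andbT; apply: imset_f.
have iD : i \in D by apply: (fintype.subsetP cD); exact: porbit_id.
by rewrite -pin // in c1 *; split=> //; apply: imset_f.
Qed.

End Sign.

Section WordSum.
Variables (X : finType) (F : comNzRingType) (m n : nat) (a : 'I_m -> F) (b : 'I_n -> F) (d : F).

Definition wchar (x : X -> letter m n) (s : {perm X}) : F :=
  (s \in stabf (wlab x))%:R * (-1) ^+ wsgn x s.

Definition lwt (l : letter m n) : F :=
  match l with Some (inl i) => a i | Some (inr j) => b j | None => d end.

Definition wwt (x : X -> letter m n) : F := \prod_i lwt (x i).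

(** The supersymmetric power sum. The letter None counts for k = 1 only, since a cycle of points
    labelled None must be a fixed point. *)
Definition psum (k : nat) : F :=
  \sum_i a i ^+ k + (-1) ^+ k.-1 * \sum_j b j ^+ k + (k == 1)%:R * d.

Lemma sum_letter (f : letter m n -> F) :
  \sum_l f l = \sum_i f (Some (inl i)) + \sum_j f (Some (inr j)) + f None.
Proof.
rewrite [LHS](bigD1 None) //= addrC; congr (_ + _).
rewrite (reindex_omap Some id) /=; last by case.
under eq_bigl => l do rewrite eqxx.
by rewrite big_sumType.
Qed.

(* A word fixed by s is constant on the cycles of s. *)
Lemma sum_words s :
  \sum_(x : {ffun X -> letter m n}) wwt x * wchar x s =
  \prod_(c in porbits s) psum #|c|.
Proof.
pose G (c : {set X}) (l : letter m n) : F :=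
  match l with
  | Some (inl i) => a i ^+ #|c|
  | Some (inr j) => (-1) ^+ #|c|.-1 * b j ^+ #|c|
  | None => (#|c| == 1%N)%:R * d end.
have -> : \prod_(c in porbits s) psum #|c| = \prod_(c in porbits s) \sum_l G c l.
  by apply: eq_bigr => c _; rewrite sum_letter /G /psum -mulr_sumr.
rewrite (big_distr_big None) /=.
pose P (x : {ffun X -> letter m n}) := [forall i, x (s i) == x i].
rewrite (bigID P) /= [X in _ + X]big1 ?addr0; last first.
  move=> x xP; rewrite /wchar; case: (boolP (s \in stabf (wlab x))) => [/stabfP xs|_].
    by case/negP: xP; apply/forallP => i; apply/eqP/wlabP.
  by rewrite mul0r mulr0.
pose rep (c : {set X}) := [pick i in c].
have repP i : exists2 j, rep (porbit s i) = Some j & porbit s j = porbit s i.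
  rewrite /rep; case: pickP => [j ji|/(_ i)]; last by rewrite porbit_id.
  by exists j => //; apply/eqP; rewrite eq_porbit_mem.
(* h spreads a labelling of the cycles over the points; h' reads it back at a representative of each
   cycle. *)
pose h (f : {ffun {set X} -> letter m n}) : {ffun X -> letter m n} := [ffun i => f (porbit s i)].
pose h' (x : {ffun X -> letter m n}) : {ffun {set X} -> letter m n} :=
  [ffun c => if c \in porbits s then (if rep c is Some j then x j else None) else None].
have const x : P x -> forall i j, porbit s i = porbit s j -> x i = x j.
  move=> /forallP xs i j ij; have : i \in porbit s j by rewrite -ij porbit_id.
  move=> /porbitP[k ->]; rewrite permX; elim: k => //= k IH.
  by rewrite (eqP (xs _)).
have inP i : porbit s i \in porbits s by exact: imset_f.
rewrite (reindex_onto h h'); last first.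
  move=> x xP; apply/ffunP => i; rewrite !ffunE inP.
  by have [j -> ji] := repP i; apply: const.
apply: eq_big => [f|f].
  have -> : P (h f) = true.
    by apply/forallP => i; rewrite !ffunE; have := porbit_perm s 1 i; rewrite expg1 => ->.
  rewrite /=; apply/eqP/pffun_onP => [<-|[fs _]].
    split; last by move=> c.
    apply/supportP => c cP; by rewrite ffunE (negPf cP).
  apply/ffunP => c; rewrite !ffunE; case: ifP => [/imsetP[i _ ->]|cP].
    by have [j -> ji] := repP i; rewrite ffunE ji.
  by move/supportP: fs => ->//; rewrite cP.
move=> _; have fx i : h f i = f (porbit s i) by rewrite ffunE.
have wE : wwt (h f) = \prod_(c in porbits s) lwt (f c) ^+ #|c|.
  rewrite /wwt /porbits (partition_big_imset (porbit s)) /=.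
  apply: eq_big => [c|c]; first by apply/imsetP/imsetP => -[i _ ->]; exists i.
  move=> /imsetP[i _ ->]; rewrite -prodr_const; apply: eq_big => [j|j].
    by rewrite eq_porbit_mem.
  by move=> /eqP ji; rewrite fx ji.
(* If s is not in the stabilizer, some cycle of length at least 2 carries None, and both sides
   vanish. *)
have [|/stabfP nst] := boolP (s \in stabf (wlab (h f))); last first.
  have [c cP [fc c1]] : exists2 c, c \in porbits s & f c = None /\ #|c| != 1%N.
    move: nst; rewrite /not => nst; apply: contrapT => no; apply: nst => i.
    rewrite /wlab !fx; have := porbit_perm s 1 i; rewrite expg1 => ->.
    case E : (f (porbit s i)) => [l|] //; congr inr.
    have : #|porbit s i| == 1%N.
      by apply/negPn/negP => c1; apply: no; exists (porbit s i).
    move=> /cards1P[j ij]; have := porbit_id s i; have := mem_porbit s 1 i.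
    by rewrite expg1 ij !inE => /eqP -> /eqP.
  rewrite /wchar (_ : s \in _ = false) ?mul0r ?mulr0; last by apply/negbTE/stabfP.
  rewrite (bigD1 c) //= (_ : G c (f c) = 0) ?mul0r //.
  by rewrite /G fc (negPf c1) mul0r.
move=> st; rewrite /wchar st mul1r wE /wsgn sign_restr_perm ?wodd_norm // big_mkcondr /= -big_split /=.
apply: eq_bigr => c /imsetP[i _ ->].
have xi j : j \in porbit s i -> h f j = f (porbit s i).
  by rewrite -eq_porbit_mem fx => /eqP ->.
have sub : (porbit s i \subset wodd (h f)) = (if f (porbit s i) is Some (inr _) then true else false).
  apply/fintype.subsetP/idP => [/(_ i (porbit_id s i))|fi j ji]; first by rewrite inE fx.
  by rewrite inE xi.
rewrite sub /G; case E : (f (porbit s i)) => [[l|l]|] /=; rewrite ?mulr1 //; first by rewrite mulrC.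
suff -> : #|porbit s i| = 1%N by rewrite expr1 eqxx mul1r.
have : s i = i.
  by have /stabfP/(_ i) := st; rewrite /wlab !fx E; case: (f _) => // -[].
move=> si; rewrite -(cards1 i); apply: eq_card => j; rewrite inE.
apply/porbitP/eqP => [[k ->]|->]; last by exists 0%N; rewrite permX.
by rewrite permX; elim: k => //= k ->.
Qed.

End WordSum.

Section WordPos.
Variables (C : numClosedFieldType) (X : finType) (m n : nat).
Implicit Types (y : galg C {perm X}) (x : X -> letter m n).

Lemma wcharE x s : wchar C x s = wproj C x s.
Proof. by rewrite /wproj csymE. Qed.

Lemma wproj_sqr x : wproj C x * wproj C x = #|stabf (wlab x)|%:R *: wproj C x.
Proof. by apply: csym_sqr; exact: wsgnM. Qed.

Lemma star_wproj x : star (wproj C x) = wproj C x.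
Proof. by apply: star_csym; exact: wsgnM. Qed.

(** The values of [wproj] are real and invariant under inversion, so pairing with them is a
    trace. *)
Lemma sum_wchar x y : \sum_g y g * wchar C x g = tr (y * wproj C x).
Proof.
rewrite /tr gmulE; apply: eq_bigr => g _; rewrite mulg1 wcharE.
have := starE (wproj C x) g; rewrite star_wproj => E.
have /ffunP/(_ g^-1%g) := star_wproj x; rewrite starE invgK => <-.
by rewrite -wcharE /wchar rmorphM /= rmorph_nat rmorph_sign.
Qed.

Lemma tr_wproj x y : #|stabf (wlab x)|%:R * tr (star y * y * wproj C x) =
  tr (star (y * wproj C x) * (y * wproj C x)).
Proof.
rewrite starM star_wproj.
have -> : wproj C x * star y * (y * wproj C x) = wproj C x * (star y * y * wproj C x) by rewrite !mulrA.
by rewrite [RHS]trC -[in RHS](mulrA _ (wproj C x) (wproj C x)) wproj_sqr -scalerAr /tr galg_scaleE.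
Qed.

(** [wproj] is a positive multiple of a self-adjoint idempotent, so this is, up to a positive
    factor, the squared norm of y * wproj. *)
Lemma wchar_ge0 x y : 0 <= \sum_g (star y * y) g * wchar C x g.
Proof.
rewrite sum_wchar; have := tr_star_ge0 (y * wproj C x); rewrite -tr_wproj.
by rewrite pmulr_rge0 // ltr0n cardG_gt0.
Qed.

Lemma wproj1 x : (forall s, s \in stabf (wlab x) -> s = 1%g) -> wproj C x = 1.
Proof.
move=> st; apply/ffunP => g; rewrite csymE -gel1 gelE.
case: (eqVneq g 1%g) => [->|g1]; first by rewrite group1 (sgn_char1 (@wsgnM _ _ _ x)) mulr1.
case: (boolP (g \in stabf_group (wlab x))) => [/st g1'|_]; last by rewrite mul0r.
by rewrite g1' eqxx in g1.
Qed.

End WordPos.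

Section Chi.
Variables (R : realType) (w : thoma R).

Local Notation al := (alpha w).
Local Notation be := (beta w).

(** The weight of None in the truncation: the letters then have total weight 1, and cycles of length
    1 contribute factors 1 as in the character. *)
Definition defect m n : R := 1 - (\sum_(i < m) al i + \sum_(j < n) be j).

Definition chi_trunc m n k (s : 'S_k) : R :=
  \prod_(c in porbits s | (2 <= #|c|)%N)
    (\sum_(i < m) al i ^+ #|c| + (-1) ^+ #|c|.-1 * \sum_(j < n) be j ^+ #|c|).

Definition chi_wt m n k (x : 'I_k -> letter m n) : R :=
  wwt (fun i => al (nat_of_ord i)) (fun j => be (nat_of_ord j)) (defect m n) x.

Lemma chi_truncE m n k (s : 'S_k) :
  chi_trunc m n s = \sum_(x : {ffun 'I_k -> letter m n}) chi_wt x * wchar R x s.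
Proof.
rewrite sum_words [RHS](bigID (fun c : {set 'I_k} => (2 <= #|c|)%N)) /=.
rewrite [X in _ = _ * X]big1 ?mulr1; last first.
  move=> c /andP[/imsetP[i _ ->]]; rewrite -leqNgt => c1.
  have -> : #|porbit s i| = 1%N.
    by apply/eqP; rewrite eqn_leq c1 lt0n card_porbit_neq0.
  rewrite /psum expr0 mul1r eqxx mul1r /defect.
  under eq_bigr do rewrite expr1.
  under [X in _ + X + _]eq_bigr do rewrite expr1.
  by rewrite addrCA subrr addr0.
apply: eq_bigr => c /andP[_ c2]; rewrite /psum.
by have -> : (#|c| == 1)%N = false; [case: #|c| c2 => [|[]]|rewrite mul0r addr0].
Qed.

Lemma al_ge0 i : 0 <= al i. Proof. by have /andP[] := alpha01 w i. Qed.
Lemma be_ge0 i : 0 <= be i. Proof. by have /andP[] := beta01 w i. Qed.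

Lemma partial_gamma N : ((\sum_(i < N) (al i + be i))%:E <= gamma al be)%E.
Proof.
rewrite -sumEFin -(big_mkord xpredT (fun i => (al i + be i)%:E)).
by apply: nneseries_lim_ge => i _; rewrite lee_fin addr_ge0 ?al_ge0 ?be_ge0.
Qed.

Lemma defect_ge0 N : 0 <= defect N N.
Proof.
rewrite /defect -big_split /= subr_ge0 -lee_fin.
exact: le_trans (partial_gamma N) (gamma_le1 w).
Qed.

Lemma is_cvg_powers (u : nat -> R) k : (forall i, 0 <= u i <= 1) ->
  (forall N, \sum_(i < N) u i <= 1) -> (0 < k)%N ->
  cvgn (series (fun i => u i ^+ k)).
Proof.
move=> u01 u1 k0; apply: nondecreasing_is_cvgn.
  apply: nondecreasing_series => i _ _; apply: exprn_ge0; by have /andP[] := u01 i.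
exists 1 => _ [N _ <-]; rewrite /series /= big_mkord; apply: le_trans (u1 N).
apply: ler_sum => i _; have /andP[u0 ui] := u01 i.
by case: k k0 => // k _; rewrite exprS ler_piMr // exprn_ile1.
Qed.

Lemma sum_al_le1 N : \sum_(i < N) al i <= 1.
Proof.
have := defect_ge0 N; rewrite /defect subr_ge0; apply: le_trans.
by rewrite lerDl sumr_ge0 // => i _; exact: be_ge0.
Qed.

Lemma sum_be_le1 N : \sum_(i < N) be i <= 1.
Proof.
have := defect_ge0 N; rewrite /defect subr_ge0; apply: le_trans.
by rewrite lerDr sumr_ge0 // => i _; exact: al_ge0.
Qed.

Lemma chi_trunc_cvg k (s : 'S_k) :
  ((fun N => chi_trunc N N s) @ \oo --> chi w s)%classic.
Proof.
rewrite /chi_trunc /chi.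
pose F (c : {set 'I_k}) (N : nat) : R :=
  \sum_(i < N) al i ^+ #|c| + (-1) ^+ #|c|.-1 * \sum_(j < N) be j ^+ #|c|.
pose L (c : {set 'I_k}) : R := limn (series (fun i => al i ^+ #|c|)) +
     (-1) ^+ #|c|.-1 * limn (series (fun i => be i ^+ #|c|)).
have FL (c : {set 'I_k}) : (2 <= #|c|)%N -> (F c @ \oo --> L c)%classic.
  move=> c2; have c0 : (0 < #|c|)%N by exact: ltnW.
  apply: cvgD.
    have E : (fun N => \sum_(i < N) al i ^+ #|c|) = series (fun i => al i ^+ #|c|).
      by apply/funext => N; rewrite /series /= big_mkord.
    rewrite E; exact: (is_cvg_powers (alpha01 w) sum_al_le1 c0).
  apply: cvgMl_tmp.
  have E : (fun N => \sum_(i < N) be i ^+ #|c|) = series (fun i => be i ^+ #|c|).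
    by apply/funext => N; rewrite /series /= big_mkord.
  rewrite E; exact: (is_cvg_powers (beta01 w) sum_be_le1 c0).
have : forall (r : seq {set 'I_k}),
   ((fun N => \prod_(c <- r | (c \in porbits s) && (2 <= #|c|)%N) F c N) @ \oo -->
    \prod_(c <- r | (c \in porbits s) && (2 <= #|c|)%N) L c)%classic.
  elim=> [|c r IH].
    by rewrite big_nil; under eq_fun do rewrite big_nil; exact: cvg_cst.
  rewrite big_cons; under eq_fun do rewrite big_cons.
  case: ifP => // /andP[_ c2]; apply: cvgM => //; exact: FL.
exact.
Qed.

Local Notation C := R[i].

Lemma chi_trunc_sum m n k (y : galg C 'S_k) :
  \sum_g y g * (chi_trunc m n g)%:C%C =
  \sum_(x : {ffun 'I_k -> letter m n}) (chi_wt x)%:C%C * \sum_g y g * wchar C x g.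
Proof.
under eq_bigr => g _ do rewrite chi_truncE rmorph_sum mulr_sumr.
rewrite exchange_big /=; apply: eq_bigr => x _; rewrite mulr_sumr; apply: eq_bigr => g _.
by rewrite rmorphM /= mulrCA /wchar [in X in _ * (_ * X)]rmorphM /= rmorph_nat rmorph_sign.
Qed.

Lemma chi_wt_ge0 N k (x : 'I_k -> letter N N) : 0 <= chi_wt x.
Proof.
apply: prodr_ge0 => i _; rewrite /lwt.
by case: (x i) => [[l|l]|]; rewrite ?al_ge0 ?be_ge0 ?defect_ge0.
Qed.

Lemma chi_trunc_ge N k (y : galg C 'S_k) (x : {ffun 'I_k -> letter N N}) c : 0 <= c ->
  c <= chi_wt x -> (forall s, s \in stabf (wlab x) -> s = 1%g) ->
  c%:C%C * tr (star y * y) <= \sum_g (star y * y) g * (chi_trunc N N g)%:C%C.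
Proof.
move=> c0 cx st; rewrite chi_trunc_sum (bigD1 x) //=.
rewrite -[leLHS]addr0 lerD //; last first.
  by apply: sumr_ge0 => x' _; rewrite mulr_ge0 ?wchar_ge0 // lecR chi_wt_ge0.
rewrite sum_wchar wproj1 // mulr1 ler_wpM2r ?tr_star_ge0 // lecR //.
Qed.

(** For large N the truncated state of star y * y is a sum of non-negative terms, and the word with
    trivial stabilizer alone contributes at least c tr (star y * y). The bound survives in the
    limit. *)
Lemma chi_faithful k (y : galg C 'S_k) (c : R) : 0 < c ->
  (\forall N \near \oo, exists2 x : {ffun 'I_k -> letter N N}, c <= chi_wt x &
      forall s, s \in stabf (wlab x) -> s = 1%g)%classic ->
  \sum_g (star y * y) g * (chi w g)%:C%C = 0 -> y = 0.
Proof.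
move=> c0 near chi0.
(* The limit is taken in R: the characters are real, so only the real parts of the coefficients
   enter. *)
pose u N := complex.Re (\sum_g (star y * y) g * (chi_trunc N N g)%:C%C).
have ReM (z : C) (r : R) : complex.Re (z * r%:C%C) = complex.Re z * r.
  by case: z => p q /=; rewrite mulr0 subr0.
have ReS (F : 'S_k -> C) : complex.Re (\sum_g F g) = \sum_g complex.Re (F g).
  by apply: (big_morph _ (fun p q => _) (erefl _)) => -[? ?] [? ?].
have uE N : u N = \sum_g complex.Re ((star y * y) g) * chi_trunc N N g.
  by rewrite /u ReS; apply: eq_bigr => g _; rewrite ReM.
have L0 : \sum_g complex.Re ((star y * y) g) * chi w g = 0.
  have E := congr1 (@complex.Re R) chi0; rewrite ReS /= in E; rewrite -[RHS]E.
  by apply: eq_bigr => g _; rewrite ReM.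
have ucvg : (u @ \oo --> 0)%classic.
  suff : (u @ \oo --> \sum_g complex.Re ((star y * y) g) * chi w g)%classic by rewrite L0.
  rewrite (_ : u = fun N => \sum_g complex.Re ((star y * y) g) * chi_trunc N N g); last exact: funext.
  elim: (index_enum _) => [|g r IH].
    by rewrite big_nil; under eq_fun do rewrite big_nil; exact: cvg_cst.
  rewrite big_cons; under eq_fun do rewrite big_cons.
  by apply: cvgD IH; apply: cvgMl_tmp; exact: chi_trunc_cvg.
have T0 := tr_star_ge0 y.
have [t tE] : exists t : R, tr (star y * y) = t%:C%C.
  by move: T0; case: (tr _) => p q; rewrite lecE /= => /andP[/eqP -> _]; exists p.
have t0 : 0 <= t by move: T0; rewrite tE lecR.
apply: tr_star_eq0; rewrite tE; congr (_%:C%C); apply/eqP; rewrite eq_le t0 andbT.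
rewrite -(pmulr_rle0 _ c0).
apply: (cvgr_to_ge ucvg); apply: filterS near => N [x cx st].
have := chi_trunc_ge y (ltW c0) cx st; rewrite tE lecE => /andP[_] /=.
by rewrite mulr0 subr0.
Qed.

Lemma wlab_inj_stab k m n (x : 'I_k -> letter m n) s :
  injective (wlab x) -> s \in stabf (wlab x) -> s = 1%g.
Proof. by move=> xI /stabfP xs; apply/permP => i; rewrite perm1; apply: xI. Qed.

Definition zero_case := (gamma al be < 1)%E \/ (forall i, 0 < al i) \/ (forall i, 0 < be i).

(** The words used are the one with all letters None, of weight at least (1 - gamma)^k, or one with
    distinct even, respectively odd, letters, whose weight is the product of the first k parameters
    for every N at least k. *)
Lemma chi_faithful_zero k (y : galg C 'S_k) : zero_case ->
  \sum_g (star y * y) g * (chi w g)%:C%C = 0 -> y = 0.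
Proof.
move=> [g1|[a0|b0]].
- have g0 : (0 <= gamma al be)%E.
    by apply: le_trans (partial_gamma 0); rewrite big_ord0.
  have gfin : gamma al be = (fine (gamma al be))%:E.
    by rewrite fineK // ge0_fin_numE // (lt_trans g1) // ltry.
  move: g1; rewrite gfin lte_fin => g1.
  apply: (@chi_faithful _ y ((1 - fine (gamma al be)) ^+ k)).
    by rewrite exprn_gt0 // subr_gt0.
  apply: nearW => N; exists [ffun=> None]; last first.
    move=> s; apply: wlab_inj_stab => i j; by rewrite /wlab !ffunE => -[].
  rewrite /chi_wt /wwt (eq_bigr (fun=> defect N N)); last by move=> i _; rewrite ffunE.
  rewrite prodr_const card_ord lerXn2r ?nnegrE ?defect_ge0 ?subr_ge0 ?(ltW g1) //.
  rewrite /defect -big_split /= lerD2l lerN2 -lee_fin -gfin; exact: partial_gamma.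
- apply: (@chi_faithful _ y (\prod_(i < k) al i)); first by apply: prodr_gt0.
  exists k => // N /= kN; exists [ffun i => Some (inl (widen_ord kN i))]; last first.
    move=> s; apply: wlab_inj_stab => i j; rewrite /wlab !ffunE => -[ij].
    exact: val_inj.
  by rewrite /chi_wt /wwt; apply: ler_prod => i _; rewrite al_ge0 ffunE /=.
- apply: (@chi_faithful _ y (\prod_(i < k) be i)); first by apply: prodr_gt0.
  exists k => // N /= kN; exists [ffun i => Some (inr (widen_ord kN i))]; last first.
    move=> s; apply: wlab_inj_stab => i j; rewrite /wlab !ffunE => -[ij].
    exact: val_inj.
  by rewrite /chi_wt /wwt; apply: ler_prod => i _; rewrite be_ge0 ffunE /=.
Qed.

Lemma sum_ord_zero (u : nat -> R) m N : (m <= N)%N -> (forall i, (m <= i)%N -> u i = 0) ->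
  \sum_(i < N) u i = \sum_(i < m) u i.
Proof.
move=> mN u0; rewrite -(big_mkord xpredT u) (big_cat_nat (leq0n m) mN) /= big_mkord.
rewrite [X in _ + X]big1_seq ?addr0 // => i /=; rewrite mem_index_iota => /andP[mi _].
exact: u0.
Qed.

Lemma lim_series_fin (u : nat -> R) m : (forall i, (m <= i)%N -> u i = 0) ->
  limn (series u) = \sum_(i < m) u i.
Proof.
move=> u0; apply: lim_near_cst => //; exists m => // N /= mN.
by rewrite /series /= big_mkord (sum_ord_zero mN u0).
Qed.

Section Finite.
Variables (m n : nat).
Hypotheses (am : is_max_index al m) (bn : is_max_index be n).
Hypothesis nz : ~ zero_case.

Lemma al_out i : (m <= i)%N -> al i = 0.
Proof.
by move=> mi; apply/eqP/negPn/negP => /(am.1 i); rewrite ltnNge mi.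
Qed.

Lemma be_out i : (n <= i)%N -> be i = 0.
Proof.
by move=> mi; apply/eqP/negPn/negP => /(bn.1 i); rewrite ltnNge mi.
Qed.

Lemma al_in i : (i < m)%N -> 0 < al i.
Proof.
case: am => _ [->//|am1] im; rewrite lt_neqAle al_ge0 andbT eq_sym.
apply: contra am1 => /eqP ai; rewrite eq_le al_ge0 andbT -ai.
by apply: alpha_noninc; rewrite -ltnS prednK //; apply: leq_ltn_trans im.
Qed.

Lemma be_in i : (i < n)%N -> 0 < be i.
Proof.
case: bn => _ [->//|bn1] im; rewrite lt_neqAle be_ge0 andbT eq_sym.
apply: contra bn1 => /eqP ai; rewrite eq_le be_ge0 andbT -ai.
by apply: beta_noninc; rewrite -ltnS prednK //; apply: leq_ltn_trans im.
Qed.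

Lemma chi_finite k (s : 'S_k) : chi w s = chi_trunc m n s.
Proof.
apply: eq_bigr => c /andP[_ c2].
have c0 : (0 < #|c|)%N by exact: ltnW.
rewrite (@lim_series_fin (fun i => al i ^+ #|c|) m) => [|i mi]; last first.
  by rewrite al_out // expr0n gtn_eqF.
rewrite (@lim_series_fin (fun i => be i ^+ #|c|) n) // => i mi.
by rewrite be_out // expr0n gtn_eqF.
Qed.

Lemma gamma_eq1 : gamma al be = 1%E.
Proof.
apply/eqP; rewrite eq_le gamma_le1 /= leNgt; apply/negP => g1; apply: nz; by left.
Qed.

Lemma defect0 : defect m n = 0.
Proof.
have := gamma_eq1; rewrite /gamma.
have -> : (\sum_(i <oo) (al i + be i)%:E)%E =
    (\sum_(i < maxn m n) (al i + be i))%:E.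
  apply: lim_near_cst => //; exists (maxn m n) => // N /= mN.
  rewrite sumEFin; congr EFin; rewrite big_mkord.
  rewrite (sum_ord_zero (u := fun i => al i + be i) mN) // => i; rewrite geq_max => /andP[mi ni].
  by rewrite al_out // be_out // addr0.
move=> [E]; rewrite /defect -E big_split /=.
rewrite (sum_ord_zero (leq_maxl m n)); last exact: al_out.
rewrite (sum_ord_zero (leq_maxr m n)); last exact: be_out.
exact: subrr.
Qed.

Lemma chi_wt_gt0 k (x : 'I_k -> letter m n) : (forall i, x i <> None) -> 0 < chi_wt x.
Proof.
move=> xN; apply: prodr_gt0 => i _; have := xN i; rewrite /lwt.
by case: (x i) => [[l|l]|] // _; [apply: al_in|apply: be_in].
Qed.

Lemma chi_wt0 k (x : 'I_k -> letter m n) i : x i = None -> chi_wt x = 0.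
Proof. by move=> xi; rewrite /chi_wt /wwt (bigD1 i) //= xi /= defect0 mul0r. Qed.

Lemma chi_words k (s : 'S_k) : (chi w s)%:C%C =
  \sum_(x : {ffun 'I_k -> letter m n}) (chi_wt x)%:C%C * wchar C x s.
Proof.
rewrite chi_finite chi_truncE rmorph_sum; apply: eq_bigr => x _.
by rewrite rmorphM /= /wchar [in X in _ * X = _]rmorphM /= rmorph_nat rmorph_sign.
Qed.

End Finite.

End Chi.

(** * Unitary representations *)

Section HilbertBasics.
Variables (R : realType) (H : hilbert R).
Implicit Types (u v x : H) (a : R[i]).
Local Open Scope classical_set_scope.

Lemma dotDl u v x : '[u + v, x] = '[u, x] + '[v, x]. Proof. by rewrite linearDl. Qed.
Lemma dotZl a u x : '[a *: u, x] = a * '[u, x]. Proof. by rewrite linearZl_LR. Qed.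
Lemma dotDr u v x : '[x, u + v] = '[x, u] + '[x, v]. Proof. by rewrite linearDr. Qed.
Lemma dotZr a u x : '[x, a *: u] = a^* * '[x, u]. Proof. by rewrite linearZr. Qed.
Lemma dot0l x : '[(0 : H), x] = 0. Proof. by rewrite linear0l. Qed.
Lemma dot0r x : '[x, (0 : H)] = 0. Proof. by rewrite linear0r. Qed.
Lemma dotNl u x : '[- u, x] = - '[u, x]. Proof. by rewrite linearNl. Qed.
Lemma dotC u v : '[u, v] = '[v, u]^*. Proof. by rewrite hermC expr0 mul1r. Qed.

Lemma dot_suml (I : Type) (r : seq I) (P : pred I) (F : I -> H) x :
  '[\sum_(i <- r | P i) F i, x] = \sum_(i <- r | P i) '[F i, x].
Proof. by apply: (big_morph (fun u => '[u, x])) => [u v|]; rewrite ?dotDl ?dot0l. Qed.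

Lemma dot_sumr (I : Type) (r : seq I) (P : pred I) (F : I -> H) x :
  '[x, \sum_(i <- r | P i) F i] = \sum_(i <- r | P i) '[x, F i].
Proof. by apply: (big_morph (fun u => '[x, u])) => [u v|]; rewrite ?dotDr ?dot0r. Qed.

Lemma dot_eq0 u : '[u, u] = 0 -> u = 0.
Proof. by rewrite hdotE => /eqP; rewrite sqrf_eq0 normr_eq0 => /eqP. Qed.

Lemma dot_ge0 u : 0 <= '[u, u]. Proof. by rewrite hdotE exprn_ge0. Qed.

Lemma cauchy_schwarz u v : `|'[u, v]| <= `|u| * `|v|.
Proof.
have [->|v0] := eqVneq v 0; first by rewrite dot0r !normr0 mulr0.
have q0 : 0 < '[v, v] by rewrite hdotE exprn_gt0 // normr_gt0.
have qr : '[v, v]^* = '[v, v] by rewrite -dotC.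
have := dot_ge0 ('[v, v] *: u + - '[u, v] *: v).
rewrite !dotDl !dotDr !dotZl !dotZr rmorphN /= qr [in '[v, u]]dotC.
set q := '[v, v]; set a := '[u, v]; set p := '[u, u].
have -> : q * (q * p) + q * (- a^* * a) + (- a * (q * a^*) + - a * (- a^* * q)) = q * (q * p - a * a^*).
  by ring.
rewrite pmulr_rge0 // subr_ge0 -normCK /p /q !hdotE -exprMn => le.
by rewrite -(@ler_pXn2r _ 2) ?nnegrE ?mulr_ge0 // mulrC.
Qed.

Lemma closed_ortho v : closed [set u : H | '[u, v] = 0].
Proof.
move=> x cx /=; apply/eqP/negPn/negP => c0.
have b0 : 0 < `|v| + 1 by rewrite ltr_wpDl.
have e0 : 0 < `|'[x, v]| / (`|v| + 1) by rewrite divr_gt0 // normr_gt0.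
have [u [/= uv]] := cx _ (nbhsx_ballx x _ e0).
rewrite -ball_normE /= => xu.
have : `|'[x, v]| < `|'[x, v]|.
  apply: (@le_lt_trans _ _ (`|x - u| * `|v|)).
    by apply: le_trans (cauchy_schwarz _ _); rewrite dotDl dotNl uv subr0.
  apply: (@le_lt_trans _ _ (`|x - u| * (`|v| + 1))); first by rewrite ler_wpM2l // lerDl.
  by rewrite -ltr_pdivlMr.
by rewrite ltxx.
Qed.

End HilbertBasics.

Section Lipschitz.
Variables (R : realType) (H H' : hilbert R).
Local Open Scope classical_set_scope.

Lemma lipschitz_closed (f : H -> H') (k : R[i]) (A : set H') :
  0 < k -> (forall u v, `|f u - f v| <= k * `|u - v|) -> closed A -> closed (f @^-1` A).
Proof.
move=> k0 fk cA x cx; apply: cA => B /nbhs_ballP[e /= e0 eB].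
have [u [/= uA]] := cx _ (nbhsx_ballx x _ (divr_gt0 e0 k0)).
rewrite -ball_normE /= => xu; exists (f u); split=> //; apply: eB.
rewrite -ball_normE /=; apply: le_lt_trans (fk _ _) _.
by rewrite mulrC -ltr_pdivlMr.
Qed.

Lemma closed_singleton0 : closed [set (0 : H')].
Proof. exact/accessible_closed_set1/hausdorff_accessible/norm_hausdorff. Qed.

End Lipschitz.

(** * Finite permutations in the infinite symmetric group *)

Section Emb.
Implicit Types (n : nat) (g : Sinf).

Lemma perm_natE n (s : 'S_n) (i : 'I_n) : perm_nat s i = s i.
Proof. by rewrite /perm_nat valK. Qed.

Lemma perm_nat_out n (s : 'S_n) i : (n <= i)%N -> perm_nat s i = i.
Proof. by move=> ni; rewrite /perm_nat insubN // -leqNgt. Qed.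

Lemma embSM n : {morph @embS n : s t / (s * t)%g}.
Proof.
move=> s t; apply: Sinf_eq => i /=.
case: (ltnP i n) => [lt|ni]; last by rewrite !perm_nat_out.
by rewrite -[ i ]/(nat_of_ord (Ordinal lt)) !perm_natE permM.
Qed.

Lemma embS_inj n : injective (@embS n).
Proof.
move=> s t st; apply/permP => i; apply: val_inj => /=.
by rewrite -!perm_natE -[perm_nat s i]/(embS s i) st.
Qed.

Lemma embSV n (s : 'S_n) : embS s^-1%g = (embS s)^-1%g.
Proof. by apply: Sinf_eq. Qed.

Lemma widen_inj n N (nN : (n <= N)%N) : injective (widen_ord nN).
Proof. by move=> i j /(congr1 val) /= ij; apply: val_inj. Qed.

Lemma embS_widen n N (nN : (n <= N)%N) (s : 'S_n) :
  embS (pext (widen_inj (nN := nN)) s) = embS s.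
Proof.
apply: Sinf_eq => i /=; case: (ltnP i n) => [lt|ni].
  rewrite -[i in RHS]/(nat_of_ord (Ordinal lt)) perm_natE.
  by rewrite -[i in LHS]/(nat_of_ord (widen_ord nN (Ordinal lt))) perm_natE pextE.
rewrite [RHS]perm_nat_out //; case: (ltnP i N) => [lt|Ni]; last by rewrite perm_nat_out.
rewrite -[i in LHS]/(nat_of_ord (Ordinal lt)) perm_natE pext_out // => j.
by rewrite -val_eqE /= neq_ltn (leq_trans (ltn_ord j) ni).
Qed.

Lemma embS_fix g n : (forall i, (n <= i)%N -> g i = i) -> exists s : 'S_n, embS s = g.
Proof.
move=> gn; have lt (i : 'I_n) : (g i < n)%N.
  rewrite ltnNge; apply/negP => ni; have E := gn _ ni.
  have {}E := can_inj (sfunK g) E.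
  by move: ni; rewrite E leqNgt ltn_ord.
have gI : injective (fun i : 'I_n => Ordinal (lt i)).
  by move=> i j /(congr1 val) /= /(can_inj (sfunK g)) ij; apply: val_inj.
exists (perm gI).
apply: Sinf_eq => i /=; case: (ltnP i n) => [l|ni]; last by rewrite perm_nat_out // gn.
by rewrite -[i in LHS]/(nat_of_ord (Ordinal l)) perm_natE permE.
Qed.

Lemma embS_surj g n0 : exists n (s : 'S_n), (n0 <= n)%N /\ embS s = g.
Proof.
have [n1 gn1] := sfin g; have [|s sg] := @embS_fix g (maxn n0 n1).
  by move=> i; rewrite geq_max => /andP[_ /gn1].
by exists (maxn n0 n1), s; split; first exact: leq_maxl.
Qed.

Lemma shiftS_embS d n (s : 'S_n) :
  shiftS d (embS s) = embS (pext (@rshift_inj d n) s).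
Proof.
apply: Sinf_eq => i /=; rewrite /shift_nat; case: ltnP => id.
  have lt : (i < d + n)%N by apply: leq_trans id (leq_addr _ _).
  rewrite -[i in RHS]/(nat_of_ord (Ordinal lt)) perm_natE pext_out // => j.
  by rewrite -val_eqE /= neq_ltn orbC (leq_trans id (leq_addr _ _)).
case: (ltnP i (d + n)) => lt; last first.
  rewrite [RHS]perm_nat_out // perm_nat_out ?subnKC //.
  by rewrite leq_subRL.
have l : (i - d < n)%N by rewrite ltn_subLR.
rewrite -[(i - d)%N]/(nat_of_ord (Ordinal l)) perm_natE.
transitivity (perm_nat (pext (@rshift_inj d n) s) (rshift d (Ordinal l))).
  by rewrite perm_natE pextE.
by congr perm_nat; rewrite /= subnKC.
Qed.

End Emb.

Section Rep.
Variables (R : realType) (H : hilbert R) (rho : unitary_rep Sinf H).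
Local Notation C := R[i].
Local Open Scope classical_set_scope.

Lemma rep_norm g u : `|rho g u| = `|u|.
Proof.
have := rep_dot rho g u u; rewrite !hdotE => /eqP.
by rewrite eqrXn2 // => /eqP.
Qed.

Lemma rep_adj g u v : '[rho g u, v] = '[u, rho g^-1%g v].
Proof. by rewrite -(rep_dot rho g^-1%g) -repM mulVg rep1. Qed.

Definition algact n (y : galg C 'S_n) (u : H) : H := \sum_s y s *: rho (embS s) u.

Lemma algactD n (y z : galg C 'S_n) u : algact (y + z) u = algact y u + algact z u.
Proof. by rewrite -big_split; apply: eq_bigr => s _; rewrite galg_addE scalerDl. Qed.

Lemma algactZ n (k : C) (y : galg C 'S_n) u : algact (k *: y) u = k *: algact y u.
Proof. by rewrite scaler_sumr; apply: eq_bigr => s _; rewrite galg_scaleE scalerA. Qed.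

Lemma algact0r n (y : galg C 'S_n) : algact y 0 = 0.
Proof. by rewrite /algact big1 // => s _; rewrite linear0 scaler0. Qed.

Lemma algact0 n u : algact (0 : galg C 'S_n) u = 0.
Proof. by rewrite /algact big1 // => s _; rewrite galg0E scale0r. Qed.

Lemma algact_sum n (I : finType) (P : pred I) (F : I -> galg C 'S_n) u :
  algact (\sum_(i | P i) F i) u = \sum_(i | P i) algact (F i) u.
Proof. by apply: (big_morph (fun y => algact y u)) => [y z|]; rewrite ?algactD ?algact0. Qed.

Lemma algact_gel n (s : 'S_n) u : algact (gel C s) u = rho (embS s) u.
Proof.
rewrite /algact (bigD1 s) //= big1 ?addr0 ?gelE ?eqxx ?scale1r // => t /negPf ts.
by rewrite gelE ts scale0r.
Qed.

Lemma algact_linear n (y : galg C 'S_n) (k : C) u v : algact y (k *: u + v) = k *: algact y u + algact y v.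
Proof.
rewrite scaler_sumr -big_split; apply: eq_bigr => s _ /=.
by rewrite linearP scalerDr !scalerA mulrC.
Qed.

Lemma algactM n (y z : galg C 'S_n) u : algact (y * z) u = algact y (algact z u).
Proof.
have gz s : algact (gel C s * z) u = rho (embS s) (algact z u).
  rewrite {1}(galgE z) mulr_sumr algact_sum linear_sum; apply: eq_bigr => t _.
  have -> : gel C s * (z t *: gel C t) = z t *: gel C (s * t)%g by rewrite -scalerAr gelM.
  by rewrite algactZ algact_gel embSM repM linearZ.
rewrite {1}(galgE y) mulr_suml algact_sum; apply: eq_bigr => s _.
have -> : y s *: gel C s * z = y s *: (gel C s * z) by rewrite -scalerAl.
by rewrite algactZ gz.
Qed.

Lemma algact_adj n (y : galg C 'S_n) u v : '[algact y u, v] = '[u, algact (star y) v].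
Proof.
rewrite dot_suml dot_sumr (reindex_inj invg_inj) /=; apply: eq_bigr => s _.
by rewrite dotZl dotZr starE conjCK rep_adj embSV invgK.
Qed.

Lemma algact_norm2 n (y : galg C 'S_n) u :
  '[algact y u, algact y u] = \sum_s (star y * y) s * '[rho (embS s) u, u].
Proof.
rewrite dotC algact_adj -algactM -dotC dot_suml.
by apply: eq_bigr => s _; rewrite dotZl.
Qed.

Lemma algact_push n N (f : 'I_n -> 'I_N) (fI : injective f) (y : galg C 'S_n) u :
  algact (push (pext fI) y) u = \sum_s y s *: rho (embS (pext fI s)) u.
Proof.
by rewrite algact_sum; apply: eq_bigr => s _; rewrite algactZ algact_gel.
Qed.

Lemma algact_widen n N (nN : (n <= N)%N) (y : galg C 'S_n) u :
  algact (push (pext (widen_inj (nN := nN))) y) u = algact y u.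
Proof. by rewrite algact_push; apply: eq_bigr => s _; rewrite embS_widen. Qed.

(** Two injections differ by a permutation of the target, so the two images of y are conjugate and
    vanish as operators together. *)
Lemma algact_conj n N (f f' : 'I_n -> 'I_N) (fI : injective f) (f'I : injective f')
    (y : galg C 'S_n) :
  (forall u, algact (push (pext fI) y) u = 0) -> forall u, algact (push (pext f'I) y) u = 0.
Proof.
move=> f0 u; have [g gf] := inj_extend fI f'I.
have E : f' = g \o f by apply/funext => i /=; rewrite gf.
have gfI : injective (g \o f) by rewrite -E.
have E0 := algact_push fI y (rho (embS g) u); rewrite f0 in E0.
apply: etrans (algact_push f'I y u) _.
have E1 := congr1 (rho (embS g)^-1%g) E0; rewrite linear0 linear_sum in E1.
rewrite [RHS]E1; apply: eq_bigr => s _.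
rewrite linearZ /= -!repM -!embSV -!embSM; congr (_ *: rho (embS _) _).
rewrite (_ : pext f'I s = pext gfI s); last first.
  apply/permP => z; case: (in_or_out f' z) => [[x ->]|zo].
    by rewrite pextE -[in RHS]gf -[g (f x)]/((g \o f) x) pextE /= gf.
  by rewrite !pext_out // => x /=; rewrite gf.
by rewrite -mulgA (pext_conj fI gfI) mulKg.
Qed.

Lemma algact_inj n N (f : 'I_n -> 'I_N) (fI : injective f) (y : galg C 'S_n) :
  (forall u, algact y u = 0) -> forall u, algact (push (pext fI) y) u = 0.
Proof.
move=> y0; have nN : (n <= N)%N by rewrite -[n]card_ord -[N]card_ord; exact: leq_card fI.
by apply: (@algact_conj n N (widen_ord nN) f (widen_inj (nN := nN))) => u; rewrite algact_widen.
Qed.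

Lemma algact_lipschitz n (y : galg C 'S_n) u v :
  `|algact y u - algact y v| <= (1 + \sum_s `|y s|) * `|u - v|.
Proof.
have -> : algact y u - algact y v = \sum_s y s *: rho (embS s) (u - v).
  by rewrite /algact -sumrB; apply: eq_bigr => s _; rewrite linearB scalerBr.
apply: le_trans (ler_norm_sum _ _ _) _; rewrite mulrDl mul1r.
apply: (@le_trans _ _ ((\sum_s `|y s|) * `|u - v|)); last by rewrite lerDr.
by rewrite mulr_suml; apply: ler_sum => s _; rewrite normrZ rep_norm.
Qed.

Lemma algact_closed n (y : galg C 'S_n) : closed_subspace [set u | algact y u = 0].
Proof.
split.
- apply: (@lipschitz_closed _ _ _ (algact y) (1 + \sum_s `|y s|) [set 0]).
  + by rewrite ltr_wpDr // sumr_ge0.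
  + exact: algact_lipschitz.
  + exact: closed_singleton0.
- exact: algact0r.
- by move=> c u v /= u0 v0; rewrite algact_linear u0 v0 scaler0 addr0.
Qed.

End Rep.

Section GroupAlgebra.
Variable R : realType.
Local Notation C := R[i].

Lemma algact_restr (H : hilbert R) (rho : unitary_rep Sinf H) n (a : group_algebra R Sinf) u :
  CS n a -> \sum_(g <- finsupp a) a g *: rho g u = algact rho (restr n a : galg C 'S_n) u.
Proof.
move=> an; rewrite /algact.
have -> : \sum_s (restr n a : galg C 'S_n) s *: rho (embS s) u =
    \sum_(g <- [seq embS s | s <- enum {: 'S_n}]) a g *: rho g u.
  by rewrite big_map big_enum; apply: eq_bigr => s _; rewrite ffunE.
rewrite [RHS](bigID (fun g => g \in finsupp a)) /= [X in _ = _ + X]big1 ?addr0; last first.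
  by move=> g; rewrite memNfinsupp => /eqP ->; rewrite scale0r.
rewrite -[RHS]big_filter; apply: perm_big; apply: uniq_perm.
- exact: fset_uniq.
- by rewrite filter_uniq // map_inj_uniq ?enum_uniq //; exact: embS_inj.
move=> g; rewrite mem_filter; case: (boolP (g \in finsupp a)) => //= ga.
have [s _ <-] := an _ ga; by rewrite (map_f (@embS n)) // mem_enum.
Qed.

Lemma CS_exists (a : group_algebra R Sinf) : exists n, CS n a.
Proof.
have [n nP] : exists n, forall g, g \in finsupp a -> forall i, (n <= i)%N -> g i = i.
  suff : forall r : seq Sinf, exists n, forall g, g \in r -> forall i, (n <= i)%N -> g i = i.
    exact.
  elim=> [|g r [n IH]]; first by exists 0%N.
  have [m gm] := sfin g; exists (maxn m n) => h; rewrite inE => /orP[/eqP ->|hr] i;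
    rewrite geq_max => /andP[mi ni]; first exact: gm.
  exact: IH.
by exists n => g ga; have [s sg] := embS_fix (nP g ga); exists s.
Qed.

Lemma restr_eq0 n (a : group_algebra R Sinf) : CS n a ->
  (restr n a : galg C 'S_n) = 0 -> a = [fsfun].
Proof.
move=> an a0; apply/fsfunP => g; rewrite fsfun0E.
case: (boolP (g \in finsupp a)) => [ga|]; last by rewrite memNfinsupp => /eqP.
have [s _ <-] := an _ ga; have /ffunP/(_ s) := a0; by rewrite !ffunE.
Qed.

End GroupAlgebra.

Local Open Scope classical_set_scope.

Section RepMore.
Variables (R : realType) (H : hilbert R) (rho : unitary_rep Sinf H).
Local Notation C := R[i].

Lemma closed_subspace_sum (A : set H) : closed_subspace A ->
  forall (I : finType) (c : I -> C) (F : I -> H), (forall i, A (F i)) -> A (\sum_i c i *: F i).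
Proof.
move=> [_ A0 AD] I c F AF; apply: (big_ind A) => // [u v Au Av|i _].
  by rewrite -[u]scale1r; apply: AD.
by rewrite -[_ *: _]addr0; apply: AD.
Qed.

Lemma subrep_algact (A : set H) n (y : galg C 'S_n) u : subrep rho A -> A u -> A (algact rho y u).
Proof. by move=> [As Ar] Au; apply: closed_subspace_sum => // s; exact: Ar. Qed.

Lemma closed_subspace_ortho (b : H) : closed_subspace [set x : H | '[x, b] = 0].
Proof.
split; [exact: closed_ortho|exact: dot0l|].
by move=> c u v /= u0 v0; rewrite dotDl dotZl u0 v0 mulr0 addr0.
Qed.

Lemma rep_closed_preim (A : set H) g : closed_subspace A -> closed_subspace [set x | A (rho g x)].
Proof.
move=> [cA A0 AD]; split.
- apply: (@lipschitz_closed _ _ _ (rho g) 1 A) => // u v.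
  by rewrite -linearB rep_norm mul1r.
- by rewrite /= linear0.
- by move=> c u v /= Au Av; rewrite linearP; apply: AD.
Qed.

Lemma AnnP n (a : group_algebra R Sinf) : CS n a ->
  Ann rho a <-> forall u, algact rho (restr n a : galg C 'S_n) u = 0.
Proof.
move=> an; split=> [H0 u|H0 u]; first by rewrite -algact_restr //; exact: H0.
by rewrite (@algact_restr _ _ rho n) //; exact: H0.
Qed.

End RepMore.

Lemma subrep_nonzero (R : realType) (H : hilbert R) (rho : unitary_rep Sinf H) (A : set H) :
  closed_subspace A -> A <> [set 0] -> exists2 b, A b & b != 0.
Proof.
move=> [_ A0 _] An0; apply: contrapT => no; apply: An0; apply/seteqP; split=> [u Au|u ->] //.
by apply/eqP/negPn/negP => u0; apply: no; exists u.
Qed.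

(** * Annihilators and quasi-equivalence *)

Section Quasi.
Variables (R : realType) (H H' : hilbert R).
Variables (rho : unitary_rep Sinf H) (rho' : unitary_rep Sinf H').
Local Notation C := R[i].

(* If a kills rho' but not rho, the closed span A of the images of a contains
   a copy B of a subrepresentation of rho'; then a^* kills B, so B is
   orthogonal to A. *)
Lemma Ann_quasi :
  (forall A, subrep rho A -> A <> [set 0] -> ~ disjoint_subrep rho A rho') ->
  (Ann rho' `<=` Ann rho)%classic.
Proof.
move=> nd a aAnn'; have [n an] := CS_exists a.
have {}aAnn' := (AnnP rho' an).1 aAnn'; apply/(AnnP rho an).
move: aAnn'; set y := (restr n a : galg C 'S_n) => y'0.
apply: contrapT => /existsNP[u0 /eqP yu0].
pose gens (B : set H) := forall g u, B (rho g (algact rho y u)).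
pose A : set H := [set x | forall B, closed_subspace B -> gens B -> B x].
have As : subrep rho A.
  split; last first.
    move=> g u Au B cB gB; apply: (Au [set x | B (rho g x)]); first exact: rep_closed_preim.
    by move=> h z /=; rewrite -repM; exact: gB.
  split.
  - have -> : A = (\bigcap_(B in [set B | closed_subspace B /\ gens B]) B)%classic.
      apply/seteqP; split=> [x Ax B [cB gB]|x Ax B cB gB]; [exact: Ax|exact: Ax].
    by apply: closed_bigI => B [[]].
  - by move=> B [].
  - by move=> c u v Au Av B cB gB; have [_ _ BD] := cB; apply: BD; [exact: Au|exact: Av].
have An0 : A <> [set 0].
  move=> A0; have : A (algact rho y u0) by move=> B cB gB; rewrite -[algact _ _ _](rep1 rho).
  by rewrite A0 => /= E; rewrite E eqxx in yu0.
apply: (nd A As An0) => B B' sB BA sB' [U [UB Uiso Ueq]].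
apply: contrapT => /(subrep_nonzero rho sB.1)[b Bb b0].
have Ugact z x : B x -> U (algact rho z x) = algact rho' (z : galg C 'S_n) (U x).
  by move=> Bx; rewrite /algact linear_sum; apply: eq_bigr => s _; rewrite linearZ /= Ueq.
have star0 x : B x -> algact rho (star y) x = 0.
  move=> Bx; apply: dot_eq0; rewrite -Uiso; try exact: subrep_algact.
  by rewrite Ugact // (algact_adj rho' (star y)) starK y'0 dot0r.
have bA : A b by exact: BA.
suff : '[b, b] = 0 by move=> /dot_eq0 b00; rewrite b00 eqxx in b0.
apply: (bA [set x | '[x, b] = 0]); first exact: closed_subspace_ortho.
move=> g u /=; rewrite rep_adj (algact_adj rho y) star0 ?dot0r //.
exact: sB.2.
Qed.

End Quasi.

(** * Faithful states and the zero case *)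

Section Faithful.
Variables (R : realType) (H : hilbert R) (rho : unitary_rep Sinf H) (w : thoma R).
Local Notation C := R[i].

(** An element acting by zero still does so after its points are moved beyond d, where the state at
    v is the Thoma character, faithful in this case. *)
Lemma Ann_faithful (v : H) d : zero_case w -> v != 0 ->
  (forall n (s : 'S_n), '[rho (shiftS d (embS s)) v, v] = (chi w s)%:C%C * '[v, v]) ->
  Ann rho = [set [fsfun]].
Proof.
move=> zc v0 vchi; apply/seteqP; split=> [a aAnn|a ->]; last first.
  by move=> u; rewrite big1_seq // => g /=; rewrite finsupp0 inE.
have [n an] := CS_exists a; have {}aAnn := (AnnP rho an).1 aAnn.
apply: (restr_eq0 an); move: aAnn; set y := (restr n a : galg C 'S_n) => y0.
apply: (chi_faithful_zero zc).
have Y0 := algact_inj (@rshift_inj d n) y0 v.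
have E : algact rho (push (pext (@rshift_inj d n)) (star y * y)) v = 0.
  rewrite (pushM (pextM (@rshift_inj d n)) (star y) y).
  apply: etrans (algactM rho _ _ v) _.
  exact: etrans (congr1 (algact rho _) Y0) (algact0r rho _).
have := congr1 (fun u => '[u, v])
  (etrans (esym (algact_push rho (@rshift_inj d n) (star y * y) v)) E).
rewrite dot0l dot_suml => E1.
have q0 : '[v, v] != 0 by apply: contra_neq v0 => /dot_eq0.
apply: (mulIf q0); rewrite mul0r mulr_suml -[RHS]E1; apply: eq_bigr => s _.
by rewrite dotZl -shiftS_embS vchi mulrA.
Qed.

End Faithful.

Section Depth.
Variables (R : realType) (H : hilbert R) (V : unitary_rep (Sinf * Sinf)%type H).
Variables (w : thoma R) (L M : young_dist R) (isV : is_V V w L M).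

Lemma Kfix_vector : exists2 v, Kfix V (yd_size L) v & v != 0.
Proof.
apply: contrapT => no; apply: (isV_depth isV); apply/seteqP; split=> [u Ku|u ->] /=.
  by apply/eqP/negPn/negP => u0; apply: no; exists u.
by move=> g _; rewrite linear0.
Qed.

Lemma Sfix_shift d n (s : 'S_n) : Sfix d (shiftS d (embS s)).
Proof. by move=> i id /=; rewrite /shift_nat id. Qed.

(** The diagonal fixes v, so right translation of v by g is left translation by g^-1; passing to the
    adjoint conjugates a real value. *)
Lemma rres_char v : Kfix V (yd_size L) v -> forall n (s : 'S_n),
  '[V (1%g, shiftS (yd_size L) (embS s)) v, v] = (chi w s)%:C%C * '[v, v].
Proof.
move=> Kv n s; set g := shiftS _ _.
have gK : Sfix (yd_size L) g by exact: Sfix_shift.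
have gVK : Sfix (yd_size L) g^-1%g.
  by move=> i id; have := sfunK g i; rewrite (gK _ id).
have -> : V (1%g, g) v = V (g^-1%g, 1%g) v.
  rewrite -{1}(Kv _ gVK) -repM; congr (V _ v).
  by rewrite -[LHS]/(1 * g^-1, g * g^-1)%g mul1g mulgV.
have -> : '[V (g^-1%g, 1%g) v, v] = '[v, V (g, 1%g) v].
  by rewrite -[LHS]/'[lres V g^-1%g v, v] rep_adj invgK.
rewrite dotC (isV_char isV) // rmorphM /= -dotC; congr (_ * _).
by rewrite /Num.conj /= oppr0.
Qed.

Lemma lAnn_zero : zero_case w -> lAnn V = [set [fsfun]].
Proof.
move=> zc; have [v Kv v0] := Kfix_vector.
by apply: (Ann_faithful zc v0) => n s; exact: (isV_char isV).
Qed.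

Lemma rAnn_zero : zero_case w -> rAnn V = [set [fsfun]].
Proof.
move=> zc; have [v Kv v0] := Kfix_vector.
by apply: (Ann_faithful zc v0) => n s; exact: rres_char.
Qed.

End Depth.

Lemma embS_lshift r k (s : 'S_r) : embS (pext (@lshift_inj r k) s) = embS s.
Proof.
rewrite -(embS_widen (leq_addr k r)); congr embS; apply/permP => y.
case: (in_or_out (@lshift r k) y) => [[x ->]|yo].
  have -> : lshift k x = widen_ord (leq_addr k r) x by apply: val_inj.
  rewrite pextE; have := pextE (@lshift_inj r k) s x.
  have -> : lshift k x = widen_ord (leq_addr k r) x by apply: val_inj.
  by move=> ->; apply: val_inj.
rewrite !pext_out // => x; have -> // : widen_ord (leq_addr k r) x = lshift k x by apply: val_inj.
Qed.

(** * The induced representation *)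

Section YoungSym.
Variable R : realType.
Local Notation C := R[i].

Lemma young_symmetrizerE n (T1 T2 : eqType) (row : 'I_n -> T1) (col : 'I_n -> T2) :
  young_symmetrizer R row col = (psym C row * asym C col : galg C 'S_n).
Proof.
apply/ffunP => s; rewrite gmulE ffunE [LHS]big_mkcond /=; apply: eq_bigr => p _.
have -> : [forall i, row (p i) == row i] = (p \in stabf row) by rewrite inE.
rewrite psymE; case: (p \in stabf row); last by rewrite mul0r.
rewrite mul1r asymE; case: (boolP (p^-1 * s \in stabf col)%g) => qs.
  rewrite (bigD1 (p^-1 * s)%g) /=; last first.
    by move: qs; rewrite inE => ->; rewrite mulKVg eqxx.
  rewrite big1 ?addr0 ?mul1r // => q /andP[/andP[_ /eqP <-]]; by rewrite mulKg eqxx.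
rewrite mul0r big1 // => q /andP[qc /eqP E]; case/negP: qs.
by rewrite -E mulKg inE.
Qed.

Lemma specht_young n nu u : @specht R n nu u <-> exists x : galg C 'S_n, u = x * young C nu n.
Proof.
rewrite /specht /left_ideal young_symmetrizerE; split=> [[x _ <-]|[x ->]]; first by exists x.
by exists x.
Qed.

End YoungSym.

Section Induced.
Variables (R : realType).
Local Notation C := R[i].
Variables (w : thoma R) (m n r : nat) (la : seq nat).
Hypotheses (am : is_max_index (alpha w) m) (bn : is_max_index (beta w) n).
Hypothesis nz : ~ zero_case w.
Hypotheses (lap : is_partition la) (lar : sumn la = r).
Variables (HT : hilbert R) (T : unitary_rep (Sinf * Sinf)%type HT)
  (W : hilbert R) (tau : unitary_rep ('S_r * Sinf)%type W)
  (HI : hilbert R) (I : unitary_rep Sinf HI).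
Hypothesis Tirr : irreducible_rep T.
Variable v : HT.
Hypotheses (v1 : '[v, v] = 1) (vfix : forall g : Sinf, T (g, g) v = v)
  (vchi : forall k (s : 'S_k), '[T (embS s, 1%g) v, v] = (chi w s)%:C%C).
Variable b : {bilinear fin_group_algebra R 'S_r -> HT -> W}.
Local Notation D := (@specht R r la).
Hypothesis bdot : forall u u' t t', D u -> D u' -> '[b u t, b u' t'] = dotf u u' * '[t, t'].
Hypothesis btau : forall s h u t, D u -> tau (s, h) (b u t) = b (ltrans s u) (lres T h t).
Hypothesis bspan : forall A : set W, closed_subspace A -> (forall u t, D u -> A (b u t)) -> A = setT.
Variable j : {linear W -> HI}.
Hypothesis jdot : forall u v, '[j u, j v] = '[u, v].
Hypothesis jtau : forall k u, I (young_emb k) (j u) = j (tau k u).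
Hypothesis jorth : forall g u v, ~ range (young_emb (r := r)) g -> '[I g (j u), j v] = 0.
Hypothesis jspan : forall A : set HI, closed_subspace A -> (forall g u, A (I g (j u))) -> A = setT.

Let c : galg C 'S_r := young C la r.
Let xi : HI := j (b c v).

Lemma Dc : D c.
Proof. by apply/specht_young; exists 1; rewrite mul1r. Qed.

Definition young_mul k (p : 'S_r * 'S_k) : 'S_(r + k) :=
  (pext (@lshift_inj r k) p.1 * pext (@rshift_inj r k) p.2)%g.

Lemma young_mul_inj k : injective (@young_mul k).
Proof.
move=> [s t] [s' t'] /= E; congr pair; apply/permP => i.
  have := congr1 (fun q : 'S_(r + k) => q (lshift k i)) E; rewrite /young_mul /= !permM !pextE.
  have o (x : 'I_r) : forall y : 'I_k, rshift r y != lshift k x by move=> y; rewrite eq_rlshift.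
  by rewrite !(pext_out _ _ (o _)) => /lshift_inj.
have := congr1 (fun q : 'S_(r + k) => q (rshift r i)) E; rewrite /young_mul /= !permM.
have o : forall y : 'I_r, lshift k y != rshift r i by move=> y; rewrite eq_lrshift.
by rewrite !(pext_out _ _ o) !pextE => /rshift_inj.
Qed.

Lemma embS_young_mul k (p : 'S_r * 'S_k) : embS (young_mul p) = young_emb (p.1, embS p.2).
Proof. by rewrite embSM embS_lshift -shiftS_embS. Qed.

Lemma young_mul_range k (g : 'S_(r + k)) : range (young_emb (r := r)) (embS g) ->
  exists p, g = young_mul p.
Proof.
move=> [[s h] _ E].
have hk i : (k <= i)%N -> h i = i.
  move=> ki; have := congr1 (fun q : Sinf => q (r + i)%N) E.
  rewrite /young_emb /= [RHS]perm_nat_out ?leq_add2l // perm_nat_out ?leq_addr //.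
  by rewrite /shift_nat ltnNge leq_addr /= addKn => /addnI.
have [t th] := embS_fix hk.
by exists (s, t); apply: embS_inj; rewrite embS_young_mul /= th E.
Qed.

(** Off the Young subgroup the translates of the inducing space are orthogonal to it. On the
    subgroup the state is the Thoma character times the matrix coefficient of c, which is the trace
    of p.1 * c * star c. *)
Lemma xi_state k (g : 'S_(r + k)) : '[I (embS g) xi, xi] =
  \sum_(p : 'S_r * 'S_k) (g == young_mul p)%:R * ((c * star c) p.1^-1%g * (chi w p.2)%:C%C).
Proof.
have [[p ->]|no] := pselect (exists p, g = @young_mul k p).
  rewrite (bigD1 p) //= eqxx mul1r big1 ?addr0; last first.
    by move=> q /negPf qp; rewrite (inj_eq (@young_mul_inj k)) eq_sym qp mul0r.
  rewrite embS_young_mul /xi jtau jdot btau ?bdot; try exact: Dc; last first.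
    apply/specht_young; exists (gel C p.1); apply/ffunP => h; rewrite ffunE mul_gell //.
  congr (_ * _); last exact: vchi.
  rewrite gmulE /dotf [LHS](reindex_inj (mulgI p.1)) /=.
  by apply: eq_bigr => h _; rewrite ffunE starE mulKg !invMg !invgK.
rewrite big1 => [|p _]; last by case: eqP => [gp|_]; [case: no; exists p|rewrite mul0r].
by apply: jorth => /young_mul_range.
Qed.

Lemma xi_norm k (Y : galg C 'S_(r + k)) :
  '[algact I Y xi, algact I Y xi] =
  \sum_(x : {ffun 'I_k -> letter m n}) (chi_wt w x)%:C%C *
    tr (star Y * Y * (push (pext (@lshift_inj r k)) (c * star c) *
                      push (pext (@rshift_inj r k)) (wproj C x))).
Proof.
rewrite algact_norm2; set B := star Y * Y.
have -> : \sum_s B s * '[I (embS s) xi, xi] =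
    \sum_(p : 'S_r * 'S_k) B (young_mul p) * ((c * star c) p.1^-1%g * (chi w p.2)%:C%C).
  under eq_bigr => g _ do rewrite xi_state mulr_sumr.
  rewrite exchange_big /=; apply: eq_bigr => p _.
  rewrite (bigD1 (young_mul p)) //= eqxx mul1r big1 ?addr0 // => g /negPf gp.
  by rewrite gp mul0r mulr0.
under eq_bigr => p _ do rewrite (chi_words am bn p.2) !mulr_sumr.
rewrite exchange_big /=; apply: eq_bigr => x _.
have trE : forall a d, tr (B * (push (pext (@lshift_inj r k)) a * push (pext (@rshift_inj r k)) d)) =
    \sum_(p : 'S_r * 'S_k) B (young_mul p) * (a p.1^-1%g * d p.2^-1%g).
  move=> a d; have -> : push (pext (@lshift_inj r k)) a * push (pext (@rshift_inj r k)) d =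
     \sum_(p : 'S_r * 'S_k) (a p.1 * d p.2) *: gel C (young_mul p).
    have -> : push (pext (@lshift_inj r k)) a = \sum_s a s *: gel C (pext (@lshift_inj r k) s) by [].
    have -> : push (pext (@rshift_inj r k)) d = \sum_s d s *: gel C (pext (@rshift_inj r k) s) by [].
    rewrite big_distrlr /= pair_big /=; apply: eq_bigr => p _.
    by rewrite -scalerAl -scalerAr scalerA gelM.
  rewrite mulr_sumr /tr galg_sumE (reindex_inj invg_inj) /=; apply: eq_bigr => p _.
  rewrite -scalerAr galg_scaleE mul_gelr mul1g mulrC; congr (B _ * _).
  rewrite /young_mul /= !(morphgV (pextM _)) invMg !invgK.
  by rewrite pext_disj //; [exact: lr_disj|exact: lr_cover].
rewrite trE mulr_sumr; apply: eq_bigr => p _.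
have wV : wproj C x p.2^-1%g = wchar C x p.2.
  rewrite -wcharE /wchar; case: (boolP (p.2 \in stabf (wlab x))) => px.
    by rewrite (groupVr (px : p.2 \in stabf_group (wlab x))) (sgn_charV (@wsgnM _ _ _ x)).
  by rewrite -[_ \in stabf _]/(_ \in stabf_group (wlab x)) groupV (negPf px) !mul0r.
by rewrite wV; ring.
Qed.

(** [wproj] commutes with the factor on the other block and squares to a multiple of itself, so a
    weighted trace becomes the squared norm of Y * hook_elt. *)
Lemma xi_term k (Y : galg C 'S_(r + k)) (x : 'I_k -> letter m n) :
  #|stabf (wlab x)|%:R * tr (star Y * Y * (push (pext (@lshift_inj r k)) (c * star c) *
                      push (pext (@rshift_inj r k)) (wproj C x))) =
  tr (star (Y * hook_elt C r la x) * (Y * hook_elt C r la x)).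
Proof.
set E := hook_elt C r la x.
have -> : tr (star (Y * E) * (Y * E)) = tr (star Y * Y * (E * star E)).
  by rewrite starM -mulrA trC !mulrA.
have -> : E * star E = #|stabf (wlab x)|%:R *: (push (pext (@lshift_inj r k)) (c * star c) *
                      push (pext (@rshift_inj r k)) (wproj C x)).
  rewrite /E /hook_elt starM -!(push_star (pextM _)) star_wproj.
  rewrite (pushM (pextM (@lshift_inj r k)) c (star c)) -/c.
  set p := push _ c; set q := push _ (star c); set e := push _ (wproj C x).
  have ee : e * e = #|stabf (wlab x)|%:R *: e.
    by rewrite -(pushM (pextM (@rshift_inj r k))) wproj_sqr (pushZ (pext (@rshift_inj r k))).
  have -> : p * e * (e * q) = p * (e * e) * q by rewrite !mulrA.
  rewrite ee -scalerAr -scalerAl; congr (_ *: _).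
  have eq : e * q = q * e := esym (push_disj _ _ (@lr_disj r k) (@lr_cover r k) _ _).
  by rewrite -[LHS]mulrA eq mulrA.
by rewrite -scalerAr /tr galg_scaleE.
Qed.

(** The squared norm of Y xi is a sum of non-negative terms. Words containing None have weight 0
    because the defect vanishes; the other weights are positive, so each of their terms must be
    0. *)
Lemma xi_kill k (Y : galg C 'S_(r + k)) : algact I Y xi = 0 <->
  forall x : 'I_k -> letter m n, (forall i, x i <> None) -> Y * hook_elt C r la x = 0.
Proof.
have st0 (x : 'I_k -> letter m n) : 0 < #|stabf (wlab x)|%:R :> C.
  by rewrite ltr0n (cardG_gt0 (stabf_group (wlab x))).
have ge0 (x : 'I_k -> letter m n) : 0 <= tr (star Y * Y * (push (pext (@lshift_inj r k)) (c * star c) *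
                      push (pext (@rshift_inj r k)) (wproj C x))).
  by rewrite -(pmulr_rge0 _ (st0 x)) xi_term tr_star_ge0.
have wt_pos (x : 'I_k -> letter m n) : 0 <= (chi_wt w x)%:C%C :> C.
  have [no|] := pselect (forall i, x i <> None); first by rewrite ler0c ltW // (chi_wt_gt0 am bn).
  by move=> /existsNP[i /contrapT xi0]; rewrite (chi_wt0 am bn nz xi0).
split=> [Y0 x xN|Y0]; last first.
  apply: dot_eq0; rewrite xi_norm big1 // => x _.
  have [no|] := pselect (forall i, x i <> None); last first.
    by move=> /existsNP[i /contrapT xi0]; rewrite (chi_wt0 am bn nz xi0) mul0r.
  rewrite [X in _ * X](_ : _ = 0) ?mulr0 //; apply: (mulfI (lt0r_neq0 (st0 x))).
  by rewrite xi_term Y0 // !mulr0 /tr galg0E.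
have := xi_norm Y; rewrite Y0 dot0l => /esym/eqP.
rewrite psumr_eq0 => [/allP/(_ (finfun x))|y _]; last by rewrite mulr_ge0.
have -> : (finfun x : 'I_k -> letter m n) = x by apply/funext => i; rewrite ffunE.
rewrite mem_index_enum => /(_ isT) /implyP/(_ isT); rewrite mulf_eq0 => /orP[/eqP E|/eqP E].
  have := chi_wt_gt0 am bn xN; move: E => /(congr1 (@complex.Re R)) /= ->.
  by rewrite ltxx.
by apply: tr_star_eq0; rewrite -xi_term E mulr0.
Qed.

Lemma lin_D (u : galg C 'S_r) t : D u ->
  exists x : galg C 'S_r, b u t = \sum_s x s *: tau (s, 1%g) (b c t).
Proof.
move=> /specht_young[x ->]; exists x; rewrite -/c.
have -> : x * c = \sum_s x s *: (ltrans s c : fin_group_algebra R 'S_r).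
  rewrite {1}(galgE x) mulr_suml; apply: eq_bigr => s _; rewrite -scalerAl; congr (_ *: _).
  by apply/ffunP => h; rewrite mul_gell [RHS]ffunE.
rewrite linear_sumlz; apply: eq_bigr => s _; rewrite linearZl_LR /= btau; last exact: Dc.
by rewrite rep1.
Qed.

(** Irreducibility of T concerns both factors together. The vectors all of whose translates give
    elements of K form a subrepresentation of T; it contains v because diagonal invariance turns T
    (g1, g2) v into a left translate of v, and left translates are realised by I. *)
Lemma xi_cyclic (K : set HI) : subrep I K -> K xi -> K = setT.
Proof.
move=> sK Kxi; have [[cK K0 KD] Kr] := sK.
have bcT g : closed_subspace [set t | K (j (b c (T g t)))].
  split=> [||a t t' /= Kt Kt'].
  (* The map multiplies norms by the square root of [dotf c c], which 1 + dotf c c dominates. *)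
  - apply: (@lipschitz_closed _ _ _ (fun t => j (b c (T g t))) (1 + dotf c c) K) => //.
    + by rewrite ltr_wpDr // sumr_ge0 // => s _; exact: mul_conjC_ge0.
    + move=> t t'; rewrite -linearB -linearBr -linearB /=.
      have d0 : 0 <= dotf c c by rewrite sumr_ge0 // => s _; exact: mul_conjC_ge0.
      rewrite -(@ler_pXn2r _ 2) ?nnegrE ?mulr_ge0 ?addr_ge0 // exprMn -!hdotE.
      rewrite jdot bdot ?rep_dot; try exact: Dc.
      rewrite ler_wpM2r ?dot_ge0 //.
      apply: (@le_trans _ _ (1 + dotf c c)); first by rewrite lerDr.
      by rewrite expr2 ler_peMr ?lerDl // addr_ge0.
  - by rewrite /= !(linear0, linear0r).
  - by rewrite /= linearP linearPr linearP; exact: KD.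
pose A0 := [set t : HT | forall g, K (j (b c (T g t)))].
have A0s : subrep T A0.
  split; last by move=> g t At h; rewrite -repM; exact: At.
  split.
  - have -> : A0 = \bigcap_(g in setT) [set t | K (j (b c (T g t)))].
      by apply/seteqP; split=> [t At g _|t At g]; exact: At.
    by apply: closed_bigI => g _; have [] := bcT g.
  - by move=> g; have [] := bcT g.
  - by move=> a t t' At At' g; have [_ _] := bcT g; apply; [exact: At|exact: At'].
have A0v : A0 v.
  move=> [g1 g2]; have -> : T (g1, g2) v = T (g1 * g2^-1, 1)%g v.
    by rewrite -{2}(vfix g2) -repM; congr (T (_, _) v); rewrite ?mulg1 ?mul1g // mulgKV.
  have := btau 1%g (g1 * g2^-1)%g v Dc.
  have -> : ltrans 1%g c = c by apply/ffunP => h; rewrite ffunE invg1 mul1g.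
  by move=> /= <-; rewrite -jtau; exact: Kr.
have A0T : A0 = setT.
  have [E|//] := Tirr.2 A0 A0s; move: A0v; rewrite E => /= v0.
  by move: v1; rewrite v0 dot0l => /esym/eqP; rewrite oner_eq0.
apply: jspan => // g u; apply: (Kr); move: u.
suff : [set u | K (j u)] = setT by move=> E u; have : [set: W] u by []; rewrite -E.
apply: bspan.
  split.
  - apply: (@lipschitz_closed _ _ _ j 1 K) => // u u'; rewrite -linearB mul1r.
    have := jdot (u - u') (u - u'); rewrite !hdotE => /eqP.
    by rewrite eqrXn2 // => /eqP ->.
  - by rewrite /= linear0.
  - by move=> a u u' /= Ku Ku'; rewrite linearP; exact: KD.
move=> u t Du /=; have [x ->] := lin_D t Du; rewrite linear_sum.
have -> : \sum_s j (x s *: tau (s, 1%g) (b c t)) = \sum_s x s *: I (young_emb (s, 1%g)) (j (b c t)).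
  by apply: eq_bigr => s _; rewrite linearZ jtau.
apply: closed_subspace_sum => // s; apply: Kr.
by have : A0 t; [rewrite A0T|move=> /(_ 1%g); rewrite rep1].
Qed.

Lemma xi_separating n0 (y : galg C 'S_n0) :
  (forall g, algact I y (I g xi) = 0) -> forall u, algact I y u = 0.
Proof.
move=> y0 u; pose K := [set u | forall g, algact I y (I g u) = 0].
have Kg g : closed_subspace [set u | algact I y (I g u) = 0].
  exact: (rep_closed_preim I g (algact_closed I y)).
have : K u; last by move=> /(_ 1%g); rewrite rep1.
rewrite (@xi_cyclic K) //; split; last by move=> g z Kz h; rewrite -repM; exact: Kz.
split.
- have -> : K = \bigcap_(g in setT) [set u | algact I y (I g u) = 0].
    by apply/seteqP; split=> [t At g _|t At g]; exact: At.
  by apply: closed_bigI => g _; have [] := Kg g.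
- by move=> g; have [] := Kg g.
- by move=> a t t' At At' g; have [_ _] := Kg g; apply; [exact: At|exact: At'].
Qed.

(** The elements of C[S_N] acting by zero form a two-sided ideal; the witness of [hook_nonzero]
    keeps the Young symmetrizer of kappa out of it, and [young_ann] applies. *)
Lemma Ann_induced_sub N (a : group_algebra R Sinf) kappa : CS N a -> Ann I a ->
  is_partition kappa -> sumn kappa = N -> sub_inf kappa (inf_part m n la) -> AnnD N kappa a.
Proof.
move=> aN aI kp kN ksub; split=> // u /specht_young[x ->].
have {}aI := (AnnP I aN).1 aI.
pose J (y : galg C 'S_N) := forall u, algact I y u = 0.
have JM y1 y y2 : J y -> J (y1 * y * y2).
  by move=> Jy z; rewrite -mulrA (algactM I y1) (algactM I y) Jy algact0r.
suff nJ : ~ J (young C kappa N) by exact: (young_ann (std_diagram kN) JM nJ x aI).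
move=> Jk.
have [k [y [f [fI [yN [z nz0]]]]]] := hook_nonzero C lap lar kp kN ksub.
apply: nz0; apply: (xi_kill _).1 yN.
rewrite (algactM I); exact: algact_inj.
Qed.

(** The y such that A z y acts by zero for all z form a two-sided ideal. It contains each Young
    symmetrizer, either because A annihilates D^nu or because the symmetrizer itself acts by zero;
    by completeness it contains 1. *)
Lemma Ann_induced_sup N (a : group_algebra R Sinf) : CS N a ->
  (forall kappa, is_partition kappa -> sumn kappa = N -> sub_inf kappa (inf_part m n la) ->
     AnnD N kappa a) -> Ann I a.
Proof.
move=> aN aD; apply/(AnnP I aN); set A := (restr N a : galg C 'S_N) => u.
pose J (y : galg C 'S_N) := forall z u, algact I (A * z * y) u = 0.
suff /(_ 1 u) : J 1 by rewrite !mulr1.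
apply: young_complete_part => [y y' Jy Jy' z t|y1 y y2 Jy z t|nu nup nuN z t].
- by rewrite mulrDr algactD Jy Jy' addr0.
- by rewrite !mulrA -(mulrA A z y1) (algactM I (A * (z * y1) * y)) Jy.
have [sub|nsub] := pselect (sub_inf nu (inf_part m n la)).
  have [_ /(_ (z * young C nu N))] := aD nu nup nuN sub.
  rewrite -mulrA => E; rewrite [A * _]E ?algact0 //.
  by apply/specht_young; exists z.
rewrite (algactM I (A * z)) (@xi_separating _ (young C nu N)) => [|g].
  exact: algact0r.
(* With M at least r + N, the translation by g and the Young symmetrizer act on xi through one
   finite group algebra C[S_(r + k)]. *)
have [M [s [rNM <-]]] := embS_surj g (r + N).
have [k E] : exists k, M = (r + k)%N.
  by exists (M - r)%N; rewrite subnKC // (leq_trans (leq_addr _ _) rNM).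
subst M; have NM := leq_trans (leq_addl r N) rNM.
rewrite -(algact_widen I NM) -(algact_gel I s) -algactM.
apply/xi_kill => x xN; exact: hook_kill.
Qed.

End Induced.

Local Open Scope ring_scope.

Lemma inf_partition_inf_part (R : realType) (w : thoma R) m n la : ~ zero_case w ->
  is_max_index (alpha w) m -> is_max_index (beta w) n -> is_partition la ->
  is_inf_partition (inf_part m n la).
Proof.
move=> nz am bn lap; split=> [i k ik|].
  rewrite /inf_part; case: (ltnP i m) => im; first by case: ifP.
  rewrite ltnNge (leq_trans im ik) /= leq_add2l; apply: partition_nth => //.
  exact: leq_sub2r.
case: (posnP m) am => [m0|m0] am; last by left; exists 0%N; rewrite /inf_part m0.
right=> B; exists B; rewrite -[X in (X <= _)%N](card_ord B) -sum1_card leq_sum // => i _.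
rewrite /inf_part m0 /= ltn_addr // lt0n; apply/eqP => n0.
(* m = n = 0 would make the defect 1. *)
have := defect0 am bn nz; rewrite /defect m0 n0 !big_ord0 addr0 subr0.
by move/eqP; rewrite oner_eq0.
Qed.

Lemma lAnn_nonzero (R : realType) (H : hilbert R) (V : unitary_rep (Sinf * Sinf)%type H)
    (w : thoma R) (L M : young_dist R) (isV : is_V V w L M) m n :
  ~ zero_case w -> VershikNessonov R ->
  is_max_index (alpha w) m -> is_max_index (beta w) n ->
  is_I (inf_part m n (L 0)) (lAnn V).
Proof.
move=> nz VN am bn; have lap := yd_partition L 0.
split; first exact: (inf_partition_inf_part nz am bn).
have [HT [T [W [tau [HI [I [[Tirr [v [v1 vfix vchi]]] [b [bdot btau bspan]]
  [j [jdot jtau jorth jspan]] [qe1 qe2]]]]]]]] := VN _ _ _ _ _ isV.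
have -> : lAnn V = Ann I by apply/seteqP; split; [exact: Ann_quasi|exact: Ann_quasi].
move=> N _; apply/seteqP; split=> a [aI aN]; split=> //.
  move=> kappa [kp [kN ksub]].
  exact: (Ann_induced_sub am bn nz lap erefl vchi bdot btau jdot jtau jorth aN aI kp kN ksub).
apply: (Ann_induced_sup am bn nz lap erefl Tirr v1 vfix vchi bdot btau bspan jdot jtau jorth jspan aI).
by move=> kappa kp kN ksub; apply: aN.
Qed.

(** * Exchange of the two factors *)

Section SwapFun.
Variables (R : realType) (d : nat).
Local Notation F := {ffun 'S_d * 'S_d -> R[i]^o}.

Definition swapf (f : F) : F := [ffun p => f (p.2, p.1)].

Fact swapf_linear : linear swapf.
Proof. by move=> a f g; apply/ffunP => p; rewrite !ffunE. Qed.
HB.instance Definition _ := GRing.isLinear.Build R[i] F F _ swapf swapf_linear.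

Lemma swapfK : involutive swapf.
Proof. by move=> f; apply/ffunP => -[s t]; rewrite !ffunE. Qed.

Lemma swapf_tensor U W f : outer_tensor U W f -> outer_tensor W U (swapf f).
Proof.
move=> [k [u [x [ux ->]]]]; exists k, x, u; split=> [l|]; first by have [] := ux l.
by apply/ffunP => p; rewrite !ffunE; apply: eq_bigr => l _; rewrite mulrC.
Qed.

Lemma swapf_act2 s t f : swapf (act2 s t f) = act2 t s (swapf f).
Proof. by apply/ffunP => p; rewrite !ffunE. Qed.

Lemma swapf_jmA L i f : swapf (jmA L i f) = jmB L i (swapf f).
Proof. by apply/ffunP => p; rewrite !ffunE. Qed.

Lemma swapf_jmB L i f : swapf (jmB L i f) = jmA L i (swapf f).
Proof. by apply/ffunP => p; rewrite !ffunE. Qed.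

End SwapFun.

Program Definition swap_rep (R : realType) (H : hilbert R)
    (V : unitary_rep (Sinf * Sinf)%type H) : unitary_rep (Sinf * Sinf)%type H :=
  @UnitaryRep R _ H (fun g => V (g.2, g.1)) _ _ _.
Next Obligation. by move=> *; exact: rep1. Qed.
Next Obligation. by move=> R H V g h u; rewrite -repM. Qed.
Next Obligation. by move=> *; exact: rep_dot. Qed.

(** Results on the left factor thereby serve for the right one, as the right annihilator of V is the
    left one of [swap_rep V]. The character condition on the other side is [rres_char]. *)
Lemma is_V_swap (R : realType) (H : hilbert R) (V : unitary_rep (Sinf * Sinf)%type H)
    (w : thoma R) (L M : young_dist R) : is_V V w L M -> is_V (swap_rep V) w M L.
Proof.
move=> isV; have sz := isV_size isV; split.
- have [ne irr] := isV_irreducible isV; split=> // A [cA sA]; apply: irr; split=> // -[g h] u Au.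
  exact: (sA (h, g)).
- exact: (isV_admissible isV).
- by rewrite sz.
- by move=> x x0; rewrite addnC; exact: (isV_pos isV).
- by move=> x x0; rewrite addnC; exact: (isV_neg isV).
- by rewrite sz; exact: (isV_depth isV).
- by rewrite sz; exact: (isV_depth_min isV).
- have := isV_module isV; rewrite /= -sz; move: (yd_size M) => d.
  move=> [Phi [[Pfun Pinj Psurj] Pact PA PB]]; exists (Phi \o @swapf R d : {linear _ -> _}).
  split=> [|s t f Uf|i N f dN Uf|i N f dN Uf] /=.
  + split=> [f Uf|f g /set_mem Uf /set_mem Ug /= fg|u Ku].
    * by apply: Pfun; exact: swapf_tensor.
    * apply: (can_inj (@swapfK R d)); apply: Pinj => //; apply/mem_set; exact: swapf_tensor.
    * have [f Uf <-] := Psurj u Ku; exists (swapf f); first exact: swapf_tensor.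
      by rewrite /= swapfK.
  + by rewrite swapf_act2 Pact //; exact: swapf_tensor.
  + by rewrite swapf_jmA; apply: PB => //; exact: swapf_tensor.
  + by rewrite swapf_jmB; apply: PA => //; exact: swapf_tensor.
- by rewrite /= sz => v Kv n s; exact: (rres_char isV).
Qed.

Theorem theorem4p2p3 (R : realType) (H : hilbert R)
    (V : unitary_rep (Sinf * Sinf)%type H)
    (w : thoma R) (L M : young_dist R) (isV : is_V V w L M) :
  let zero_case := (gamma (alpha w) (beta w) < 1)%E \/
                   (forall i, 0 < alpha w i) \/ (forall i, 0 < beta w i) in
  (zero_case -> lAnn V = [set [fsfun]] /\ rAnn V = [set [fsfun]]) /\
  (~ zero_case -> VershikNessonov R ->
   forall m n : nat,
     is_max_index (alpha w) m -> is_max_index (beta w) n ->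
     is_I (inf_part m n (L 0)) (lAnn V) /\
     is_I (inf_part m n (M 0)) (rAnn V)).
Proof.
move=> zc; split=> [z|nz VN m n am bn].
  by split; [exact: (lAnn_zero isV z)|exact: (rAnn_zero isV z)].
split; first exact: (lAnn_nonzero isV nz VN am bn).
exact: (lAnn_nonzero (is_V_swap isV) nz VN am bn).
Qed.
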